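(* Let $m\ge 2$ be an integer. There are $\beta_1>0$ and $r'>1$ such that for any $\beta\in(0,\beta_1]$, $\varepsilon>0$ and $T>0$, there exists $\delta=\delta(m,\beta,\varepsilon,T)>0$ such that the following holds. If $\omega_0=\mathbf 1_{A_0}$ for some $m$-fold symmetric open set $A_0\subset\mathbb R^2$ satisfying $$\|\omega_0-\omega^{m,\beta}\|_{L^1(\mathbb R^2)}\le\delta\qquad\text{and}\qquad A_0\subset B_{r'},$$ then the solution $\omega(t)$ of the 2D Euler equations with initial data $\omega_0$ satisfies $$\sup_{t\in[0,T]}\big\|\omega(t)-\omega^{m,\beta}_{\Omega^{m,\beta}t}\big\|_{L^1(\mathbb R^2)}\le\varepsilon .$$
   Context: The 2D Euler equations in vorticity form on $\mathbb R^2$ are $\partial_t\omega+u\cdot\nabla\omega=0$, $u=-\nabla^\perp(-\Delta)^{-1}\omega$, where $(-\Delta)^{-1}\omega(x)=\frac1{2\pi}\int\ln\frac1{|x-x'|}\,\omega(x')\,dx'$ and the sign convention for $\nabla^\perp$ is such that positive vorticity induces counterclockwise rotation. For initial data $\omega_0=\mathbf 1_{A_0}$ with $A_0$ bounded and measurable, the solution is the unique global weak (Yudovich) solution; it has the form $\omega(t)=\mathbf 1_{A(t)}$, where $A(t)$ is the image of $A_0$ under the flow of $u$. $B_r$ is the open ball of radius $r$ centered at the origin; $(r,\theta)$ are polar coordinates; $R_\alpha$ is the counterclockwise rotation by angle $\alpha$ about the origin; $\omega_\alpha(x):=\omega(R_{-\alpha}x)$. A set $A\subset\mathbb R^2$ is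 $m$-fold symmetric if $R_{2\pi/m}[A]=A$. Kelvin waves (reference radius $1$): it is known that for each integer $m\ge2$ and each sufficiently small $\beta>0$ there is a (for small $\beta$ unique) smooth function $g^{m,\beta}$ of the form $g^{m,\beta}(\theta)=\beta\cos(m\theta)+o(\beta)$ as $\beta\to0$, where the $o(\beta)$ term consists only of modes $\cos(km\theta)$ with integers $k>1$, such that $\omega^{m,\beta}:=\mathbf 1_{A^{m,\beta}}$, $A^{m,\beta}:=\{(r,\theta): r<1+g^{m,\beta}(\theta)\}$, rotates uniformly: for some $\Omega^{m,\beta}\in\mathbb R$ the function $(t,x)\mapsto \omega^{m,\beta}_{\Omega^{m,\beta}t}(x)$ solves the Euler equations. Moreover $g^{m,\beta}\to0$ in $C^1$ and $\Omega^{m,\beta}\to\frac{m-1}{2m}$ as $\beta\to0$. $\omega^{m,\beta}$ is called the Kelvin $m$-wave with parameter $\beta$. *)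

(* Defs.v *)
From HB Require Import structures.
From mathcomp Require Import all_boot all_order all_algebra.
From mathcomp Require Import all_classical all_reals all_analysis.

Set Implicit Arguments.
Unset Strict Implicit.
Unset Printing Implicit Defensive.

Import Order.TTheory GRing.Theory Num.Theory.
Import numFieldNormedType.Exports.

Local Open Scope classical_set_scope.
Local Open Scope ring_scope.

Notation area := (lebesgue_measure \x lebesgue_measure)%E.

Section plane.
Context {R : realType}.
Implicit Types (x : R * R) (A : set (R * R)) (f h : R * R -> R).

(* The library norm on R * R is the max norm. *)
Definition enorm x : R := Num.sqrt (x.1 ^+ 2 + x.2 ^+ 2).

Definition eball (r : R) : set (R * R) := [set x | enorm x < r].

Definition polar (r theta : R) : R * R := (r * cos theta, r * sin theta).

Definition rotation (alpha : R) x : R * R :=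
  (cos alpha * x.1 - sin alpha * x.2, sin alpha * x.1 + cos alpha * x.2).

Definition rotated (alpha : R) f : R * R -> R :=
  fun x => f (rotation (- alpha) x).

Definition fold_symmetric (m : nat) A : Prop :=
  rotation (2 * pi / m%:R) @` A = A.

Definition L1_dist f h : \bar R := ('N[area]_1%:E [EFin \o (f \- h)%R])%E.

End plane.

Section euler.
Context {R : realType}.
Implicit Types (x : R * R) (w : R * R -> R) (omega : R -> R * R -> R).

Definition partial1 (f : R * R -> R) x : R := 'D_((1, 0) : R * R) f x.
Definition partial2 (f : R * R -> R) x : R := 'D_((0, 1) : R * R) f x.

(* (-Delta)^{-1} w; the value of [ln (1 / 0)] is irrelevant since the
   singularity is a null set. *)
Definition stream w x : R :=
  (2 * pi)^-1 * \int[area]_y (ln (1 / enorm (x - y)) * w y).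

(* - nabla^perp (-Delta)^{-1} w with nabla^perp = (- d_2, d_1): for w >= 0 the
   stream function decreases away from the support of w, so this choice gives a
   counterclockwise velocity. *)
Definition velocity w x : R * R :=
  (partial2 (stream w) x, - partial1 (stream w) x).

(* C^1 functions of (t, x) that are compactly supported in x. *)
Record test_function (phi : R -> R * R -> R) : Prop := {
  test_derivable_t : forall (t : R) x, derivable (phi ^~ x) t 1;
  test_derivable_1 : forall (t : R) x, derivable (phi t) x ((1, 0) : R * R);
  test_derivable_2 : forall (t : R) x, derivable (phi t) x ((0, 1) : R * R);
  test_continuous : continuous (fun z : R * (R * R) => phi z.1 z.2);
  test_continuous_t :
    continuous (fun z : R * (R * R) => derive1 (phi ^~ z.2) z.1);
  test_continuous_1 :
    continuous (fun z : R * (R * R) => partial1 (phi z.1) z.2);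
  test_continuous_2 :
    continuous (fun z : R * (R * R) => partial2 (phi z.1) z.2);
  test_support : exists r : R, forall t x, r <= enorm x -> phi t x = 0
}.

Definition material_derivative omega (phi : R -> R * R -> R) (t : R) x : R :=
  derive1 (phi ^~ x) t
  + (velocity (omega t) x).1 * partial1 (phi t) x
  + (velocity (omega t) x).2 * partial2 (phi t) x.

(* Global weak solutions on [0, +oo[ in the class of bounded functions with
   compact support (locally uniformly in time). *)
Record weak_solution (w0 : R * R -> R) omega : Prop := {
  weak_measurable : measurable_fun [set z : R * (R * R) | 0 <= z.1]
    (fun z : R * (R * R) => omega z.1 z.2);
  weak_bounded : forall T : R, exists M r : R,
    forall t : R, 0 <= t <= T ->
      {ae area, forall x, `|omega t x| <= M /\ (r <= enorm x -> omega t x = 0)};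
  weak_equation : forall phi, test_function phi -> forall t : R, 0 <= t ->
    \int[area]_x (omega t x * phi t x) - \int[area]_x (w0 x * phi 0 x)
    = \int[lebesgue_measure]_(s in `[0, t])
        \int[area]_x (omega s x * material_derivative omega phi s x)
}.

Record is_flow (u : R -> R * R -> R * R) (Phi : R -> R * R -> R * R) : Prop := {
  flow_init : forall x, Phi 0 x = x;
  flow_continuous : forall x, {within `[0, +oo[, continuous (Phi ^~ x)};
  flow_ode : forall x (t : R), 0 < t -> is_derive t 1 (Phi ^~ x) (u t (Phi t x))
}.

(* [omega] is (a representative of) the Yudovich solution with initial data
   the indicator function of [A0], for bounded measurable [A0]: the global weak
   solution, of the form \1_(A t) where [A t] is the image of [A0] under the
   flow of the velocity. *)
Definition yudovich_solution (A0 : set (R * R)) omega : Prop :=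
  weak_solution \1_A0 omega /\
  exists2 Phi, is_flow (fun t => velocity (omega t)) Phi &
    forall t : R, 0 <= t ->
      {ae area, forall x, omega t x = \1_(Phi t @` A0) x}.

End euler.

Section kelvin.
Context {R : realType}.

Definition kelvin_set (g : R -> R) : set (R * R) :=
  [set x | exists r theta, [/\ 0 <= r, r < 1 + g theta & x = polar r theta]].

Definition kelvin_wave (g : R -> R) : R * R -> R := \1_(kelvin_set g).

(* [g beta] and [Omega beta] are the boundary profile g^{m,beta} and the angular
   velocity Omega^{m,beta} of the Kelvin m-wave with parameter [beta]; only
   their values for small [beta] > 0 matter. *)
Record kelvin_family (m : nat) (g : R -> R -> R) (Omega : R -> R) : Prop := {
  kelvin_smooth : \forall beta \near (0 : R)^'+,
    forall n (theta : R), derivable (derive1n n (g beta)) theta 1;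
  kelvin_modes : \forall beta \near (0 : R)^'+, exists a : nat -> R,
    forall theta,
      (fun n => \sum_(2 <= k < n) a k * cos ((k * m)%:R * theta)) @ \oo
        --> g beta theta - beta * cos (m%:R * theta);
  kelvin_littleo : forall e : R, 0 < e -> \forall beta \near (0 : R)^'+,
    forall theta, `|g beta theta - beta * cos (m%:R * theta)| <= e * beta;
  kelvin_cvgC1 : forall e : R, 0 < e -> \forall beta \near (0 : R)^'+,
    forall theta, `|g beta theta| <= e /\ `|derive1 (g beta) theta| <= e;
  kelvin_cvg_Omega :
    Omega beta @[beta --> (0 : R)^'+] --> ((m%:R - 1) / (2 * m%:R) : R);
  kelvin_rotates : \forall beta \near (0 : R)^'+,
    yudovich_solution (kelvin_set (g beta))
      (fun t => rotated (Omega beta * t) (kelvin_wave (g beta)))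
}.

End kelvin.

(* Main.v *)
From HB Require Import structures.
Require Import Defs.
From mathcomp Require Import all_boot all_order all_algebra.
From mathcomp Require Import all_classical all_reals all_analysis.
From mathcomp Require Import measurable_realfun.
From mathcomp Require Import ring lra.
Import Order.TTheory GRing.Theory Num.Theory.
Import numFieldNormedType.Exports.
Local Open Scope classical_set_scope.
Local Open Scope ring_scope.
Set Implicit Arguments.
Unset Strict Implicit.
Unset Printing Implicit Defensive.


(** On a bounded time interval, stability follows from a functional that controls
the L1 distance of the solution to the rotating patch, and whose rate of change
is quadratic in this distance up to a logarithm.

Let [K] be the patch of a Kelvin wave, let [Psi] be its relative stream function,
that is the stream function of [\1_K] plus [Omega * |x| ^ 2 / 2], and read all
solutions in the frame that rotates with angular velocity [Omega]. There, [\1_K]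
is a steady flow whose particles follow the level lines of [Psi]. For small
[beta] the patch is close to the unit disk, for which the outward derivative of
the relative stream function on the unit circle is [Omega - 1 / 2], and the limit
of [Omega] is below [1 / 2]. So [Psi] decreases strictly along rays near the unit
circle ([near_disk_radial]). Since the flow is steady, [Psi] is equal to a
constant [c] on the boundary of [K] ([boundary_value_constant]), hence near the
unit circle [K] is the set where [Psi] exceeds [c].

Let [l] be a truncation of a multiple of [Psi - c], and consider for [0 <= w <= 1]
the defect, the integral of [(\1_K - w) * (spline l - 8)], where the spline is
increasing and takes the value 8 at 0. The integrand is nonnegative, and as the
band [|l| <= s] has area of order [s] ([level_band_area], by the divergence
theorem), the distance is at most of order the square root of the defect
([patch_defect_bounds]).

Mass is conserved, so the defect changes in time only through the integral of
[w * spline l]. Write [w = \1_K + rho]. In its rate of change the terms linear in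
[rho] cancel: the velocity of the patch is tangent to the level lines of [l], and
stationarity of the patch can be tested with the weight times the logarithmic
kernel ([stationary_kernel]). What remains is a quadratic form in [rho] whose
kernel, once symmetrised, has only a logarithmic singularity, because the
velocity is log-Lipschitz ([weighted_field_modulus]). Cutting the singularity off
at distance [eta] bounds the rate in terms of the L1 norm of [rho] and of [eta]
([quadratic_estimate]).

With the cut-off at the fourth root of the defect [F] this becomes the inequality
[F' <= C * F * (1 + ln (1 / F))] of Osgood type. Its solutions remain arbitrarily
small on the time interval if they start small enough ([growth_comparison],
[osgood_curve], [patch_stability]). *)

(** * Area-preserving maps of the plane *)

Section measure_preservation.
Context {R : realType}.
Local Notation leb := (@lebesgue_measure R).
Local Notation plane := (measurableTypeR R * measurableTypeR R)%type.

Lemma lebesgue_measure_shift (a : R) (A : set R) :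
  measurable A ->
  pushforward leb ((fun x => x + a) : R -> measurableTypeR R) A = leb A.
Proof.
move=> mA.
have mf : measurable_fun [set: R] ((fun x => x + a) : R -> measurableTypeR R).
  exact: measurable_funD.
apply/esym; move: A mA; apply: (lebesgue_measure_unique (mu := pushforward leb ((fun x => x + a) : R -> measurableTypeR R))) => //.
move=> _ [[b c]] _ <-.
rewrite /pushforward.
rewrite [X in _ = lebesgue_measure X](_ : _ = `](b - a), (c - a)]%classic); last first.
  by apply/seteqP; split => x /=; rewrite !in_itv/= ltrBlDr lerBrDr.
rewrite !lebesgue_measure_itv/= !lte_fin ltrD2r; case: ifPn => // _.
by rewrite -!EFinD; congr EFin; ring.
Qed.

Definition area_preserving (T : R * R -> R * R) :=
  measurable_fun [set: plane] (T : plane -> plane) /\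
  forall A : set plane, measurable A -> area (T @^-1` A) = area A.

Lemma area_preserving_comp S T : area_preserving S -> area_preserving T ->
  area_preserving (S \o T).
Proof.
move=> [mS hS] [mT hT]; split.
  exact: (measurableT_comp (mS : measurable_fun setT (S : plane -> plane))).
move=> A mA; rewrite comp_preimage hT ?hS//.
by rewrite -[X in measurable X]setTI; exact: mS.
Qed.

Lemma area_preserving_swap : area_preserving (fun x => (x.2, x.1)).
Proof.
have mT : measurable_fun [set: plane] ((fun x => (x.2, x.1)) : plane -> plane).
  exact: measurable_fun_pair.
split=> // A mA.
apply/esym; move: A mA.
apply: (product_measure_unique (m' := pushforward area ((fun x => (x.2, x.1)) : plane -> plane))) => //.
move=> A B mA mB; rewrite /= /pushforward.
have -> : ((fun x => (x.2, x.1)) : plane -> plane) @^-1` (A `*` B) = B `*` A.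
  by apply/seteqP; split => -[x y] /= [].
by rewrite product_measure1E// muleC.
Qed.

Lemma area_preserving_shear (h : R -> R) : measurable_fun [set: R] h ->
  area_preserving (fun x => (x.1, x.2 + h x.1)).
Proof.
move=> mh.
have mT : measurable_fun [set: plane] ((fun x => (x.1, x.2 + h x.1)) : plane -> plane).
  apply: measurable_fun_pair => //; apply: measurable_funD => //.
  exact: measurableT_comp.
split=> // A mA.
rewrite /product_measure1; apply: eq_integral => x _ /=.
rewrite (_ : xsection _ _ = (fun y => y + h x) @^-1` (xsection A x)); last first.
  by apply/seteqP; split => y; rewrite /xsection/= !inE.
apply: lebesgue_measure_shift.
exact: measurable_xsection.
Qed.

Lemma area_preserving_ext (S T : R * R -> R * R) :
  S =1 T -> area_preserving S -> area_preserving T.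
Proof. by move/funext => ->. Qed.

Lemma area_preserving_shear1 (h : R -> R) : measurable_fun [set: R] h ->
  area_preserving (fun x => (x.1 + h x.2, x.2)).
Proof.
move=> mh; apply: (area_preserving_ext _ (area_preserving_comp
  area_preserving_swap (area_preserving_comp (area_preserving_shear mh)
   area_preserving_swap))).
by [].
Qed.

Lemma area_preserving_translation (a : R * R) :
  area_preserving (fun x => x + a).
Proof.
apply: (area_preserving_ext _ (area_preserving_comp
  (@area_preserving_shear (cst a.2) _) (@area_preserving_shear1 (cst a.1) _))) => //.
Qed.

(** Apart from the half turn, a rotation is a product of three shears; the half
turn is the square of the quarter turn. *)
Lemma area_preserving_unit_matrix (c s : R) : c ^+ 2 + s ^+ 2 = 1 ->
  area_preserving (fun x => (c * x.1 - s * x.2, s * x.1 + c * x.2)).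
Proof.
have generic c' s' : c' ^+ 2 + s' ^+ 2 = 1 -> c' != -1 ->
    area_preserving (fun x => (c' * x.1 - s' * x.2, s' * x.1 + c' * x.2)).
  move=> cs cN1.
  have c0 : 1 + c' != 0 by rewrite addrC addr_eq0.
  pose t := s' / (1 + c').
  have S1 : area_preserving (fun x => (x.1 + (- t * x.2), x.2)).
    by apply: (@area_preserving_shear1 (fun u => - t * u)); exact: measurable_funM.
  have S2 : area_preserving (fun x => (x.1, x.2 + s' * x.1)).
    by apply: (@area_preserving_shear (fun u => s' * u)); exact: measurable_funM.
  apply: (area_preserving_ext _ (area_preserving_comp S1 (area_preserving_comp S2 S1))).
  have ts : t * s' = 1 - c'.
    rewrite /t mulrAC -expr2 (_ : s' ^+ 2 = (1 - c') * (1 + c')); first by rewrite mulfK.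
    by rewrite -subr_sqr expr1n -cs; ring.
  have tc : t * (1 + c') = s' by rewrite /t divfK.
  by move=> [x y] /=; congr pair; [rewrite -[in RHS]tc|]; ring: ts.
move=> cs; have [cN1|/eqP ?] := boolP (c == -1); last exact/generic/eqP.
have Q := @generic 0 1.
apply: (area_preserving_ext _ (area_preserving_comp (Q _ _) (Q _ _))) => //.
- have s0 : s = 0.
    by apply/eqP; rewrite -sqrf_eq0; apply/eqP; move: cs; rewrite (eqP cN1) sqrrN expr1n; lra.
  by move=> [x y] /=; rewrite (eqP cN1) s0; congr pair; ring.
- by rewrite expr0n expr1n add0r.
- by rewrite eq_sym oppr_eq0 oner_eq0.
- by rewrite expr0n expr1n add0r.
- by rewrite eq_sym oppr_eq0 oner_eq0.
Qed.

Lemma area_preserving_rotation (alpha : R) : area_preserving (rotation alpha).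
Proof. exact/area_preserving_unit_matrix/cos2Dsin2. Qed.

Lemma area_preserving_reflection (a : R * R) : area_preserving (fun x => a - x).
Proof.
apply: (area_preserving_ext _ (area_preserving_comp
  (area_preserving_translation a) (@area_preserving_unit_matrix (-1) 0 _))).
  by move=> [x y]; rewrite /= !mul0r !mulN1r subr0 add0r addrC.
by rewrite sqrrN expr1n expr0n addr0.
Qed.

Lemma area_preserving_ge0 (T : R * R -> R * R) (f : R * R -> \bar R) :
  area_preserving T -> measurable_fun [set: plane] f ->
  (forall x, (0 <= f x)%E) ->
  (\int[area]_x f (T x) = \int[area]_x f x)%E.
Proof.
move=> [mT hT] mf f0.
have := @ge0_integral_pushforward _ _ _ _ R (T : plane -> plane) mT area setT f measurableT mf.
move=> /(_ (fun x _ => f0 x)).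
rewrite preimage_setT => <-.
apply: eq_measure_integral => A mA _.
exact: hT.
Qed.

Lemma area_preserving_integral (T : R * R -> R * R) (f : R * R -> R) :
  area_preserving T -> measurable_fun [set: plane] f ->
  \int[area]_x f (T x) = \int[area]_x f x.
Proof.
move=> hT mf; rewrite /Rintegral; congr fine.
rewrite integralE [RHS]integralE; congr (_ - _)%E.
  rewrite -[RHS](area_preserving_ge0 (f := (EFin \o f)^\+%E) hT)//.
    by apply: eq_integral => x _; rewrite /= !funeposE.
  by apply: measurable_funepos; exact: measurableT_comp.
rewrite -[RHS](area_preserving_ge0 (f := (EFin \o f)^\-%E) hT)//.
  by apply: eq_integral => x _; rewrite /= !funenegE.
by apply: measurable_funeneg; exact: measurableT_comp.
Qed.

Lemma area_preserving_integrable (T : R * R -> R * R) (f : R * R -> R) :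
  area_preserving T ->
  area.-integrable setT (EFin \o f) -> area.-integrable setT (EFin \o (f \o T)).
Proof.
move=> hT /integrableP[mf intf]; apply/integrableP; split.
  exact: (measurableT_comp mf (hT.1 : measurable_fun setT (T : plane -> plane))).
rewrite (area_preserving_ge0 (f := abse \o (EFin \o f)) hT)//.
  exact: measurableT_comp.
by move=> x /=; rewrite lee_fin.
Qed.

End measure_preservation.

(** * Real-valued integrals, and slices by the max norm *)

Section real_integrals.
Context d (T : measurableType d) {R : realType} (mu : {measure set T -> \bar R}).
Implicit Types f g : T -> R.

Lemma integrable_dominated f g : measurable_fun setT f ->
  mu.-integrable setT (EFin \o g) -> (forall x, `|f x| <= g x) ->
  mu.-integrable setT (EFin \o f).
Proof.
move=> mf ig fg; apply: le_integrable ig => //; first exact: measurableT_comp.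
by move=> x _ /=; rewrite lee_fin (le_trans (fg x))// ler_norm.
Qed.

Lemma normr_Rintegral_le f g : mu.-integrable setT (EFin \o f) ->
  mu.-integrable setT (EFin \o g) -> (forall x, `|f x| <= g x) ->
  `|\int[mu]_x f x| <= \int[mu]_x g x.
Proof.
move=> If Ig fg; apply: le_trans (le_normr_Rintegral _ If) _ => //.
apply: le_Rintegral => //.
exact: integrable_norm.
Qed.

Lemma integrable_funD f g : mu.-integrable setT (EFin \o f) ->
  mu.-integrable setT (EFin \o g) ->
  mu.-integrable setT (EFin \o (fun x => f x + g x)).
Proof.
move=> If Ig; have := integrableD measurableT If Ig.
by apply: eq_integrable => // y _ /=; rewrite EFinD.
Qed.

Lemma integrable_funB f g : mu.-integrable setT (EFin \o f) ->
  mu.-integrable setT (EFin \o g) ->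
  mu.-integrable setT (EFin \o (fun x => f x - g x)).
Proof.
move=> If Ig; have := integrableB measurableT If Ig.
by apply: eq_integrable => // y _ /=; rewrite EFinB.
Qed.

Lemma integrable_funZ f (k : R) : mu.-integrable setT (EFin \o f) ->
  mu.-integrable setT (EFin \o (fun x => k * f x)).
Proof.
move=> If; have := integrableZl measurableT k If.
by apply: eq_integrable => // y _ /=; rewrite EFinM.
Qed.

Lemma integrable_measurable f : mu.-integrable setT (EFin \o f) ->
  measurable_fun setT f.
Proof. by case/integrableP => /measurable_EFinP. Qed.

Lemma integrable_ge0_le f (C : R) : measurable_fun setT f ->
  (forall x, 0 <= f x) -> (\int[mu]_x (f x)%:E <= C%:E)%E ->
  mu.-integrable setT (EFin \o f).
Proof.
move=> mf f0 fC; apply/integrableP; split; first exact: measurableT_comp.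
under eq_integral do rewrite /= ger0_norm//.
by rewrite (le_lt_trans fC)// ltry.
Qed.

Lemma Rintegral_ge0_le f (C : R) : (forall x, 0 <= f x) ->
  (\int[mu]_x (f x)%:E <= C%:E)%E -> \int[mu]_x f x <= C.
Proof.
move=> f0 fC; rewrite /Rintegral -lee_fin fineK//.
rewrite ge0_fin_numE; first by rewrite (le_lt_trans fC)// ltry.
by apply: integral_ge0 => x _; rewrite lee_fin.
Qed.

Lemma measurable_normr_le f (s : R) : measurable_fun setT f ->
  measurable [set x | `|f x| <= s].
Proof.
move=> mf; have : measurable_fun setT (fun x => `|f x| <= s).
  by apply: measurable_fun_ler => //; exact: measurableT_comp.
move=> /(_ measurableT [set true] I); rewrite setTI.
by congr (measurable _); apply/seteqP; split.
Qed.

End real_integrals.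

Section maxnorm_slices.
Context {R : realType}.
Local Notation leb := (@lebesgue_measure R).
Local Notation plane := (measurableTypeR R * measurableTypeR R)%type.
Implicit Type f : R -> R.

Definition maxnorm (x : R * R) : R := Num.max `|x.1| `|x.2|.

Lemma measurable_maxnorm : measurable_fun [set: plane] (maxnorm : plane -> R).
Proof. by apply: measurable_maxr; apply: measurableT_comp. Qed.

Lemma integral_even_le f : measurable_fun setT f -> (forall t, 0 <= f t) ->
  (\int[leb]_t (f `|t|)%:E <= 2%:E * \int[leb]_(t in `[0%R, +oo[) (f t)%:E)%E.
Proof.
move=> mf f0.
pose G (t : measurableTypeR R) : \bar R := (if 0 <= t then f t else 0)%:E.
have mG : measurable_fun setT G.
  apply/measurable_EFinP; apply: measurable_fun_if => //.
    exact: measurable_fun_ler.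
  exact: measurable_funTS.
have G0 t : (0 <= G t)%E by rewrite /G lee_fin; case: ifP.
have -> : (\int[leb]_(t in `[0%R, +oo[) (f t)%:E = \int[leb]_t G t)%E.
  rewrite integral_mkcond; apply: eq_integral => t _.
  by rewrite patchE mem_setE in_itv/= andbT /G; case: ifP.
have GN : (\int[leb]_t G (- t)%R = \int[leb]_t G t)%E.
  have mN : measurable_fun setT ((-%R) : measurableTypeR R -> measurableTypeR R) by [].
  have := @ge0_integral_pushforward _ _ _ _ R _ mN leb setT G measurableT mG.
  move=> /(_ (fun x _ => G0 x)); rewrite preimage_setT => <-.
  apply: eq_measure_integral => A mA _; exact/lebesgue_measureN.
rewrite (_ : (2%:E * _ = \int[leb]_t (G t + G (- t)%R))%E); last first.
  rewrite ge0_integralD//; first by rewrite GN mule_natl mule2n.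
  by apply: (measurableT_comp mG).
apply: ge0_le_integral => //.
- by move=> t _; rewrite lee_fin.
- apply/measurable_EFinP; apply: (measurableT_comp mf); exact: normr_measurable.
- apply: emeasurable_funD => //; exact: (measurableT_comp mG).
- move=> t _; rewrite /G -EFinD lee_fin.
  have [t0|t0] := leP 0 t.
    by rewrite ger0_norm// lerDl; case: ifP.
  have h : 0 <= - (t : R) by rewrite oppr_ge0 ltW.
  by rewrite h add0r (ltr0_norm (t0 : (t : R) < 0)).
Qed.

Lemma integral_slice_le f : measurable_fun setT f -> (forall t, 0 <= f t) ->
  (\int[area]_z (if `|z.1| <= `|z.2| then f `|z.2| else 0)%:E =
   \int[leb]_t (2 * (`|t| * f `|t|))%:E)%E.
Proof.
move=> mf f0.
pose F (z : plane) := (if `|z.1| <= `|z.2| then f `|z.2| else 0)%:E.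
have mF : measurable_fun setT F.
  apply/measurable_EFinP; apply: measurable_fun_if => //.
  - apply: measurable_fun_ler; exact: measurableT_comp.
  - by apply: measurable_funTS; apply: (measurableT_comp mf); apply: measurableT_comp.
have F0 z : (0 <= F z)%E by rewrite /F; case: ifP; rewrite lee_fin.
rewrite (fubini_tonelli2 F)//; apply: eq_integral => t _.
rewrite /fubini_G /F/=.
rewrite (_ : (fun x : R => _) = (fun x => (f `|t|)%:E * (\1_(`[- `|t|, `|t|]%classic : set R) x)%:E)%E); last first.
  apply/funext => x; rewrite indicE mem_setE in_itv/= -ler_norml.
  by case: ifP => _; rewrite ?mule1 ?mule0.
rewrite ge0_integralZl//; last 2 first.
  by apply/measurable_EFinP; exact: measurable_indic.
  by rewrite lee_fin.
rewrite integral_indic//= setIT lebesgue_measure_itv/= lte_fin.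
case: ifPn => [_|].
  rewrite -EFinD -EFinM; congr EFin; ring.
rewrite -leNgt => h.
have -> : `|t| = 0 by apply/eqP; rewrite eq_le normr_ge0 andbT; lra.
by rewrite mul0r mulr0 mule0.
Qed.

(** A substitute for polar coordinates: the plane is the union of the two double
cones on which one of the coordinates dominates. They are exchanged by the
swap, and on each of them Fubini integrates a function of the dominating
coordinate [t] along a segment of length [2 * `|t|]. *)
Lemma maxnorm_integral_le f (rho : R) : 0 <= rho -> measurable_fun setT f ->
  (forall t, 0 <= f t) -> (forall t, rho < t -> f t = 0) ->
  (\int[area]_z (f (maxnorm z))%:E <=
   8%:E * \int[leb]_(t in `[0%R, rho]) (t * f t)%:E)%E.
Proof.
move=> rho0 mf f0 frho.
pose F (z : plane) := (if `|z.1| <= `|z.2| then f `|z.2| else 0)%:E.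
have mF : measurable_fun setT F.
  apply/measurable_EFinP; apply: measurable_fun_if => //.
  - apply: measurable_fun_ler; exact: measurableT_comp.
  - by apply: measurable_funTS; apply: (measurableT_comp mf); apply: measurableT_comp.
have F0 z : (0 <= F z)%E by rewrite /F; case: ifP; rewrite lee_fin.
pose S (z : plane) : plane := (z.2, z.1).
have mS : measurable_fun setT S by exact: measurable_fun_pair.
have IS : (\int[area]_z F (S z) = \int[area]_z F z)%E.
  exact: (area_preserving_ge0 area_preserving_swap).
apply: (@le_trans _ _ (\int[area]_z (F z + F (S z)))%E).
  apply: ge0_le_integral => //.
  - by move=> z _; rewrite lee_fin.
  - by apply/measurable_EFinP; exact: (measurableT_comp mf measurable_maxnorm).
  - apply: emeasurable_funD => //; exact: (measurableT_comp mF).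
  - move=> [x y] _; rewrite /F /S /maxnorm/= -EFinD lee_fin.
    have [xy|/ltW yx] := leP `|x| `|y|.
      by rewrite lerDl; case: ifP.
    by rewrite add0r yx.
rewrite ge0_integralD//; last exact: (measurableT_comp mF).
rewrite IS /F integral_slice_le//.
have mtf : measurable_fun setT (fun t : R => `|t| * f `|t|).
  apply: measurable_funM; first exact: normr_measurable.
  by apply: (measurableT_comp mf); exact: normr_measurable.
under eq_integral do rewrite EFinM.
rewrite ge0_integralZl//; last 2 first.
  by apply/measurable_EFinP.
  by move=> t _; rewrite lee_fin mulr_ge0.
have mt' : measurable_fun setT (fun t : R => `|t| * f t).
  by apply: measurable_funM => //; exact: normr_measurable.
have /= := @integral_even_le (fun t => `|t| * f t) mt'.
under eq_integral do rewrite normr_id.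
move=> /(_ (fun t => mulr_ge0 (normr_ge0 t) (f0 t))) h.
have -> : (\int[leb]_(t in `[0%R, rho]) (t * f t)%:E = \int[leb]_(t in `[0%R, +oo[) (`|t| * f t)%:E)%E.
  rewrite integral_mkcond [RHS]integral_mkcond; apply: eq_integral => t _.
  rewrite !patchE !mem_setE !in_itv/= andbT.
  have [t0|] //= := leP 0 t; rewrite ger0_norm//.
  by case: (leP t rho) => // /frho ->; rewrite mulr0.
set I := (\int[leb]_(t in `[0%R, +oo[) _)%E in h *.
set L := (\int[leb]_t _)%E in h *.
have -> : (2%:E * L + 2%:E * L = 4%:E * L)%E.
  rewrite -ge0_muleDl ?lee_fin// -EFinD; congr (_%:E * _)%E; ring.
have -> : (8%:E * I = 4%:E * (2%:E * I))%E.
  by rewrite muleA -EFinM; congr (_%:E * _)%E; ring.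
by apply: lee_wpmul2l.
Qed.

End maxnorm_slices.

(** * The Euclidean norm and its singular powers *)

Section euclidean_norm.
Context {R : realType}.
Implicit Types x y : R * R.

Definition dot x y : R := x.1 * y.1 + x.2 * y.2.

Lemma enorm_ge0 x : 0 <= enorm x. Proof. exact: sqrtr_ge0. Qed.

Lemma sqr_enorm x : enorm x ^+ 2 = x.1 ^+ 2 + x.2 ^+ 2.
Proof. by rewrite sqr_sqrtr// addr_ge0// sqr_ge0. Qed.

Lemma enorm_le x (c : R) : 0 <= c -> (enorm x <= c) = (x.1 ^+ 2 + x.2 ^+ 2 <= c ^+ 2).
Proof. by move=> c0; rewrite -sqr_enorm ler_pXn2r// nnegrE enorm_ge0. Qed.

Lemma enorm_eq0 x : (enorm x == 0) = (x == 0).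
Proof.
rewrite -sqrf_eq0 sqr_enorm paddr_eq0 ?sqr_ge0// !sqrf_eq0.
by case: x => a b.
Qed.

Lemma enorm_gt0 x : (0 < enorm x) = (x != 0).
Proof. by rewrite lt_neqAle enorm_ge0 andbT eq_sym enorm_eq0. Qed.

Lemma enormN x : enorm (- x) = enorm x.
Proof. by rewrite /enorm /= !sqrrN. Qed.

Lemma enormBC x y : enorm (x - y) = enorm (y - x).
Proof. by rewrite -enormN opprB. Qed.

Lemma normr_dot_le x y : `|dot x y| <= enorm x * enorm y.
Proof.
rewrite -(@ler_pXn2r _ 2)// ?nnegrE ?mulr_ge0 ?enorm_ge0//.
rewrite exprMn !sqr_enorm real_normK ?num_real// /dot.
have := sqr_ge0 (x.1 * y.2 - x.2 * y.1); nra.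
Qed.

Lemma ler_enormD x y : enorm (x + y) <= enorm x + enorm y.
Proof.
rewrite enorm_le ?addr_ge0 ?enorm_ge0//.
have := ler_normlW (normr_dot_le x y); rewrite /dot => h.
have hx := sqr_enorm x; have hy := sqr_enorm y.
rewrite [leRHS]sqrrD hx hy /=; nra.
Qed.

Lemma ler_enormB x y : enorm (x - y) <= enorm x + enorm y.
Proof. by rewrite (le_trans (ler_enormD _ _))// enormN. Qed.

Lemma ler_dist_enorm x y z : enorm (x - z) <= enorm (x - y) + enorm (y - z).
Proof. by rewrite (le_trans _ (ler_enormD _ _))// addrA subrK. Qed.

Lemma ler_enorm1 x : `|x.1| <= enorm x.
Proof.
by rewrite -(@ler_pXn2r _ 2)// ?nnegrE ?enorm_ge0// sqr_enorm real_normK ?num_real// lerDl sqr_ge0.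
Qed.

Lemma ler_enorm2 x : `|x.2| <= enorm x.
Proof.
by rewrite -(@ler_pXn2r _ 2)// ?nnegrE ?enorm_ge0// sqr_enorm real_normK ?num_real// lerDr sqr_ge0.
Qed.

Lemma maxnorm_le_enorm x : maxnorm x <= enorm x.
Proof. by rewrite /maxnorm ge_max ler_enorm1 ler_enorm2. Qed.

Lemma enorm_le_maxnorm x : enorm x <= 2 * maxnorm x.
Proof.
have m0 : 0 <= maxnorm x by rewrite le_max normr_ge0.
have h1 : `|x.1| <= maxnorm x by rewrite le_max lexx.
have h2 : `|x.2| <= maxnorm x by rewrite le_max lexx orbT.
rewrite enorm_le ?mulr_ge0//.
rewrite -(@real_normK _ x.1) ?num_real// -(@real_normK _ x.2) ?num_real//.
have := normr_ge0 x.1; have := normr_ge0 x.2; nra.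
Qed.

Lemma maxnorm_eq0 x : (maxnorm x == 0) = (x == 0).
Proof.
apply/eqP/eqP => [m0|->]; last by rewrite /maxnorm normr0 maxxx.
apply/eqP; rewrite -enorm_eq0 eq_le enorm_ge0 andbT.
by rewrite (le_trans (enorm_le_maxnorm _))// m0 mulr0.
Qed.

Lemma enorm_rotation (a : R) x : enorm (rotation a x) = enorm x.
Proof.
apply/eqP; rewrite -(eqrXn2 (n := 2)) ?enorm_ge0//; apply/eqP; rewrite !sqr_enorm /=.
have := cos2Dsin2 a; set c := cos a; set s := sin a => h.
transitivity ((c ^+ 2 + s ^+ 2) * (x.1 ^+ 2 + x.2 ^+ 2)); last by rewrite h mul1r.
ring.
Qed.

Lemma enorm_polar (r t : R) : 0 <= r -> enorm (polar r t) = r.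
Proof.
move=> r0; apply/eqP; rewrite -(eqrXn2 (n := 2)) ?enorm_ge0//; apply/eqP; rewrite sqr_enorm /=.
by rewrite !exprMn -mulrDr cos2Dsin2 mulr1.
Qed.

Lemma measurable_enorm : measurable_fun [set: measurableTypeR R * measurableTypeR R] (@enorm R).
Proof.
apply: (measurableT_comp (continuous_measurable_fun (@sqrt_continuous R))).
by apply: measurable_funD; apply: measurable_funX.
Qed.

Lemma measurable_funV d (T : measurableType d) (f : T -> R) :
  measurable_fun setT f -> (forall t, 0 <= f t) ->
  measurable_fun setT (fun t => (f t)^-1).
Proof.
move=> mf f0.
have -> : (fun t => (f t)^-1) = (fun t => f t `^ (-1)).
  by apply/funext => x; rewrite powR_inv1.
exact: (measurableT_comp (measurable_powR (-1))).
Qed.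

End euclidean_norm.

Section singular_integrals.
Context {R : realType}.
Local Notation leb := (@lebesgue_measure R).
Local Notation plane := (measurableTypeR R * measurableTypeR R)%type.

Lemma is_derive_continuous1 (f : R -> R) (t a : R) :
  is_derive t 1 f a -> {for t, continuous f}.
Proof.
by move=> H; apply/differentiable_continuous/derivable1_diffP; exact: ex_derive.
Qed.

Lemma is_derive_mulr (c t : R) : is_derive t 1 (fun s : R => s * c) c.
Proof.
have := is_deriveM (is_derive_id t 1) (is_derive_cst c t 1).
by rewrite /GRing.scale/= mulr0 add0r mulr1.
Qed.

Lemma is_derive_addr (c t : R) : is_derive t 1 (fun s : R => s + c) 1.
Proof. by apply: is_derive_eq; rewrite addr0. Qed.

Lemma is_derive_FTC2 (F f : R -> R) (a b : R) : a < b ->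
  {within `[a, b], continuous f} ->
  (forall t, a <= t <= b -> is_derive t 1 F (f t)) ->
  (\int[leb]_(t in `[a, b]) (f t)%:E = (F b - F a)%:E)%E.
Proof.
move=> ab cf dF; rewrite (@continuous_FTC2 _ f F)//.
- have cF t : a <= t <= b -> {for t, continuous F}.
    by move=> /dF; exact: is_derive_continuous1.
  split.
  + move=> t; rewrite in_itv/= => /andP[at' tb].
    by have := dF t; rewrite !ltW//= => /(_ isT) h; exact: ex_derive.
  + by apply: cvg_at_right_filter; apply: cF; rewrite lexx ltW.
  + by apply: cvg_at_left_filter; apply: cF; rewrite lexx ltW.
- move=> t; rewrite in_itv/= => /andP[at' tb].
  have := dF t; rewrite !ltW//= => /(_ isT) h.
  by rewrite derive1E; exact: derive_val.
Qed.

Definition sing (rho : R) (z : R * R) : R :=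
  if enorm z <= rho then (enorm z)^-1 else 0.

(** The product of the singularities [1 / |z|] and [1 / |z'|] at two points of
distance [2 * d], as seen from the nearer one: the other distance is then at
least [max (|z|, d)]. *)
Definition sing2 (rho d : R) (z : R * R) : R :=
  if enorm z <= rho then (enorm z * Num.max (enorm z) d)^-1 else 0.

Lemma sing_ge0 rho z : 0 <= sing rho z.
Proof. by rewrite /sing; case: ifP => // _; rewrite invr_ge0 enorm_ge0. Qed.

Lemma sing2_ge0 rho d z : 0 <= sing2 rho d z.
Proof.
rewrite /sing2; case: ifP => // _.
by rewrite invr_ge0 mulr_ge0 ?enorm_ge0// le_max enorm_ge0.
Qed.

Lemma measurable_sing rho : measurable_fun [set: plane] (sing rho).
Proof.
apply: measurable_fun_if => //.
- exact: measurable_fun_ler measurable_enorm _.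
- apply: measurable_funTS; apply: measurable_funV; first exact: measurable_enorm.
  exact: enorm_ge0.
Qed.

Lemma measurable_sing2 rho d : measurable_fun [set: plane] (sing2 rho d).
Proof.
apply: measurable_fun_if => //.
- exact: measurable_fun_ler measurable_enorm _.
- apply: measurable_funTS; apply: measurable_funV.
    apply: measurable_funM; first exact: measurable_enorm.
    by apply: measurable_maxr => //; exact: measurable_enorm.
  by move=> x; rewrite mulr_ge0 ?enorm_ge0// le_max enorm_ge0.
Qed.

Lemma integral_sing_le rho : 0 <= rho ->
  (\int[area]_z (sing rho z)%:E <= (8 * rho)%:E)%E.
Proof.
move=> rho0.
pose f (t : R) : R := if 0 <= t <= rho then t^-1 else 0.
have f0 t : 0 <= f t.
  by rewrite /f; case: ifP => // /andP[t0 _]; rewrite invr_ge0.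
have fE : f = (fun t => (if 0 <= t <= rho then t else 0)^-1).
  by apply/funext => t; rewrite /f; case: ifP; rewrite ?invr0.
have mf : measurable_fun setT f.
  rewrite fE; apply: measurable_funV; last by move=> t; case: ifP => // /andP[].
  apply: measurable_fun_if => //.
  by apply: measurable_and; apply: measurable_fun_ler.
apply: (@le_trans _ _ (\int[area]_z (f (maxnorm z))%:E)%E).
  apply: ge0_le_integral => //.
  - by move=> z _; rewrite lee_fin sing_ge0.
  - by apply/measurable_EFinP; exact: measurable_sing.
  - by apply/measurable_EFinP; exact: (measurableT_comp mf measurable_maxnorm).
  - move=> z _; rewrite lee_fin /sing /f.
    have m0 : 0 <= maxnorm z by rewrite le_max normr_ge0.
    case: ifPn => zr; last by rewrite m0; case: ifP => // _; rewrite invr_ge0.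
    rewrite m0 (le_trans (maxnorm_le_enorm _) zr)/=.
    have [->|z0] := eqVneq z 0.
      by rewrite /enorm/= expr0n/= addr0 sqrtr0 /maxnorm normr0 maxxx.
    by rewrite lef_pV2 ?posrE ?maxnorm_le_enorm ?enorm_gt0// lt_neqAle m0 eq_sym maxnorm_eq0 z0.
have frho t : rho < t -> f t = 0.
  by move=> rt; rewrite /f (leNgt t) rt andbF.
apply: (le_trans (maxnorm_integral_le rho0 mf f0 frho)).
rewrite EFinM; apply: lee_wpmul2l => //.
apply: (@le_trans _ _ (\int[leb]_(t in `[0%R, rho]) (cst 1%:E t))%E).
  apply: ge0_le_integral => //.
  - by move=> t /=; rewrite in_itv/= => /andP[t0 _]; rewrite lee_fin mulr_ge0.
  - by apply/measurable_EFinP; apply: measurable_funTS; exact: measurable_funM.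
  - move=> t /=; rewrite in_itv/= => t0; rewrite lee_fin /f t0.
    by have [->|t00] := eqVneq t 0; [rewrite mul0r|rewrite divff].
rewrite integral_cst//= mul1e lebesgue_measure_itv/= lte_fin.
by case: ifP => _; rewrite -?EFinD lee_fin ?oppr0 ?addr0.
Qed.

Lemma integral_sing2_le rho d : 0 < rho -> 0 < d ->
  (\int[area]_z (sing2 rho d z)%:E <= (16 * ln (1 + rho / d))%:E)%E.
Proof.
move=> rho0 d0.
pose g (t : R) : R := (if 0 <= t <= rho then t else 0).
have g0 t : 0 <= g t by rewrite /g; case: ifP => // /andP[].
have mg : measurable_fun setT g.
  apply: measurable_fun_if => //.
  by apply: measurable_and; apply: measurable_fun_ler.
pose f (t : R) : R := (g t * Num.max (g t) d)^-1.
have f0 t : 0 <= f t by rewrite invr_ge0 mulr_ge0// le_max g0.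
have mf : measurable_fun setT f.
  apply: measurable_funV; last by move=> t; rewrite mulr_ge0// le_max g0.
  by apply: measurable_funM => //; exact: measurable_maxr.
apply: (@le_trans _ _ (\int[area]_z (f (maxnorm z))%:E)%E).
  apply: ge0_le_integral => //.
  - by move=> z _; rewrite lee_fin sing2_ge0.
  - by apply/measurable_EFinP; exact: measurable_sing2.
  - by apply/measurable_EFinP; exact: (measurableT_comp mf measurable_maxnorm).
  - move=> z _; rewrite lee_fin /sing2.
    have m0 : 0 <= maxnorm z by rewrite le_max normr_ge0.
    case: ifPn => zr//.
    rewrite /f /g m0 (le_trans (maxnorm_le_enorm _) zr)/=.
    have [->|z0] := eqVneq z 0.
      by rewrite /enorm/= expr0n/= addr0 sqrtr0 /maxnorm normr0 maxxx !mul0r.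
    have mp : 0 < maxnorm z by rewrite lt_neqAle m0 eq_sym maxnorm_eq0 z0.
    have M1 : 0 < Num.max (maxnorm z) d by rewrite lt_max mp.
    have M2 : 0 < Num.max (enorm z) d by rewrite lt_max enorm_gt0 z0.
    rewrite lef_pV2 ?posrE ?mulr_gt0 ?enorm_gt0//.
    rewrite ler_pM// ?maxnorm_le_enorm// ?(ltW M1)//.
    by rewrite ge_max !le_max maxnorm_le_enorm lexx orbT.
have frho t : rho < t -> f t = 0.
  by move=> rt; rewrite /f /g (leNgt t) rt andbF mul0r invr0.
apply: (le_trans (maxnorm_integral_le (ltW rho0) mf f0 frho)).
have -> : (16 * ln (1 + rho / d))%:E = (8%:E * (2 * ln (rho + d) - 2 * ln (0 + d))%:E)%E.
  rewrite -EFinM; congr EFin.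
  rewrite add0r -mulrBr -ln_div ?posrE ?addr_gt0//.
  rewrite (_ : (rho + d) / d = 1 + rho / d); first ring.
  by rewrite addrC mulrDl divff ?gt_eqF.
apply: lee_wpmul2l => //.
have cF : {within `[0, rho], continuous (fun t : R => 2 / (t + d))}.
  apply: continuous_in_subspaceT => t; rewrite mem_setE in_itv/= => /andP[t0 _].
  apply: cvgM; first exact: cvg_cst.
  apply: cvgV; first by rewrite gt_eqF// ltr_wpDl.
  by apply: cvgD; [exact: cvg_id|exact: cvg_cst].
have dF t : 0 <= t <= rho -> is_derive t 1 (fun t => 2 * ln (t + d)) (2 / (t + d)).
  move=> /andP[t0 _].
  have td : 0 < t + d by rewrite ltr_wpDl.
  have h := is_derive1_ln td.
  have h2 : is_derive t 1 (fun t => ln (t + d)) (t + d)^-1.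
    have := @is_derive1_comp R (@ln R) (fun t => t + d) t _ _ h (is_derive_addr d t).
    by rewrite mulr1.
  exact: is_deriveZ.
rewrite -(is_derive_FTC2 rho0 cF dF).
(* a maximum is at least the mean, which has an explicit primitive *)
have gen (s : R) : 0 <= s -> s / (s * Num.max s d) <= 2 / (s + d).
  move=> s0; have [->|t00] := eqVneq s 0.
    by rewrite !mul0r add0r divr_ge0// ltW.
  have M1 : 0 < Num.max s d by rewrite lt_max d0 orbT.
  rewrite invfM mulrA divff// mul1r.
  rewrite ler_pdivlMr ?ltr_wpDl// mulrC ler_pdivrMr//.
  have := le_max s s d; have := le_max d s d; rewrite !lexx orbT /=; lra.
apply: ge0_le_integral => //.
- by move=> t /=; rewrite in_itv/= => /andP[t0 _]; rewrite lee_fin mulr_ge0.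
- by apply/measurable_EFinP; apply: measurable_funTS; exact: measurable_funM.
- apply/measurable_EFinP.
  exact: (subspace_continuous_measurable_fun (measurable_itv _) cF).
- move=> t /=; rewrite in_itv/= => t0; rewrite lee_fin /f /g t0.
  case/andP: t0 => t0 _; exact: gen.
Qed.
End singular_integrals.

(** * The logarithmic kernel and its gradient *)

Section real_estimates.
Context {R : realType}.

(** Here [a] is the length of a vector, [b] that of the vector displaced by an
amount of length [h], and [p] is the scalar product of the two. The second-order
remainder of the logarithm is read off [ln u <= u - 1], applied to the quotients of the squares,
as long as neither length exceeds twice the other; otherwise [h] is at least
half of the larger length and each term is bounded separately. *)
Lemma ln_taylor_le (a b h p : R) : 0 < a -> 0 < b -> 0 <= h ->
  `|a - b| <= h -> `|p| <= h * a -> b ^+ 2 = a ^+ 2 + 2 * p + h ^+ 2 ->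
  `|ln b - ln a - p / a ^+ 2| <= 6 * (h ^+ 2 / (a * b)).
Proof.
move=> a0 b0 h0 abh pha bE.
have ab0 : 0 < a * b by rewrite mulr_gt0.
have lnX (t : R) : 0 < t -> ln (t ^+ 2) = 2 * ln t.
  by move=> t0; rewrite lnXn// mulr_natl.
have a20 : 0 < a ^+ 2 by rewrite exprn_gt0.
have b20 : 0 < b ^+ 2 by rewrite exprn_gt0.
move: abh pha; rewrite !ler_norml => /andP[abh1 abh2] /andP[pha1 pha2].
have up : ln b - ln a <= p / a ^+ 2 + h ^+ 2 / (2 * a ^+ 2).
  have : ln (1 + (b ^+ 2 / a ^+ 2 - 1)) <= b ^+ 2 / a ^+ 2 - 1.
    by apply: le_ln1Dx; rewrite ltrBDr addrC subrr divr_gt0.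
  rewrite addrC subrK ln_div ?posrE// !lnX// bE => H.
  have -> : p / a ^+ 2 + h ^+ 2 / (2 * a ^+ 2) =
    2^-1 * ((a ^+ 2 + 2 * p + h ^+ 2) / a ^+ 2 - 1) by field; rewrite gt_eqF.
  lra.
have lo : ln a - ln b <= (a ^+ 2 - b ^+ 2) / (2 * b ^+ 2).
  have : ln (1 + (a ^+ 2 / b ^+ 2 - 1)) <= a ^+ 2 / b ^+ 2 - 1.
    by apply: le_ln1Dx; rewrite ltrBDr addrC subrr divr_gt0.
  rewrite addrC subrK ln_div ?posrE// !lnX// => H.
  have -> : (a ^+ 2 - b ^+ 2) / (2 * b ^+ 2) =
    2^-1 * (a ^+ 2 / b ^+ 2 - 1) by field; rewrite gt_eqF.
  lra.
have up2 : ln b - ln a <= b / a.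
  by rewrite -ln_div ?posrE// ltW// ln_sublinear// divr_gt0.
have lo2 : ln a - ln b <= a / b.
  by rewrite -ln_div ?posrE// ltW// ln_sublinear// divr_gt0.
have pa : p / a ^+ 2 <= h / a.
  by rewrite ler_pdivrMr// (_ : h / a * a ^+ 2 = h * a)//; field; rewrite gt_eqF.
have pa' : - (h / a) <= p / a ^+ 2.
  by rewrite ler_pdivlMr// (_ : - (h / a) * a ^+ 2 = - (h * a))//; field; rewrite gt_eqF.
apply/andP; split.
  have [ab|ab] := leP a (2 * b).
    have -> : - (6 * (h ^+ 2 / (a * b))) =
       - (6 * h ^+ 2 * (a * b)) / (a ^+ 2 * b ^+ 2).
      by field; rewrite !gt_eqF.
    have : - (a ^+ 2 - b ^+ 2) / (2 * b ^+ 2) - p / a ^+ 2 <=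
       ln b - ln a - p / a ^+ 2 by rewrite mulNr; lra.
    apply: le_trans.
    have -> : - (a ^+ 2 - b ^+ 2) / (2 * b ^+ 2) - p / a ^+ 2 =
      (2^-1 * (b ^+ 2 - a ^+ 2) * a ^+ 2 - p * b ^+ 2) / (a ^+ 2 * b ^+ 2).
      by field; rewrite !gt_eqF.
    rewrite ler_pM2r ?invr_gt0 ?mulr_gt0//.
    have -> : 2^-1 * (b ^+ 2 - a ^+ 2) * a ^+ 2 - p * b ^+ 2 =
      p * ((a - b) * (a + b)) + 2^-1 * h ^+ 2 * a ^+ 2.
      have -> : b ^+ 2 - a ^+ 2 = 2 * p + h ^+ 2 by rewrite bE; ring.
      by field.
    have q1 : - (h * a * (h * (a + b))) <= p * ((a - b) * (a + b)).
      have : `|p * ((a - b) * (a + b))| <= h * a * (h * (a + b)).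
        rewrite normrM ler_pM// ?ler_norml ?pha1//.
        by rewrite -mulNr !ler_pM2r ?addr_gt0// abh1.
      by rewrite ler_norml => /andP[].
    have q2 : 0 <= h ^+ 2 * a * (2 * b - a) by rewrite mulr_ge0 ?subr_ge0// mulr_ge0 ?sqr_ge0// ltW.
    have q3 : 0 <= h ^+ 2 * (a * b) by rewrite mulr_ge0 ?sqr_ge0// ltW.
    have q4 : 0 <= h ^+ 2 * a ^+ 2 by rewrite mulr_ge0 ?sqr_ge0.
    nra.
  have ha : a <= 2 * h by lra.
  have s1 : a / b <= 4 * (h ^+ 2 / (a * b)).
    have -> : a / b = a ^+ 2 / (a * b) by field; rewrite !gt_eqF.
    by rewrite mulrA ler_pM2r ?invr_gt0//; nra.
  have s2 : h / a <= h ^+ 2 / (a * b).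
    have -> : h / a = h * b / (a * b) by field; rewrite !gt_eqF.
    by rewrite ler_pM2r ?invr_gt0//; nra.
  lra.
have [ba|ba] := leP b (2 * a).
  have s1 : h ^+ 2 / (2 * a ^+ 2) <= h ^+ 2 / (a * b).
    rewrite ler_pdivrMr ?mulr_gt0//.
    have -> : h ^+ 2 / (a * b) * (2 * a ^+ 2) = h ^+ 2 * (2 * a) / b.
      by field; rewrite !gt_eqF.
    by rewrite ler_pdivlMr//; have := sqr_ge0 h; nra.
  have s2 : 0 <= h ^+ 2 / (a * b) by rewrite divr_ge0 ?sqr_ge0// ltW.
  lra.
have hb : b <= 2 * h by lra.
have s1 : b / a <= 4 * (h ^+ 2 / (a * b)).
  have -> : b / a = b ^+ 2 / (a * b) by field; rewrite !gt_eqF.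
  by rewrite mulrA ler_pM2r ?invr_gt0//; nra.
have s2 : h / a <= 2 * (h ^+ 2 / (a * b)).
  have -> : h / a = h * b / (a * b) by field; rewrite !gt_eqF.
  by rewrite mulrA ler_pM2r ?invr_gt0//; nra.
lra.
Qed.

Lemma ln1D_le_sqrt (t : R) : 0 <= t -> ln (1 + t) <= 2 * Num.sqrt (1 + t).
Proof.
move=> t0; have t1 : 0 < 1 + t by lra.
rewrite -{1}(sqr_sqrtr (ltW t1)) lnXn ?sqrtr_gt0//.
by rewrite -[leLHS]mulr_natl ler_pM2l// ltW// ln_sublinear// sqrtr_gt0.
Qed.

Lemma normr_ln_le (t : R) : 0 < t -> `|ln t| <= t^-1 + t.
Proof.
move=> t0; rewrite ler_norml; apply/andP; split.
  have : ln t^-1 < t^-1 by rewrite ln_sublinear// invr_gt0.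
  rewrite lnV ?posrE//; lra.
have := ln_sublinear t0; have : 0 < t^-1 by rewrite invr_gt0.
lra.
Qed.

End real_estimates.

Section kernels.
Context {R : realType}.
Local Notation plane := (measurableTypeR R * measurableTypeR R)%type.
Implicit Types x y z : R * R.

Definition kern1 z : R := z.1 / enorm z ^+ 2.
Definition kern2 z : R := z.2 / enorm z ^+ 2.

Lemma normr_coord_kern_le (c e : R) : `|c| <= e -> `|c / e ^+ 2| <= e^-1.
Proof.
move=> ce; have e0 : 0 <= e by exact: le_trans ce.
have [->|en0] := eqVneq e 0; first by rewrite expr0n/= invr0 mulr0 normr0.
have ep : 0 < e by rewrite lt_neqAle eq_sym en0.
rewrite normrM (ger0_norm (_ : 0 <= (e ^+ 2)^-1)) ?invr_ge0 ?sqr_ge0//.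
by rewrite ler_pdivrMr ?exprn_gt0// expr2 mulKf.
Qed.

Lemma normr_kern1_le z : `|kern1 z| <= (enorm z)^-1.
Proof. exact/normr_coord_kern_le/ler_enorm1. Qed.

Lemma normr_kern2_le z : `|kern2 z| <= (enorm z)^-1.
Proof. exact/normr_coord_kern_le/ler_enorm2. Qed.

(** The kernel is the inversion in the unit circle, which distorts distances by
exactly this factor. *)
Lemma sqr_kern_dist a b : a != 0 -> b != 0 ->
  (kern1 a - kern1 b) ^+ 2 + (kern2 a - kern2 b) ^+ 2 =
  (enorm (a - b) / (enorm a * enorm b)) ^+ 2.
Proof.
rewrite -!enorm_gt0 => a0 b0.
rewrite exprMn exprVn exprMn /kern1 /kern2 (sqr_enorm (a - b)) /=.
have := sqr_enorm a; have := sqr_enorm b.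
have : 0 < enorm a ^+ 2 by rewrite exprn_gt0.
have : 0 < enorm b ^+ 2 by rewrite exprn_gt0.
move: (enorm a ^+ 2) (enorm b ^+ 2) => A B B0 A0 hB hA.
case: a b hB hA {a0 b0} => [a1 a2] [b1 b2] /= hB hA.
have -> : (a1 / A - b1 / B) ^+ 2 + (a2 / A - b2 / B) ^+ 2 =
  ((a1 ^+ 2 + a2 ^+ 2) * B ^+ 2 + (b1 ^+ 2 + b2 ^+ 2) * A ^+ 2
   - 2 * (a1 * b1 + a2 * b2) * A * B) / (A * B) ^+ 2.
  by field; rewrite !gt_eqF.
rewrite -hA -hB.
have -> : (a1 - b1) ^+ 2 + (a2 - b2) ^+ 2 = A + B - 2 * (a1 * b1 + a2 * b2).
  by rewrite hA hB; ring.
by field; rewrite !gt_eqF.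
Qed.

Lemma kern1_dist_le a b : a != 0 -> b != 0 ->
  `|kern1 a - kern1 b| <= enorm (a - b) / (enorm a * enorm b).
Proof.
move=> a0 b0.
rewrite -(@ler_pXn2r _ 2)// ?nnegrE ?divr_ge0 ?mulr_ge0 ?enorm_ge0//.
by rewrite -sqr_kern_dist// real_normK ?num_real// lerDl sqr_ge0.
Qed.

Lemma kern2_dist_le a b : a != 0 -> b != 0 ->
  `|kern2 a - kern2 b| <= enorm (a - b) / (enorm a * enorm b).
Proof.
move=> a0 b0.
rewrite -(@ler_pXn2r _ 2)// ?nnegrE ?divr_ge0 ?mulr_ge0 ?enorm_ge0//.
by rewrite -sqr_kern_dist// real_normK ?num_real// lerDr sqr_ge0.
Qed.

Lemma ln_enorm_taylor_le a h : a != 0 -> a + h != 0 ->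
  `|ln (enorm (a + h)) - ln (enorm a) - (h.1 * kern1 a + h.2 * kern2 a)| <=
  6 * (enorm h ^+ 2 / (enorm a * enorm (a + h))).
Proof.
rewrite -!enorm_gt0 => a0 b0.
have -> : h.1 * kern1 a + h.2 * kern2 a = dot h a / enorm a ^+ 2.
  by rewrite /kern1 /kern2 /dot; field; rewrite gt_eqF.
apply: ln_taylor_le => //.
- exact: enorm_ge0.
- rewrite ler_norml; apply/andP; split.
    by have := ler_enormD a h; lra.
  have := ler_enormB (a + h) h; rewrite addrK; lra.
- exact: normr_dot_le.
- by rewrite !sqr_enorm /dot /=; ring.
Qed.

(** The farther of the two points is at distance at least [|x - y| / 2] from [z],
so the product is one of the two terms on the right. *)
Lemma inv_enorm_prod_le x y z (rho : R) : enorm (x - z) <= rho -> enorm (y - z) <= rho ->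
  x != y ->
  (enorm (x - z) * enorm (y - z))^-1 <=
  sing2 rho (enorm (x - y) / 2) (x - z) + sing2 rho (enorm (x - y) / 2) (y - z).
Proof.
move=> xr yr xy; rewrite /sing2 xr yr.
have d0 : 0 < enorm (x - y) by rewrite enorm_gt0 subr_eq0.
have [->|xz] := eqVneq x z.
  rewrite subrr [enorm 0](_ : _ = 0) ?mul0r ?invr0; last by apply/eqP; rewrite enorm_eq0.
  by rewrite add0r invr_ge0 mulr_ge0 ?enorm_ge0// le_max enorm_ge0.
have [->|yz] := eqVneq y z.
  rewrite subrr [enorm 0](_ : _ = 0) ?mul0r ?mulr0 ?invr0; last by apply/eqP; rewrite enorm_eq0.
  by rewrite addr0 invr_ge0 mulr_ge0 ?enorm_ge0// le_max enorm_ge0.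
have a0 : 0 < enorm (x - z) by rewrite enorm_gt0 subr_eq0.
have b0 : 0 < enorm (y - z) by rewrite enorm_gt0 subr_eq0.
have tri : enorm (x - y) <= enorm (x - z) + enorm (y - z).
  by rewrite (le_trans (ler_dist_enorm _ z _))// (enormBC z).
move: a0 b0 d0 tri; move: (enorm (x - z)) (enorm (y - z)) (enorm (x - y)) => a b d a0 b0 d0 tri.
have gen s t : 0 < s -> 0 < t -> s <= t -> d <= s + t ->
    (s * t)^-1 <= (s * Num.max s (d / 2))^-1.
  move=> s0 t0 st dst; have m0 : 0 < Num.max s (d / 2) by rewrite lt_max s0.
  rewrite lef_pV2 ?posrE ?mulr_gt0// ler_pM2l// ge_max st/=; lra.
have pos s : 0 < s -> 0 <= (s * Num.max s (d / 2))^-1.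
  by move=> s0; rewrite invr_ge0 mulr_ge0 ?ltW// lt_max s0.
have [ab|ab] := leP a b.
  by have := gen _ _ a0 b0 ab tri; have := pos _ b0; lra.
have := gen _ _ b0 a0 (ltW ab); rewrite addrC mulrC => /(_ tri).
by have := pos _ a0; rewrite mulrC; lra.
Qed.

Lemma measurable_kern1 : measurable_fun [set: plane] kern1.
Proof.
apply: measurable_funM => //; apply: measurable_funV; last by move=> z; rewrite sqr_ge0.
by apply: measurable_funX; exact: measurable_enorm.
Qed.

Lemma measurable_kern2 : measurable_fun [set: plane] kern2.
Proof.
apply: measurable_funM => //; apply: measurable_funV; last by move=> z; rewrite sqr_ge0.
by apply: measurable_funX; exact: measurable_enorm.
Qed.

Lemma measurable_ln_enorm : measurable_fun [set: plane] (fun z => ln (enorm z) : R).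
Proof. exact: (measurableT_comp (@measurable_ln R) measurable_enorm). Qed.

End kernels.

(** * Potentials of bounded vorticities *)

Section potentials.
Context {R : realType}.
Local Notation plane := (measurableTypeR R * measurableTypeR R)%type.
Implicit Types (x y z : R * R) (w : R * R -> R).

Lemma measurable_point x : measurable ([set x] : set plane).
Proof.
have -> : [set x] = [set x.1] `*` [set x.2].
  by case: x => x1 x2; apply/seteqP; split => -[a b] /= [-> ->].
exact: measurableX.
Qed.

Lemma area_point x : area [set x] = 0%E.
Proof.
have -> : [set x] = [set x.1] `*` [set x.2].
  by case: x => x1 x2; apply/seteqP; split => -[a b] /= [-> ->].
by rewrite product_measure1E//= lebesgue_measure_set1 mul0e.
Qed.

Lemma ae_imp (P Q : R * R -> Prop) : (forall x, P x -> Q x) ->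
  {ae area, forall x, P x} -> {ae area, forall x, Q x}.
Proof.
move=> PQ [N [mN N0 NP]]; exists N; split => // x nQ.
by apply: NP => Px; apply: nQ; exact: PQ.
Qed.

Lemma ae_and (P Q : R * R -> Prop) :
  {ae area, forall x, P x} -> {ae area, forall x, Q x} ->
  {ae area, forall x, P x /\ Q x}.
Proof.
move=> [N [mN N0 NP]] [N' [mN' N0' NP']].
exists (N `|` N'); split.
- exact: measurableU.
- by rewrite measureU0.
- move=> x /= nPQ; apply: contrapT => /not_orP[n1 n2]; apply: nPQ; split.
    by apply: contrapT => nP; apply/n1/NP.
  by apply: contrapT => nQ; apply/n2/NP'.
Qed.

Lemma ae_neq x : {ae area, forall y, y != x}.
Proof.
exists [set x]; split; [exact: measurable_point|exact: area_point|].
by move=> y /= /negP; rewrite negbK => /eqP.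
Qed.

Lemma normr_Rintegral_le_ae (f g : R * R -> R) :
  area.-integrable setT (EFin \o f) ->
  area.-integrable setT (EFin \o g) -> (forall x, 0 <= g x) ->
  {ae area, forall x, `|f x| <= g x} ->
  `|\int[area]_x f x| <= \int[area]_x g x.
Proof.
move=> If Ig g0 fg; apply: le_trans (le_normr_Rintegral _ If) _ => //.
have mf := integrable_measurable If.
have mg := integrable_measurable Ig.
have Igf := integrable_fin_num measurableT Ig.
have Iff := integrable_fin_num measurableT (integrable_norm If).
rewrite /Rintegral fine_le//.
apply: ae_ge0_le_integral => //.
- by apply/measurable_EFinP; exact: measurableT_comp.
- by move=> x _; rewrite lee_fin.
- by apply/measurable_EFinP.
- by apply: ae_imp fg => x h _; rewrite lee_fin.
Qed.

Lemma integrable_sing rho x :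
  area.-integrable setT (EFin \o (fun y => sing rho (x - y))).
Proof.
apply: (area_preserving_integrable (f := sing rho) (area_preserving_reflection x)).
have [rho0|rho0] := leP 0 rho.
  apply: (integrable_ge0_le (C := 8 * rho)); first exact: measurable_sing.
    exact: sing_ge0.
  exact: integral_sing_le.
rewrite (_ : EFin \o _ = cst 0%E); first exact: integrable0.
apply/funext => z /=; rewrite /sing ifF//; apply/negbTE; rewrite -ltNge.
by rewrite (lt_le_trans rho0)// enorm_ge0.
Qed.

Lemma Rintegral_sing_le rho x : 0 <= rho ->
  \int[area]_y sing rho (x - y) <= 8 * rho.
Proof.
move=> rho0.
rewrite (area_preserving_integral (f := sing rho) (area_preserving_reflection x)); last exact: measurable_sing.
by apply: Rintegral_ge0_le; [exact: sing_ge0|exact: integral_sing_le].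
Qed.

Lemma integrable_sing2 rho d x : 0 < rho -> 0 < d ->
  area.-integrable setT (EFin \o (fun y => sing2 rho d (x - y))).
Proof.
move=> rho0 d0.
apply: (area_preserving_integrable (f := sing2 rho d) (area_preserving_reflection x)).
apply: integrable_ge0_le; first exact: measurable_sing2.
  exact: sing2_ge0.
exact: integral_sing2_le.
Qed.

Lemma Rintegral_sing2_le rho d x : 0 < rho -> 0 < d ->
  \int[area]_y sing2 rho d (x - y) <= 16 * ln (1 + rho / d).
Proof.
move=> rho0 d0.
rewrite (area_preserving_integral (f := sing2 rho d) (area_preserving_reflection x)); last exact: measurable_sing2.
by apply: Rintegral_ge0_le; [exact: sing2_ge0|exact: integral_sing2_le].
Qed.

Definition bounded_vorticity (r : R) w :=
  [/\ measurable_fun [set: R * R] w, forall x, `|w x| <= 1 &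
      forall x, r <= enorm x -> w x = 0].

Lemma measurable_sub_kernel (F : R * R -> R) x : measurable_fun [set: plane] F ->
  measurable_fun [set: plane] (fun y : plane => F (x - y)).
Proof.
move=> mF; exact: (measurableT_comp mF (area_preserving_reflection x).1).
Qed.

Lemma vorticity_support r w x y : bounded_vorticity r w -> w y != 0 ->
  enorm (x - y) <= enorm x + r.
Proof.
move=> [_ _ w0] wy; rewrite (le_trans (ler_enormB _ _))// lerD2l ltW// ltNge.
by apply: contra wy => /w0 ->.
Qed.

Lemma integrable_kernel r w x (F : R * R -> R) (c : R) :
  bounded_vorticity r w -> measurable_fun [set: plane] F ->
  (forall z, enorm z <= enorm x + r -> `|F z| <= c * (enorm z)^-1) ->
  area.-integrable setT (EFin \o (fun y => F (x - y) * w y)).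
Proof.
move=> W mF Fc; have [mw w1 w0] := W.
have I := integrable_sing (enorm x + r) x.
apply: (@integrable_dominated _ plane R area (fun y => F (x - y) * w y)
  (fun y => `|c| * sing (enorm x + r) (x - y))).
- by apply: measurable_funM => //; exact: measurable_sub_kernel.
- exact: integrable_funZ I.
- move=> y; rewrite normrM.
  have [wy|wy] := eqVneq (w y) 0.
    by rewrite wy normr0 mulr0 mulr_ge0// sing_ge0.
  have sy := vorticity_support x W wy.
  rewrite /sing sy.
  apply: le_trans (ler_wpM2l (normr_ge0 _) (w1 y)) _; rewrite mulr1.
  apply: le_trans (Fc _ sy) _.
  by rewrite ler_wpM2r ?invr_ge0 ?enorm_ge0// ler_norm.
Qed.

Definition potential w x : R := \int[area]_y (ln (enorm (x - y)) * w y).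
Definition biot_savart1 w x : R := \int[area]_y (kern1 (x - y) * w y).
Definition biot_savart2 w x : R := \int[area]_y (kern2 (x - y) * w y).

Lemma integrable_kern1 r w x : bounded_vorticity r w ->
  area.-integrable setT (EFin \o (fun y => kern1 (x - y) * w y)).
Proof.
move=> W; apply: (integrable_kernel (c := 1) W measurable_kern1) => z _.
by rewrite mul1r normr_kern1_le.
Qed.

Lemma integrable_kern2 r w x : bounded_vorticity r w ->
  area.-integrable setT (EFin \o (fun y => kern2 (x - y) * w y)).
Proof.
move=> W; apply: (integrable_kernel (c := 1) W measurable_kern2) => z _.
by rewrite mul1r normr_kern2_le.
Qed.

Lemma integrable_ln r w x : bounded_vorticity r w ->
  area.-integrable setT (EFin \o (fun y => ln (enorm (x - y)) * w y)).
Proof.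
move=> W; apply: (integrable_kernel (c := 1 + (enorm x + r) ^+ 2) W measurable_ln_enorm) => z zr.
have [->|z0] := eqVneq z 0.
  have -> : enorm (0 : R * R) = 0 by apply/eqP; rewrite enorm_eq0.
  by rewrite ln0// normr0 invr0 mulr0.
have zp : 0 < enorm z by rewrite enorm_gt0.
apply: le_trans (normr_ln_le zp) _.
rewrite mulrDl mul1r lerD2l ler_pdivlMr// -expr2 ler_pXn2r ?nnegrE ?enorm_ge0//.
by rewrite (le_trans _ zr)// enorm_ge0.
Qed.

Lemma streamE r w x : bounded_vorticity r w ->
  stream w x = - (2 * pi)^-1 * potential w x.
Proof.
move=> W; rewrite /stream /potential mulNr -mulrN; congr (_ * _).
rewrite -mulN1r -RintegralZl//; last exact: integrable_ln W.
apply: eq_Rintegral => y _; rewrite mulrA; congr (_ * _).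
have [->|e0] := eqVneq (enorm (x - y)) 0; first by rewrite invr0 mulr0 ln0// mulr0.
by rewrite div1r lnV ?mulN1r// posrE lt_neqAle eq_sym e0 enorm_ge0.
Qed.

(** Differences of the velocity kernel and Taylor remainders of the logarithm are
both bounded by the product of two inverse distances. This estimate therefore
yields the log-Lipschitz modulus of the velocity as well as the
differentiability of the potential, for merely bounded vorticities. *)
Lemma kernel_difference_le r w (c e rho : R) x x' (F : R * R -> R) :
  bounded_vorticity r w -> x != x' -> 0 < rho -> 0 <= c ->
  enorm x + r <= rho -> enorm x' + r <= rho ->
  area.-integrable setT (EFin \o (fun y => F y * w y)) ->
  (forall y, y != x -> y != x' ->
     `|F y| <= c / (enorm (x - y) * enorm (x' - y))) ->
  `|\int[area]_y (F y * w y)| <= c * (32 * ln (1 + 2 * rho / enorm (x - x'))).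
Proof.
move=> W xx' rho0 c0 xr xr' IF Fc; have [mw w1 w0] := W.
have d0 : 0 < enorm (x - x') by rewrite enorm_gt0 subr_eq0.
have d20 : 0 < enorm (x - x') / 2 by rewrite divr_gt0.
set d := enorm (x - x') / 2 in d20.
pose G y := c * (sing2 rho d (x - y) + sing2 rho d (x' - y)).
have I1 := integrable_sing2 x rho0 d20.
have I2 := integrable_sing2 x' rho0 d20.
have I12 := integrable_funD I1 I2.
have IG : area.-integrable setT (EFin \o G) by exact: integrable_funZ I12.
apply: (@le_trans _ _ (\int[area]_y G y)).
  apply: normr_Rintegral_le_ae => //.
    by move=> y; rewrite mulr_ge0// addr_ge0// sing2_ge0.
  apply: ae_imp (ae_and (ae_neq x) (ae_neq x')) => y [yx yx'].
  rewrite normrM.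
  have [wy|wy] := eqVneq (w y) 0.
    by rewrite wy normr0 mulr0 mulr_ge0// addr_ge0// sing2_ge0.
  apply: le_trans (ler_wpM2l (normr_ge0 _) (w1 y)) _; rewrite mulr1.
  apply: le_trans (Fc _ yx yx') _; rewrite ler_wpM2l//.
  apply: inv_enorm_prod_le => //.
    exact: le_trans (vorticity_support x W wy) xr.
  exact: le_trans (vorticity_support x' W wy) xr'.
rewrite /G RintegralZl// ler_wpM2l// RintegralD//.
have -> : 1 + 2 * rho / enorm (x - x') = 1 + rho / d by rewrite /d; field; rewrite gt_eqF.
have := Rintegral_sing2_le x rho0 d20; have := Rintegral_sing2_le x' rho0 d20.
lra.
Qed.

Lemma biot_savart_loglip r w (rho : R) x x' : bounded_vorticity r w ->
  x != x' -> 0 < rho -> enorm x + r <= rho -> enorm x' + r <= rho ->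
  `|biot_savart1 w x - biot_savart1 w x'| <=
    enorm (x - x') * (32 * ln (1 + 2 * rho / enorm (x - x'))) /\
  `|biot_savart2 w x - biot_savart2 w x'| <=
    enorm (x - x') * (32 * ln (1 + 2 * rho / enorm (x - x'))).
Proof.
move=> W xx' rho0 xr xr'.
have subxx y : (x - y) - (x' - y) = x - x' by rewrite opprB subrKA.
split.
- rewrite /biot_savart1 -RintegralB//; [|exact: integrable_kern1 W|exact: integrable_kern1 W].
  under eq_Rintegral do rewrite -mulrBl.
  apply: (kernel_difference_le (r := r)) => //; first exact: enorm_ge0.
    have := integrable_funB (integrable_kern1 x W) (integrable_kern1 x' W).
    by apply: eq_integrable => // y _ /=; rewrite mulrBl.
  move=> y yx yx'; rewrite -(subxx y).
  by apply: kern1_dist_le; rewrite subr_eq0 eq_sym.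
- rewrite /biot_savart2 -RintegralB//; [|exact: integrable_kern2 W|exact: integrable_kern2 W].
  under eq_Rintegral do rewrite -mulrBl.
  apply: (kernel_difference_le (r := r)) => //; first exact: enorm_ge0.
    have := integrable_funB (integrable_kern2 x W) (integrable_kern2 x' W).
    by apply: eq_integrable => // y _ /=; rewrite mulrBl.
  move=> y yx yx'; rewrite -(subxx y).
  by apply: kern2_dist_le; rewrite subr_eq0 eq_sym.
Qed.

Lemma potential_taylor r w (rho : R) x h : bounded_vorticity r w ->
  h != 0 -> 0 < rho -> enorm x + r <= rho -> enorm (x + h) + r <= rho ->
  `|potential w (x + h) - potential w x
    - (h.1 * biot_savart1 w x + h.2 * biot_savart2 w x)| <=
   6 * enorm h ^+ 2 * (32 * ln (1 + 2 * rho / enorm h)).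
Proof.
move=> W h0 rho0 xr xr'.
pose F y := ln (enorm (x + h - y)) - ln (enorm (x - y)) -
   (h.1 * kern1 (x - y) + h.2 * kern2 (x - y)).
have I1 := integrable_ln (x + h) W.
have I2 := integrable_ln x W.
have I3 := integrable_funZ h.1 (integrable_kern1 x W).
have I4 := integrable_funZ h.2 (integrable_kern2 x W).
have I12 := integrable_funB I1 I2.
have I34 := integrable_funD I3 I4.
have -> : potential w (x + h) - potential w x
    - (h.1 * biot_savart1 w x + h.2 * biot_savart2 w x) = \int[area]_y (F y * w y).
  rewrite /potential -RintegralB// /biot_savart1 /biot_savart2.
  rewrite -RintegralZl//; last exact: integrable_kern1 W.
  rewrite -RintegralZl//; last exact: integrable_kern2 W.
  rewrite -RintegralD// -RintegralB//.
  by apply: eq_Rintegral => y _; rewrite /F; ring.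
have hE : enorm h = enorm (x - (x + h)) by rewrite opprD addrA subrr add0r enormN.
rewrite [in ln _]hE.
apply: (kernel_difference_le (r := r)) => //.
- by rewrite -subr_eq0 opprD addrA subrr add0r oppr_eq0.
- by rewrite mulr_ge0// sqr_ge0.
- have := integrable_funB I12 I34.
  by apply: eq_integrable => // y _ /=; congr EFin; rewrite /F; ring.
- move=> y yx yxh; rewrite /F -mulrA.
  have -> : x + h - y = (x - y) + h by rewrite addrAC.
  apply: ln_enorm_taylor_le; first by rewrite subr_eq0 eq_sym.
  by rewrite addrAC subr_eq0 eq_sym.
Qed.

End potentials.

(** * Gradients of functions on the plane *)

Section gradients.
Context {R : realType}.
Implicit Types (x h : R * R) (f k : R * R -> R).

Definition has_grad f x (a b : R) : Prop :=
  is_diff x f (fun h => h.1 * a + h.2 * b).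

Lemma is_diff_fst x : is_diff x (fst : R * R -> R) fst.
Proof.
have c1 : continuous (fst : {linear (R * R)%type -> R}) by move=> y; exact: cvg_fst.
by apply: DiffDef; [exact: linear_differentiable c1|exact: diff_lin].
Qed.

Lemma is_diff_snd x : is_diff x (snd : R * R -> R) snd.
Proof.
have c1 : continuous (snd : {linear (R * R)%type -> R}) by move=> y; exact: cvg_snd.
by apply: DiffDef; [exact: linear_differentiable c1|exact: diff_lin].
Qed.

Lemma normE_maxnorm x : `|x| = maxnorm x.
Proof. by []. Qed.

Lemma is_diff_flat f x :
  (forall e : R, 0 < e -> exists2 d : R, 0 < d &
     forall h, enorm h < d -> `|f (x + h) - f x| <= e * enorm h) ->
  is_diff x f (\0 : R * R -> R).
Proof.
move=> H.
have E : f \o shift x = cst (f x) + (\0 : R * R -> R) +o_ (0 : R * R) id.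
  apply/eqaddoP => e e0.
  have [d d0 Hd] := H (e / 2) (divr_gt0 e0 (ltr0n R 2)).
  have d20 : 0 < d / 2 by rewrite divr_gt0.
  have := nbhsx_ballx (0 : R * R) (d / 2) d20; apply: filterS => h.
  rewrite -ball_normE /= sub0r normrN => hd0.
  have -> : (f \o shift x - (cst (f x) + \0)) h = f (x + h) - f x.
    by rewrite /= addr0 !fctE /= (addrC h).
  have hd : enorm h < d.
    rewrite (le_lt_trans (enorm_le_maxnorm _))// -normE_maxnorm mulrC -ltr_pdivlMr//.
  rewrite (le_trans (Hd _ hd))// -mulrA ler_pM2l// mulrC ler_pdivrMr// mulrC.
  by rewrite normE_maxnorm enorm_le_maxnorm.
have c0 : continuous (\0 : R * R -> R) by move=> y; exact: cvg_cst.
have D := diff_unique c0 E.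
apply: DiffDef => //.
by apply/diff_locallyP; rewrite D; split.
Qed.

Lemma is_derive_is_diff (f : R -> R) (t a : R) : is_derive t 1 f a -> is_diff t f (fun s => s * a).
Proof.
move=> H; apply: DiffDef.
  by apply/derivable1_diffP; exact: ex_derive.
rewrite diff1E; last by apply/derivable1_diffP; exact: ex_derive.
by rewrite derive1E derive_val.
Qed.

Lemma is_diff_is_derive (f : R -> R) (t a : R) : is_diff t f (fun s => s * a) -> is_derive t 1 f a.
Proof.
move=> H; have D : differentiable f t by exact: ex_diff.
apply: DeriveDef; first exact/derivable1_diffP.
by rewrite deriveE// diff_val mul1r.
Qed.

Lemma has_grad_partial f x a b : has_grad f x a b ->
  is_derive x ((1, 0) : R * R) f a /\ is_derive x ((0, 1) : R * R) f b.
Proof.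
move=> H; have D : differentiable f x by case: H.
split; apply: DeriveDef; try exact: diff_derivable;
  rewrite deriveE// (@diff_val _ _ _ _ _ _ _ H)/=; ring.
Qed.

Lemma has_grad_curve f (g1 g2 : R -> R) (t a b d1 d2 : R) :
  has_grad f (g1 t, g2 t) a b -> is_derive t 1 g1 d1 -> is_derive t 1 g2 d2 ->
  is_derive t 1 (fun s => f (g1 s, g2 s)) (a * d1 + b * d2).
Proof.
move=> Hf /is_derive_is_diff H1 /is_derive_is_diff H2.
apply: is_diff_is_derive.
have Hp := @is_diff_pair _ _ _ _ _ _ _ _ _ H1 H2.
have := @is_diff_comp _ _ _ _ _ _ _ _ _ Hp Hf.
move=> H; apply: is_diff_eq.
by apply/funext => s /=; ring.
Qed.

Lemma has_grad_comp1 (eta : R -> R) f x a b c :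
  is_derive (f x) 1 eta c -> has_grad f x a b ->
  has_grad (eta \o f) x (c * a) (c * b).
Proof.
move=> /is_derive_is_diff H1 Hf.
have := @is_diff_comp _ _ _ _ _ _ _ _ _ Hf H1.
by move=> H; apply: is_diff_eq; apply/funext => s /=; ring.
Qed.

Lemma has_gradD f k x a b c d : has_grad f x a b -> has_grad k x c d ->
  has_grad (fun y => f y + k y) x (a + c) (b + d).
Proof.
move=> Hf Hk; have H := @is_diffD _ _ _ _ _ _ _ _ Hf Hk.
apply: (is_diff_eq (H : is_diff x (fun y => f y + k y) _)).
by apply/funext => s /=; rewrite !fctE; ring.
Qed.

Lemma has_gradM f k x a b c d : has_grad f x a b -> has_grad k x c d ->
  has_grad (fun y => f y * k y) x (f x * c + k x * a) (f x * d + k x * b).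
Proof.
move=> Hf Hk; have H := @is_diffM _ _ _ _ _ _ _ Hf Hk.
apply: (is_diff_eq (H : is_diff x (fun y => f y * k y) _)).
by apply/funext => s /=; rewrite !fctE/= /GRing.scale/=; ring.
Qed.

Lemma has_grad_cst c x : has_grad (fun=> c) x 0 0.
Proof.
apply: (is_diff_eq (is_diff_cst c x)).
by apply/funext => s /=; rewrite !mulr0 addr0.
Qed.

Lemma has_grad_eq f x a b a' b' : has_grad f x a b -> a = a' -> b = b' ->
  has_grad f x a' b'.
Proof. by move=> H <- <-. Qed.

Lemma has_grad_fst x : has_grad (fun y => y.1) x 1 0.
Proof. by apply: (is_diff_eq (is_diff_fst x)); apply/funext => s /=; ring. Qed.

Lemma has_grad_snd x : has_grad (fun y => y.2) x 0 1.
Proof. by apply: (is_diff_eq (is_diff_snd x)); apply/funext => s /=; ring. Qed.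

Lemma has_grad_linear (a b : R) x : has_grad (fun y => y.1 * a + y.2 * b) x a b.
Proof.
have := has_gradD (has_gradM (has_grad_fst x) (has_grad_cst a x))
  (has_gradM (has_grad_snd x) (has_grad_cst b x)).
by rewrite !(mulr0, mulr1, add0r, addr0).
Qed.

Lemma has_grad_sqr_enorm x : has_grad (fun y => enorm y ^+ 2) x (2 * x.1) (2 * x.2).
Proof.
rewrite (_ : (fun y => _) = (fun y => y.1 * y.1 + y.2 * y.2)); last first.
  by apply/funext => y; rewrite sqr_enorm !expr2.
apply: (has_grad_eq (has_gradD (has_gradM (has_grad_fst x) (has_grad_fst x))
  (has_gradM (has_grad_snd x) (has_grad_snd x)))); ring.
Qed.

(** The differential refers to the max norm of the product; the Euclidean norm has
the advantage of being invariant under rotations. *)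
Lemma has_gradP f x a b : has_grad f x a b <->
  (forall e : R, 0 < e -> exists2 d : R, 0 < d &
     forall h, enorm h < d ->
       `|f (x + h) - f x - (h.1 * a + h.2 * b)| <= e * enorm h).
Proof.
split=> [H e e0|H].
  have D : differentiable f x by case: H.
  have := diff_locally D; rewrite (@diff_val _ _ _ _ _ _ _ H) => /eqaddoP /(_ e e0).
  rewrite -[X in X -> _]/(nbhs (0 : R * R) _) => /nbhs_ballP[d /= d0 Hd].
  exists d => // h hd.
  have := Hd h; rewrite -ball_normE /= sub0r normrN => /(_ _).
  have hd' : `|h| < d by rewrite (le_lt_trans _ hd)// normE_maxnorm maxnorm_le_enorm.
  move=> /(_ hd') /=; rewrite !fctE/= (addrC h) opprD addrA => /le_trans; apply.
  by rewrite ler_pM2l// normE_maxnorm maxnorm_le_enorm.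
pose k y := f y - (y.1 * a + y.2 * b).
have K : is_diff x k (\0 : R * R -> R).
  apply: is_diff_flat => e e0; have [d d0 Hd] := H e e0; exists d => // h hd.
  by have := Hd h hd; rewrite (_ : k (x + h) - k x = f (x + h) - f x - (h.1 * a + h.2 * b))// /k /=; ring.
have K0 : has_grad k x 0 0.
  by apply: (is_diff_eq K); apply/funext => s /=; rewrite !mulr0 addr0.
have := has_gradD K0 (has_grad_linear a b x); rewrite !add0r.
by congr has_grad; apply/funext => y; rewrite /k subrK.
Qed.

Lemma has_grad_near f k x a b (d : R) : 0 < d ->
  (forall y, enorm (y - x) < d -> f y = k y) ->
  has_grad f x a b -> has_grad k x a b.
Proof.
move=> d0 fk /has_gradP H; apply/has_gradP => e e0.
have [d' d'0 Hd] := H e e0.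
exists (Num.min d d'); first by rewrite lt_min d0.
move=> h; rewrite lt_min => /andP[hd hd'].
rewrite -!fk; first exact: Hd.
  by rewrite subrr /enorm/= expr0n addr0 sqrtr0.
by rewrite addrAC subrr add0r.
Qed.

Lemma has_grad_rotation f x a b (al : R) : has_grad f (rotation al x) a b ->
  has_grad (f \o rotation al) x (cos al * a + sin al * b) (- sin al * a + cos al * b).
Proof.
move=> /has_gradP H; apply/has_gradP => e e0; have [d d0 Hd] := H e e0.
exists d => // h hd.
have -> : (f \o rotation al) (x + h) = f (rotation al x + rotation al h).
  by rewrite /= /rotation/=; congr f; congr pair; rewrite /=; ring.
have := Hd (rotation al h); rewrite enorm_rotation => /(_ hd).
congr (`|_ - _ - _| <= _); rewrite /=; ring.
Qed.

Lemma has_grad_continuous f x a b : has_grad f x a b -> {for x, continuous f}.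
Proof. by case=> D _; exact: differentiable_continuous. Qed.

End gradients.

(** * The velocity of a bounded vorticity *)

Section biot_savart.
Context {R : realType}.
Local Notation plane := (measurableTypeR R * measurableTypeR R)%type.
Implicit Types (x y z : R * R) (w f : R * R -> R).

Lemma enorm0 : enorm (0 : R * R) = 0.
Proof. by apply/eqP; rewrite enorm_eq0. Qed.

Lemma modulus_small (rho e : R) : 0 < rho -> 0 < e ->
  exists2 d : R, 0 < d & forall t, 0 < t -> t < d -> t * ln (1 + 2 * rho / t) <= e.
Proof.
move=> rho0 e0.
have r1 : 0 < 1 + 2 * rho by lra.
have e20 : 0 < (e / 2) ^+ 2 by rewrite exprn_gt0 ?divr_gt0.
exists (Num.min 1 ((e / 2) ^+ 2 / (1 + 2 * rho))).
  by rewrite lt_min ltr01 divr_gt0.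
move=> t t0; rewrite lt_min => /andP[t1]; rewrite ltr_pdivlMr// => td.
have q0 : 0 <= 2 * rho / t by rewrite divr_ge0 ?mulr_ge0 ?ltW.
apply: (le_trans (ler_wpM2l (ltW t0) (ln1D_le_sqrt q0))).
have -> : t * (2 * Num.sqrt (1 + 2 * rho / t)) = 2 * Num.sqrt (t ^+ 2 * (1 + 2 * rho / t)).
  by rewrite sqrtrM ?sqr_ge0// sqrtr_sqr gtr0_norm//; ring.
have -> : t ^+ 2 * (1 + 2 * rho / t) = t ^+ 2 + 2 * rho * t by field; rewrite gt_eqF.
have e2 : 0 <= e / 2 by rewrite divr_ge0// ltW.
rewrite mulrC -ler_pdivlMr// -(ger0_norm e2).
by rewrite -sqrtr_sqr ler_sqrt ?sqr_ge0//; nra.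
Qed.

Lemma continuous_enormP f x :
  (forall e : R, 0 < e -> exists2 d : R, 0 < d &
     forall y, enorm (y - x) < d -> `|f y - f x| <= e) ->
  {for x, continuous f}.
Proof.
move=> H; apply/cvgrPdist_le => e e0; have [d d0 Hd] := H e e0.
have d20 : 0 < d / 2 by rewrite divr_gt0.
have := nbhsx_ballx x (d / 2) d20; apply: filterS => y; rewrite -ball_normE /= => xy.
rewrite distrC; apply: Hd; rewrite enormBC.
rewrite (le_lt_trans (enorm_le_maxnorm _))// -normE_maxnorm mulrC -ltr_pdivlMr//.
Qed.

Lemma stream_grad r w x : bounded_vorticity r w ->
  has_grad (stream w) x (- (2 * pi)^-1 * biot_savart1 w x)
                        (- (2 * pi)^-1 * biot_savart2 w x).
Proof.
move=> W.
have P : has_grad (potential w) x (biot_savart1 w x) (biot_savart2 w x).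
  apply/has_gradP => e e0.
  pose rho := enorm x + `|r| + 1.
  have rho0 : 0 < rho by rewrite /rho; have := enorm_ge0 x; have := normr_ge0 r; lra.
  have e10 : 0 < e / 192 by rewrite divr_gt0.
  have [d d0 Hd] := modulus_small rho0 e10.
  exists (Num.min 1 d); first by rewrite lt_min ltr01.
  move=> h; rewrite lt_min => /andP[h1 hd].
  have [->|h0] := eqVneq h 0.
    by rewrite enorm0 mulr0 addr0 subrr !mul0r addr0 subr0 normr0.
  have hp : 0 < enorm h by rewrite enorm_gt0.
  have rr := ler_norm r.
  have xr : enorm x + r <= rho by rewrite /rho; lra.
  have xhr : enorm (x + h) + r <= rho.
    by rewrite /rho; have := ler_enormD x h; lra.
  apply: (le_trans (potential_taylor W h0 rho0 xr xhr)).
  have := ler_wpM2l (ltW hp) (Hd _ hp hd).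
  have -> : 6 * enorm h ^+ 2 * (32 * ln (1 + 2 * rho / enorm h)) =
    192 * (enorm h * (enorm h * ln (1 + 2 * rho / enorm h))) by ring.
  by move=> H; lra.
have -> : stream w = (fun y => - (2 * pi)^-1 * potential w y).
  by apply/funext => y; exact: streamE W.
have := has_gradM (has_grad_cst (- (2 * pi)^-1) x) P.
by rewrite !mulr0 !addr0.
Qed.

Lemma biot_savart_continuous r w : bounded_vorticity r w ->
  continuous (biot_savart1 w) /\ continuous (biot_savart2 w).
Proof.
move=> W.
suff H x e : 0 < e -> exists2 d : R, 0 < d & forall y, enorm (y - x) < d ->
    `|biot_savart1 w y - biot_savart1 w x| <= e /\
    `|biot_savart2 w y - biot_savart2 w x| <= e.
  by split=> x; apply: continuous_enormP => e e0; have [d d0 Hd] := H x e e0;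
    exists d => // y yd; case: (Hd y yd).
move=> e0.
pose rho := enorm x + `|r| + 1.
have rho0 : 0 < rho by rewrite /rho; have := enorm_ge0 x; have := normr_ge0 r; lra.
have e10 : 0 < e / 32 by rewrite divr_gt0.
have [d d0 Hd] := modulus_small rho0 e10.
exists (Num.min 1 d); first by rewrite lt_min ltr01.
move=> y; rewrite lt_min => /andP[y1 yd].
have [->|yx] := eqVneq y x; first by rewrite !subrr normr0 ltW.
have hp : 0 < enorm (y - x) by rewrite enorm_gt0 subr_eq0.
have rr := ler_norm r.
have xr : enorm x + r <= rho by rewrite /rho; lra.
have yr : enorm y + r <= rho.
  have := ler_enormD x (y - x); rewrite addrC subrK /rho; lra.
have [B1 B2] := biot_savart_loglip W yx rho0 yr xr.
have := Hd _ hp yd.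
by split; [apply: (le_trans B1)|apply: (le_trans B2)]; lra.
Qed.

Definition L1norm w : R := \int[area]_y `|w y|.

Lemma L1norm_ge0 w : 0 <= L1norm w.
Proof. exact: Rintegral_ge0. Qed.

Lemma integrable_vorticity r w : bounded_vorticity r w ->
  area.-integrable setT (EFin \o w).
Proof.
move=> W; have [mw w1 w0] := W.
have H (y : R * R) : y != 0 -> `|w y| <= `|r| * sing `|r| (0 - y).
  move=> y0; have [wy|wy] := eqVneq (w y) 0.
    by rewrite wy normr0 mulr_ge0// sing_ge0.
  have yr : enorm y <= `|r|.
    rewrite (le_trans _ (ler_norm r))// ltW// ltNge; apply: contra wy.
    by move=> /w0 ->.
  rewrite /sing sub0r enormN yr (le_trans (w1 y))// ler_pdivlMr ?enorm_gt0//.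
  by rewrite mul1r.
have I := integrable_funZ `|r| (integrable_sing `|r| (0 : R * R)).
apply/integrableP; split; first exact: measurableT_comp.
have /integrableP[_] := I; apply: le_lt_trans.
apply: ae_ge0_le_integral => //.
- by apply: measurableT_comp => //; exact: measurableT_comp.
- by apply: measurableT_comp => //; case/integrableP : I.
- apply: ae_imp (ae_neq 0) => y y0 _ /=; rewrite lee_fin.
  by rewrite (le_trans (H y y0))// ler_norm.
Qed.

(** The singularity is cut off at distance [eta]: outside, the kernel is at most
[1 / eta]; inside, the vorticity is at most 1 and the kernel has integral at
most [8 * eta]. *)
Lemma Rintegral_inv_le r w x (eta : R) : bounded_vorticity r w -> 0 < eta ->
  area.-integrable setT (EFin \o (fun y => (enorm (x - y))^-1 * `|w y|)) /\
  \int[area]_y ((enorm (x - y))^-1 * `|w y|) <= L1norm w / eta + 8 * eta.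
Proof.
move=> W eta0; have [mw w1 w0] := W.
have W' : bounded_vorticity r (fun y => `|w y|).
  split; first exact: measurableT_comp.
    by move=> y; rewrite normr_id.
  by move=> y /w0 ->; rewrite normr0.
have mi : measurable_fun [set: plane] (fun z : plane => (enorm z)^-1).
  by apply: measurable_funV; [exact: measurable_enorm|exact: enorm_ge0].
have I : area.-integrable setT (EFin \o (fun y => (enorm (x - y))^-1 * `|w y|)).
  apply: (integrable_kernel (F := fun z => (enorm z)^-1) (c := 1) W' mi) => z _.
  by rewrite mul1r ger0_norm// invr_ge0 enorm_ge0.
split=> //.
have I1 := integrable_funZ eta^-1 (integrable_vorticity W').
have I2 := integrable_sing eta x.
apply: (@le_trans _ _ (\int[area]_y (eta^-1 * `|w y| + sing eta (x - y)))).
  apply: le_Rintegral => //; first exact: integrable_funD.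
  move=> y _; rewrite /sing; case: ifPn => xy.
    rewrite -[X in X <= _]add0r lerD ?mulr_ge0 ?invr_ge0 ?(ltW eta0)//.
    by rewrite ler_piMr// invr_ge0 enorm_ge0.
  have xy' : eta < enorm (x - y) by rewrite ltNge.
  by rewrite addr0 ler_wpM2r// lef_pV2 ?posrE ?(lt_trans eta0 xy')// ltW.
rewrite RintegralD//.
rewrite RintegralZl//; last exact: integrable_vorticity W'.
by rewrite /L1norm mulrC lerD2l Rintegral_sing_le// ltW.
Qed.

Lemma biot_savart_le r w x (eta : R) : bounded_vorticity r w -> 0 < eta ->
  `|biot_savart1 w x| <= L1norm w / eta + 8 * eta /\
  `|biot_savart2 w x| <= L1norm w / eta + 8 * eta.
Proof.
move=> W eta0; have [I B] := Rintegral_inv_le x W eta0.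
by split; apply: le_trans B; apply: normr_Rintegral_le => //;
  [exact: integrable_kern1 W|move=> y; rewrite normrM ler_wpM2r// normr_kern1_le|
   exact: integrable_kern2 W|move=> y; rewrite normrM ler_wpM2r// normr_kern2_le].
Qed.

Lemma potential_le r w x (eta rho : R) : bounded_vorticity r w -> 0 < eta ->
  enorm x + r <= rho ->
  `|potential w x| <= (1 + rho ^+ 2) * (L1norm w / eta + 8 * eta).
Proof.
move=> W eta0 xr; have [I B] := Rintegral_inv_le x W eta0.
have [mw w1 w0] := W.
apply: (@le_trans _ _ ((1 + rho ^+ 2) * \int[area]_y ((enorm (x - y))^-1 * `|w y|))); last first.
  by rewrite ler_wpM2l// addr_ge0// sqr_ge0.
rewrite -RintegralZl//; apply: normr_Rintegral_le => //.
- exact: integrable_ln W.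
- exact: integrable_funZ.
move=> y; rewrite normrM mulrA.
have [wy|wy] := eqVneq (w y) 0; first by rewrite wy normr0 !mulr0.
rewrite ler_wpM2r//.
have zr := le_trans (vorticity_support x W wy) xr.
have [->|z0] := eqVneq (x - y) 0; first by rewrite enorm0 ln0// normr0 invr0 mulr0.
have zp : 0 < enorm (x - y) by rewrite enorm_gt0.
apply: le_trans (normr_ln_le zp) _.
rewrite mulrDl mul1r lerD2l ler_pdivlMr// -expr2 ler_pXn2r ?nnegrE ?enorm_ge0//.
by rewrite (le_trans _ zr)// enorm_ge0.
Qed.

Lemma biot_savartB r w r' w' x : bounded_vorticity r w -> bounded_vorticity r' w' ->
  biot_savart1 w x - biot_savart1 w' x = biot_savart1 (fun y => w y - w' y) x /\
  biot_savart2 w x - biot_savart2 w' x = biot_savart2 (fun y => w y - w' y) x.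
Proof.
move=> W W'; split.
- rewrite /biot_savart1 -RintegralB//; [|exact: integrable_kern1 W|exact: integrable_kern1 W'].
  by apply: eq_Rintegral => y _; rewrite mulrBr.
- rewrite /biot_savart2 -RintegralB//; [|exact: integrable_kern2 W|exact: integrable_kern2 W'].
  by apply: eq_Rintegral => y _; rewrite mulrBr.
Qed.

Lemma stream_rotation w x (al : R) : measurable_fun [set: plane] w ->
  stream (w \o rotation al) x = stream w (rotation al x).
Proof.
move=> mw; rewrite /stream; congr (_ * _).
pose f y := ln (1 / enorm (rotation al x - y)) * w y.
have mf : measurable_fun [set: plane] f.
  apply: measurable_funM => //.
  apply: (measurableT_comp (@measurable_ln R)).
  apply: measurable_funM => //; apply: measurable_funV.
    exact: (measurable_sub_kernel (F := @enorm R) _ measurable_enorm).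
  by move=> y; exact: enorm_ge0.
rewrite -(area_preserving_integral (area_preserving_rotation al) mf).
apply: eq_Rintegral => y _; rewrite /f /=; congr (ln (_ / _) * _).
rewrite -(enorm_rotation al); congr enorm.
by rewrite /rotation; congr pair => /=; ring.
Qed.

Lemma bounded_vorticity_rotation r w al : bounded_vorticity r w ->
  bounded_vorticity r (w \o rotation al).
Proof.
move=> [mw w1 w0]; split.
- exact: (measurableT_comp (mw : measurable_fun [set: plane] w) (area_preserving_rotation al).1).
- by move=> x; exact: w1.
- by move=> x rx /=; apply: w0; rewrite enorm_rotation.
Qed.

End biot_savart.

(** * The weak equation in a rotating frame *)

Section rotating_test_functions.
Context {R : realType}.
Local Notation plane := (measurableTypeR R * measurableTypeR R)%type.
Implicit Types (x y z : R * R) (w f : R * R -> R).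

(** An open set is the union of the countably many squares with rational centres
and radii [1 / (n + 1)] that it contains, and squares are products of
intervals. *)
Lemma open_measurable2 (A : set (R * R)) : open A -> measurable (A : set plane).
Proof.
move=> oA.
pose B (a b : rat) (n : nat) : set (R * R) := ball (ratr a : R, ratr b : R) (n.+1%:R^-1).
pose F a b n := if `[< B a b n `<=` A >] then B a b n else set0.
have -> : A = \bigcup_a \bigcup_b \bigcup_n F a b n.
  apply/seteqP; split => [x Ax|x [a _ [b _ [n _]]]]; last first.
    by rewrite /F; case: asboolP => // BA; exact: BA.
  have /nbhs_ballP[e /= e0 eA] : nbhs x A by exact: open_nbhs_nbhs.
  have [n ne] : exists n, n.+1%:R^-1 < e / 2 :> R.
    have [n _ Hn] := near_infty_natSinv_lt (PosNum (divr_gt0 e0 (ltr0n R 2))).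
    by exists n; exact: (Hn n (leqnn n)).
  have n0 : 0 < n.+1%:R^-1 :> R by rewrite invr_gt0.
  have q (u : R) : exists a : rat, `|ratr a - u| < n.+1%:R^-1.
    have lt : u - n.+1%:R^-1 < u + n.+1%:R^-1 by rewrite ltrD2l (lt_trans _ n0)// oppr_lt0.
    have [a] := rat_in_itvoo lt.
    rewrite in_itv/= => /andP[h1 h2]; exists a.
    move: h1 h2; move: (n.+1%:R^-1) => k h1 h2.
    by rewrite ltr_norml; apply/andP; split; lra.
  have [a ha] := q x.1; have [b hb] := q x.2.
  exists a => //; exists b => //; exists n => //; rewrite /F.
  have BAB : B a b n `<=` A.
    move=> z [/= z1 z2]; apply: eA; split; rewrite /ball/= in z1 z2 *.
      have := ler_distD (ratr a) x.1 z.1; rewrite (distrC x.1) => h.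
      rewrite (le_lt_trans h)//; move: z1 ha ne; rewrite distrC (distrC (ratr a)).
      by move: (n.+1%:R^-1) => k; lra.
    have := ler_distD (ratr b) x.2 z.2; rewrite (distrC x.2) => h.
    rewrite (le_lt_trans h)//; move: z2 hb ne; rewrite distrC (distrC (ratr b)).
    by move: (n.+1%:R^-1) => k; lra.
  by rewrite asboolT//; split.
apply: bigcupT_measurable_rat => a; apply: bigcupT_measurable_rat => b.
apply: bigcupT_measurable => n; rewrite /F; case: ifP => // _.
have -> : B a b n = ball (ratr a : R) (n.+1%:R^-1) `*` ball (ratr b : R) (n.+1%:R^-1).
  by apply/seteqP; split => -[u v].
by apply: measurableX; exact: measurable_ball.
Qed.

Lemma continuous_measurable2 (f : R * R -> R) : continuous f -> measurable_fun [set: plane] f.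
Proof.
move=> /continuousP cf; apply: (measurability _ (RGenOpens.measurableE R)).
move=> _ [_ [a [b ->] <-]]; rewrite setTI; apply: open_measurable2.
exact/cf/interval_open.
Qed.

Record C1_compact f (g1 g2 : R * R -> R) : Prop := {
  C1_grad : forall x, has_grad f x (g1 x) (g2 x);
  C1_continuous1 : continuous g1;
  C1_continuous2 : continuous g2;
  C1_support : exists r : R, forall x, r <= enorm x ->
     [/\ f x = 0, g1 x = 0 & g2 x = 0]
}.

Lemma rotation0 x : rotation 0 x = x.
Proof. by case: x => a b; rewrite /rotation cos0 sin0 /=; congr pair; ring. Qed.

Lemma rotationK (al : R) x : rotation al (rotation (- al) x) = x.
Proof.
case: x => a b; rewrite /rotation cosN sinN /=.
have h := cos2Dsin2 al; move: h; move: (cos al) (sin al) => c s h.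
congr pair.
  transitivity ((c ^+ 2 + s ^+ 2) * a); last by rewrite h mul1r.
  ring.
transitivity ((c ^+ 2 + s ^+ 2) * b); last by rewrite h mul1r.
ring.
Qed.

Definition rotating (Omega : R) f (t : R) x : R := f (rotation (- (Omega * t)) x).

Lemma continuous_rotating (Omega : R) f : continuous f ->
  continuous (fun z : R * (R * R) => rotating Omega f z.1 z.2).
Proof.
move=> cf z.
have ca : {for z, continuous (fun z : R * (R * R) => - (Omega * z.1))}.
  by apply: continuousN; apply: continuousM; [exact: cst_continuous|exact: cvg_fst].
have c1 : {for z, continuous (fun z : R * (R * R) => z.2.1)}.
  by apply: continuous_comp; [exact: cvg_snd|exact: cvg_fst].
have c2 : {for z, continuous (fun z : R * (R * R) => z.2.2)}.
  by apply: continuous_comp; [exact: cvg_snd|exact: cvg_snd].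
have cc : {for z, continuous (fun z : R * (R * R) => cos (- (Omega * z.1)))}.
  by apply: continuous_comp => //; exact: continuous_cos.
have cs : {for z, continuous (fun z : R * (R * R) => sin (- (Omega * z.1)))}.
  by apply: continuous_comp => //; exact: continuous_sin.
apply: (@continuous_comp _ _ _ (fun z : R * (R * R) => rotation (- (Omega * z.1)) z.2) f); last exact: cf.
rewrite /prop_for /continuous_at /rotation.
apply: (@cvg_pair _ _ _ (nbhs z) (nbhs _) (nbhs _)).
  by rewrite /=; apply: cvgB; apply: cvgM.
by rewrite /=; apply: cvgD; apply: cvgM.
Qed.

Lemma continuous_has_grad f g1 g2 : (forall x, has_grad f x (g1 x) (g2 x)) -> continuous f.
Proof. by move=> H x; exact: has_grad_continuous (H x). Qed.

Variables (Omega : R) (chi g1 g2 : R * R -> R).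
Hypothesis C : C1_compact chi g1 g2.
Let phi := rotating Omega chi.

Lemma rotating_partials t x :
  [/\ is_derive x ((1, 0) : R * R) (phi t)
        (cos (- (Omega * t)) * rotating Omega g1 t x + sin (- (Omega * t)) * rotating Omega g2 t x) &
      is_derive x ((0, 1) : R * R) (phi t)
        (- sin (- (Omega * t)) * rotating Omega g1 t x + cos (- (Omega * t)) * rotating Omega g2 t x)].
Proof.
have H := has_grad_rotation (C1_grad C (rotation (- (Omega * t)) x)).
by have [] := has_grad_partial H.
Qed.

Lemma rotating_derive_t (t : R) x :
  is_derive t 1 (phi ^~ x)
    (Omega * ((rotation (- (Omega * t)) x).2 * rotating Omega g1 t x
            - (rotation (- (Omega * t)) x).1 * rotating Omega g2 t x)).
Proof.
pose th (s : R) := - (Omega * s).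
have dth : is_derive t 1 th (- Omega).
  by rewrite /th; apply: is_derive_eq; rewrite /GRing.scale/= mulr1.
have dc : is_derive t 1 (fun s => cos (th s)) (- sin (th t) * - Omega).
  exact: (@is_derive1_comp R (@cos R) th).
have ds : is_derive t 1 (fun s => sin (th s)) (cos (th t) * - Omega).
  exact: (@is_derive1_comp R (@sin R) th).
have d1 : is_derive t 1 (fun s => cos (th s) * x.1 - sin (th s) * x.2)
    (Omega * (rotation (th t) x).2).
  have H := is_deriveB (is_deriveM dc (is_derive_cst x.1 t 1)) (is_deriveM ds (is_derive_cst x.2 t 1)).
  apply: (is_derive_eq (H : is_derive t 1 (fun s => cos (th s) * x.1 - sin (th s) * x.2) _)).
  by rewrite /GRing.scale/= !mulr0; ring.
have d2 : is_derive t 1 (fun s => sin (th s) * x.1 + cos (th s) * x.2)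
    (- (Omega * (rotation (th t) x).1)).
  have H := is_deriveD (is_deriveM ds (is_derive_cst x.1 t 1)) (is_deriveM dc (is_derive_cst x.2 t 1)).
  apply: (is_derive_eq (H : is_derive t 1 (fun s => sin (th s) * x.1 + cos (th s) * x.2) _)).
  by rewrite /GRing.scale/= !mulr0; ring.
have H := @has_grad_curve _ chi (fun s => cos (th s) * x.1 - sin (th s) * x.2)
  (fun s => sin (th s) * x.1 + cos (th s) * x.2) _ _ _ _ _
  (C1_grad C (rotation (th t) x)) d1 d2.
apply: (is_derive_eq (H : is_derive t 1 (phi ^~ x) _)).
by rewrite /rotating -/(th t); ring.
Qed.

Lemma rotating_test_function : test_function phi.
Proof.
split.
- by move=> t x; have H := rotating_derive_t t x; exact: ex_derive.
- by move=> t x; have [H _] := rotating_partials t x; exact: ex_derive.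
- by move=> t x; have [_ H] := rotating_partials t x; exact: ex_derive.
- exact: (continuous_rotating (continuous_has_grad (C1_grad C))).
- have -> : (fun z : R * (R * R) => derive1 (phi ^~ z.2) z.1) =
    (fun z : R * (R * R) => Omega * rotating Omega (fun y => y.2 * g1 y - y.1 * g2 y) z.1 z.2).
    by apply/funext => z; rewrite derive1E; have H := rotating_derive_t z.1 z.2; rewrite derive_val.
  move=> z; apply: cvgM; first exact: cvg_cst.
  apply: continuous_rotating => y; apply: cvgB; apply: cvgM.
  + exact: cvg_snd.
  + exact: (C1_continuous1 C).
  + exact: cvg_fst.
  + exact: (C1_continuous2 C).
- have -> : (fun z : R * (R * R) => partial1 (phi z.1) z.2) = (fun z : R * (R * R) =>
      cos (- (Omega * z.1)) * rotating Omega g1 z.1 z.2 + sin (- (Omega * z.1)) * rotating Omega g2 z.1 z.2).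
    by apply/funext => z; have [H _] := rotating_partials z.1 z.2; rewrite /partial1 derive_val.
  move=> z.
  have ca : {for z, continuous (fun z : R * (R * R) => - (Omega * z.1))}.
    by apply: continuousN; apply: continuousM; [exact: cst_continuous|exact: cvg_fst].
  apply: cvgD; apply: cvgM.
  + by apply: continuous_comp => //; exact: continuous_cos.
  + exact/continuous_rotating/(C1_continuous1 C).
  + by apply: continuous_comp => //; exact: continuous_sin.
  + exact/continuous_rotating/(C1_continuous2 C).
- have -> : (fun z : R * (R * R) => partial2 (phi z.1) z.2) = (fun z : R * (R * R) =>
      - sin (- (Omega * z.1)) * rotating Omega g1 z.1 z.2 + cos (- (Omega * z.1)) * rotating Omega g2 z.1 z.2).
    by apply/funext => z; have [_ H] := rotating_partials z.1 z.2; rewrite /partial2 derive_val.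
  move=> z.
  have ca : {for z, continuous (fun z : R * (R * R) => - (Omega * z.1))}.
    by apply: continuousN; apply: continuousM; [exact: cst_continuous|exact: cvg_fst].
  apply: cvgD; apply: cvgM.
  + by apply: cvgN; apply: continuous_comp => //; exact: continuous_sin.
  + exact/continuous_rotating/(C1_continuous1 C).
  + by apply: continuous_comp => //; exact: continuous_cos.
  + exact/continuous_rotating/(C1_continuous2 C).
- have [r Hr] := C1_support C; exists r => t x rx.
  by rewrite /phi /rotating; have [] := Hr (rotation (- (Omega * t)) x); rewrite ?enorm_rotation.
Qed.

(** The gradient of the relative stream function [psi + Omega * |y| ^ 2 / 2], with
[psi] the stream function of [w]: in the rotating frame, the velocity is this
gradient turned by a right angle. *)
Definition rel1 w y : R := - (2 * pi)^-1 * biot_savart1 w y + Omega * y.1.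
Definition rel2 w y : R := - (2 * pi)^-1 * biot_savart2 w y + Omega * y.2.

Definition advection w y : R := rel2 w y * g1 y - rel1 w y * g2 y.

Lemma Rintegral_ae_eq (f h : R * R -> R) : measurable_fun [set: plane] f ->
  measurable_fun [set: plane] h -> {ae area, forall x, f x = h x} ->
  \int[area]_x f x = \int[area]_x h x.
Proof.
move=> mf mh fh; rewrite /Rintegral; congr fine; apply: ae_eq_integral => //.
- exact: measurableT_comp.
- exact: measurableT_comp.
- by apply: ae_imp fh => x -> _.
Qed.

Lemma stream_ae_eq w w' x : measurable_fun [set: plane] w ->
  measurable_fun [set: plane] w' -> {ae area, forall x, w x = w' x} ->
  stream w x = stream w' x.
Proof.
move=> mw mw' ww'; rewrite /stream; congr (_ * _).
have ml : measurable_fun [set: plane] (fun y : plane => ln (1 / enorm (x - y))).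
  apply: (measurableT_comp (@measurable_ln R)).
  apply: measurable_funM => //; apply: measurable_funV.
    exact: (measurable_sub_kernel (F := @enorm R) _ measurable_enorm).
  by move=> y; exact: enorm_ge0.
apply: Rintegral_ae_eq; [exact: measurable_funM|exact: measurable_funM|].
by apply: ae_imp ww' => y ->.
Qed.

Lemma material_derivativeE (omega : R -> R * R -> R) r w t x :
  measurable_fun [set: plane] (omega t) -> bounded_vorticity r w ->
  {ae area, forall y, omega t y = rotating Omega w t y} ->
  material_derivative omega phi t x = rotating Omega (advection w) t x.
Proof.
move=> mo W ow; set al := - (Omega * t); set y := rotation al x.
have Wr := bounded_vorticity_rotation al W.
have [mw w1 w0] := W; have [mwr _ _] := Wr.
have SE : stream (omega t) = stream w \o rotation al.
  apply/funext => z; rewrite /= -(stream_rotation _ _ mw).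
  exact: stream_ae_eq.
have G := has_grad_rotation (stream_grad (rotation al x) W).
have [D1 D2] := has_grad_partial G.
rewrite /material_derivative /velocity derive1E /partial1 /partial2 SE.
have Dt := rotating_derive_t t x.
have [P1 P2] := rotating_partials t x.
rewrite !derive_val /= /rotating -/al -/y /advection /rel1 /rel2.
have y1 : y.1 = cos al * x.1 - sin al * x.2 by [].
have y2 : y.2 = sin al * x.1 + cos al * x.2 by [].
rewrite y1 y2.
have h := cos2Dsin2 al; move: h; move: (cos al) (sin al) => c s h.
set A := - (2 * pi)^-1 * biot_savart1 w y; set B := - (2 * pi)^-1 * biot_savart2 w y.
transitivity (Omega * ((s * x.1 + c * x.2) * g1 y - (c * x.1 - s * x.2) * g2 y) + (c ^+ 2 + s ^+ 2) * (B * g1 y - A * g2 y)); first by ring.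
by rewrite h; ring.
Qed.

Lemma measurable_rotating (f : R * R -> R) t : measurable_fun [set: plane] f ->
  measurable_fun [set: plane] (rotating Omega f t).
Proof. by move=> mf; exact: (measurableT_comp mf (area_preserving_rotation _).1). Qed.

Lemma measurable_advection r w : bounded_vorticity r w -> measurable_fun [set: plane] (advection w).
Proof.
move=> W; have [c1 c2] := biot_savart_continuous W.
apply: measurable_funB; apply: measurable_funM.
- apply: measurable_funD; apply: measurable_funM => //.
  exact: continuous_measurable2.
- exact: (continuous_measurable2 (C1_continuous1 C)).
- apply: measurable_funD; apply: measurable_funM => //.
  exact: continuous_measurable2.
- exact: (continuous_measurable2 (C1_continuous2 C)).
Qed.

(** Tested with a function that rotates with the frame, the weak equation contains
no time derivative any more: it has been absorbed into the velocity, which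
becomes the velocity relative to the frame. The change of variables to the
rotating coordinates preserves area. *)
Lemma weak_identity (w0 : R * R -> R) (omega w : R -> R * R -> R) (t : R) :
  weak_solution w0 omega -> 0 <= t ->
  (forall s, 0 <= s <= t -> measurable_fun [set: plane] (omega s)) ->
  (forall s, 0 <= s <= t -> exists r, bounded_vorticity r (w s)) ->
  (forall s, 0 <= s <= t -> {ae area, forall y, omega s y = rotating Omega (w s) s y}) ->
  \int[area]_x (w t x * chi x) - \int[area]_x (w0 x * chi x) =
  \int[lebesgue_measure]_(s in `[0, t]) \int[area]_x (w s x * advection (w s) x).
Proof.
move=> [_ _ /(_ _ rotating_test_function t) WE] t0 mo W ow.
have mchi : measurable_fun [set: plane] chi.
  exact: (continuous_measurable2 (continuous_has_grad (C1_grad C))).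
have tt : 0 <= t <= t by rewrite t0 lexx.
have E1 : \int[area]_x (omega t x * phi t x) = \int[area]_x (w t x * chi x).
  have [r Wt] := W t tt; have [mw _ _] := Wt.
  rewrite -(area_preserving_integral (f := fun y => w t y * chi y) (area_preserving_rotation (- (Omega * t)))); last exact: measurable_funM.
  apply: Rintegral_ae_eq.
  - by apply: measurable_funM; [exact: mo|exact: measurable_rotating].
  - by apply: (measurable_rotating t (f := fun y => w t y * chi y)); exact: measurable_funM.
  - by apply: ae_imp (ow t tt) => y ->.
have E0 : \int[area]_x (w0 x * phi 0 x) = \int[area]_x (w0 x * chi x).
  by apply: eq_Rintegral => x _; rewrite /phi /rotating mulr0 oppr0 rotation0.
rewrite -E1 -E0 (WE t0); apply: eq_Rintegral => s; rewrite inE/= in_itv/= => st.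
have [r Wt] := W s st; have [mw _ _] := Wt.
have madv := measurable_advection Wt.
rewrite -(area_preserving_integral (f := fun y => w s y * advection (w s) y) (area_preserving_rotation (- (Omega * s)))); last exact: measurable_funM.
apply: Rintegral_ae_eq.
- apply: measurable_funM; first exact: mo.
  rewrite (_ : material_derivative omega phi s = rotating Omega (advection (w s)) s); last first.
    by apply/funext => x; exact: (material_derivativeE _ (mo s st) Wt (ow s st)).
  exact: measurable_rotating.
- by apply: (measurable_rotating s (f := fun y => w s y * advection (w s) y)); exact: measurable_funM.
- apply: ae_imp (ow s st) => y ->.
  by rewrite (material_derivativeE _ (mo s st) Wt (ow s st)).
Qed.

End rotating_test_functions.

(** * A cubic spline *)

Section spline.
Context {R : realType}.

Lemma is_deriveP (f : R -> R) (t a : R) :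
  (forall e : R, 0 < e -> exists2 d : R, 0 < d &
     forall h, `|h| < d -> `|f (t + h) - f t - h * a| <= e * `|h|) ->
  is_derive t 1 f a.
Proof.
move=> H.
have G : has_grad (fun x : R * R => f x.1) (t, 0) a 0.
  apply/has_gradP => e e0; have [d d0 Hd] := H e e0; exists d => // h hd /=.
  rewrite mulr0 addr0 (le_trans (Hd _ _))//.
    by rewrite (le_lt_trans (ler_enorm1 h)).
  by rewrite ler_pM2l// ler_enorm1.
have := @has_grad_curve _ (fun x : R * R => f x.1) id (cst 0) t _ _ _ _ G
  (is_derive_id t 1) (is_derive_cst 0 t 1).
by rewrite mulr1 mulr0 addr0.
Qed.

Definition ramp2 (t : R) : R := Num.max t 0 ^+ 2.

Lemma is_derive_ramp2 (t : R) : is_derive t 1 ramp2 (2 * Num.max t 0).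
Proof.
apply: is_deriveP => e e0; exists e => // h he; rewrite /ramp2.
have Hh : `|Num.max (t + h) 0 ^+ 2 - Num.max t 0 ^+ 2 - h * (2 * Num.max t 0)| <= h ^+ 2.
  have [h1|h1] := leP (t + h) 0; have [h2|h2] := leP t 0; rewrite ler_norml; apply/andP; split; nra.
apply: (le_trans Hh); rewrite -real_normK ?num_real// expr2.
by rewrite ler_wpM2r// ltW.
Qed.

Definition ramp3 (t : R) : R := t * ramp2 t.

Lemma is_derive_ramp3 (t : R) : is_derive t 1 ramp3 (3 * ramp2 t).
Proof.
have H := is_deriveM (is_derive_id t 1) (is_derive_ramp2 t).
apply: (is_derive_eq (H : is_derive t 1 ramp3 _)).
rewrite /GRing.scale/= mulr1 /ramp2.
by have [h|h] := leP t 0; ring.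
Qed.

Lemma is_derive_shift (f : R -> R) (t a b : R) : is_derive (t + b) 1 f a ->
  is_derive t 1 (fun s => f (s + b)) a.
Proof.
move=> H.
by have := @is_derive1_comp R f (fun s => s + b) t _ _ H (is_derive_addr b t);
  rewrite mulr1.
Qed.

(** A C2 step function, equal to 0 below -3 and to 16 above 3. It takes the value 8
at 0 and has slope at least 4 between -1 and 1; its first derivative [spline']
is a C1 bump, the weight of all the estimates below. *)
Definition spline (t : R) : R :=
  3^-1 * (ramp3 (t + 3) - 3 * ramp3 (t + 1) + 3 * ramp3 (t - 1) - ramp3 (t - 3)).
Definition spline' (t : R) : R :=
  ramp2 (t + 3) - 3 * ramp2 (t + 1) + 3 * ramp2 (t - 1) - ramp2 (t - 3).
Definition spline'' (t : R) : R :=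
  2 * (Num.max (t + 3) 0 - 3 * Num.max (t + 1) 0 + 3 * Num.max (t - 1) 0 - Num.max (t - 3) 0).

Lemma is_derive_spline (t : R) : is_derive t 1 spline (spline' t).
Proof.
have D (b : R) := is_derive_shift (is_derive_ramp3 (t + b)).
have H := is_deriveZ 3^-1 (is_deriveB (is_deriveD (is_deriveB (D 3) (is_deriveZ 3 (D 1)))
   (is_deriveZ 3 (D (-1)))) (D (-3))).
apply: (is_derive_eq (H : is_derive t 1 spline _)).
by rewrite /GRing.scale/= /spline'; field.
Qed.

Lemma is_derive_spline' (t : R) : is_derive t 1 spline' (spline'' t).
Proof.
have D (b : R) := is_derive_shift (is_derive_ramp2 (t + b)).
have H := is_deriveB (is_deriveD (is_deriveB (D 3) (is_deriveZ 3 (D 1)))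
   (is_deriveZ 3 (D (-1)))) (D (-3)).
apply: (is_derive_eq (H : is_derive t 1 spline' _)).
by rewrite /GRing.scale/= /spline''; ring.
Qed.

Lemma spline_pieces (t : R) :
  [/\ t <= -3 -> [/\ spline t = 0, spline' t = 0 & spline'' t = 0],
      -3 <= t <= -1 -> [/\ spline t = 3^-1 * (t + 3) ^+ 3, spline' t = (t + 3) ^+ 2 & spline'' t = 2 * (t + 3)],
      -1 <= t <= 1 -> [/\ spline t = 8 + 6 * t - 2 / 3 * t ^+ 3, spline' t = 6 - 2 * t ^+ 2 & spline'' t = - 4 * t],
      1 <= t <= 3 -> [/\ spline t = 16 - 3^-1 * (3 - t) ^+ 3, spline' t = (3 - t) ^+ 2 & spline'' t = - 2 * (3 - t)] &
      3 <= t -> [/\ spline t = 16, spline' t = 0 & spline'' t = 0]].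
Proof.
rewrite /spline /spline' /spline'' /ramp3 /ramp2.
split=> [h1|/andP[h1 h2]|/andP[h1 h2]|/andP[h1 h2]|h1].
- rewrite !(max_r (_ : _ <= 0)); try lra.
  by split; field.
- rewrite (max_l (_ : 0 <= t + 3)); last lra.
  rewrite !(max_r (_ : _ <= 0)); try lra.
  by split; field.
- rewrite (max_l (_ : 0 <= t + 3)); last lra.
  rewrite (max_l (_ : 0 <= t + 1)); last lra.
  rewrite !(max_r (_ : _ <= 0)); try lra.
  by split; field.
- rewrite (max_l (_ : 0 <= t + 3)); last lra.
  rewrite (max_l (_ : 0 <= t + 1)); last lra.
  rewrite (max_l (_ : 0 <= t - 1)); last lra.
  rewrite !(max_r (_ : _ <= 0)); try lra.
  by split; field.
- rewrite !(max_l (_ : 0 <= _)); try lra.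
  by split; field.
Qed.

Lemma spline_bounds (t : R) :
  [/\ 0 <= spline t <= 16, 0 <= spline' t <= 6, `|spline'' t| <= 4,
      0 <= t -> 4 * Num.min t 1 <= spline t - 8 &
      t <= 0 -> 4 * Num.min (- t) 1 <= 8 - spline t].
Proof.
have [P1 P2 P3 P4 P5] := spline_pieces t.
have cube (u : R) : 0 <= u <= 2 -> 0 <= u ^+ 3 <= 8.
  move=> /andP[u0 u2]; rewrite exprn_ge0//= (_ : 8 = 2 ^+ 3); last by ring.
  by rewrite lerXn2r// nnegrE.
have [h1|h1] := leP t (-3).
  have [-> -> ->] := P1 h1; split; rewrite ?normr0; try lra.
  by move=> _; have [] := leP (- t) 1; lra.
have [h2|h2] := leP t (-1).
  have [|-> -> ->] := P2; first by rewrite (ltW h1).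
  have := cube (t + 3) ltac:(lra); set u := (t + 3) ^+ 3 => hu.
  split; rewrite ?ler_norml; try lra; try nra.
  by move=> _; rewrite min_r; lra.
have [h3|h3] := leP t 1.
  have [|-> -> ->] := P3; first by rewrite (ltW h2).
  have t3 : -1 <= t ^+ 3 <= 1.
    by rewrite -ler_norml normrX exprn_ile1// ler_norml (ltW h2).
  split; rewrite ?ler_norml; try lra; try nra.
  by move=> t0; rewrite min_l; nra.
have [h4|h4] := leP t 3.
  have [|-> -> ->] := P4; first by rewrite (ltW h3).
  have := cube (3 - t) ltac:(lra); set u := (3 - t) ^+ 3 => hu.
  by split; rewrite ?ler_norml; try lra; try nra.
have [-> -> ->] := P5 (ltW h4).
by split; rewrite ?normr0; lra.
Qed.

Lemma spline'_ge4 (t : R) : -1 <= t <= 1 -> 4 <= spline' t.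
Proof.
by move=> h; have [_ _ /(_ h) [_ -> _] _ _] := spline_pieces t; nra.
Qed.

Lemma spline_flat (t : R) : 3 <= `|t| -> spline' t = 0 /\ spline'' t = 0.
Proof.
have [P1 _ _ _ P5] := spline_pieces t.
rewrite ler_normr => /orP[/P5[_ -> ->]//|h].
by have [|_ -> ->] := P1; first lra.
Qed.

Lemma continuous_spline' : continuous spline'.
Proof. by move=> t; exact: is_derive_continuous1 (is_derive_spline' t). Qed.

Lemma continuous_spline'' : continuous spline''.
Proof.
move=> t.
have c (b : R) : {for t, continuous (fun s => Num.max (s + b) 0)}.
  apply: continuous_max; last exact: cst_continuous.
  by apply: continuousD; [exact: cvg_id|exact: cst_continuous].
rewrite /continuous_at /spline''; apply: cvgM; first exact: cvg_cst.
apply: cvgB; last exact: c.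
by apply: cvgD; [apply: cvgB; [exact: c|]|]; (apply: cvgM; [exact: cvg_cst|exact: c]).
Qed.

Lemma spline_radial_C1 (p q : R) : 0 < q ->
  let N x := p - q * enorm x ^+ 2 in
  C1_compact (spline \o N) (fun x => spline' (N x) * (- 2 * q * x.1))
    (fun x => spline' (N x) * (- 2 * q * x.2)).
Proof.
move=> q0 N.
have GN x : has_grad N x (- 2 * q * x.1) (- 2 * q * x.2).
  rewrite (_ : N = (fun x => p + - q * enorm x ^+ 2)); last first.
    by apply/funext => y; rewrite /N mulNr.
  by apply: (has_grad_eq (has_gradD (has_grad_cst p x)
    (has_gradM (has_grad_cst (- q) x) (has_grad_sqr_enorm x)))); ring.
have cS x : {for x, continuous (fun x => spline' (N x))}.
  apply: continuous_comp; last exact: continuous_spline'.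
  exact: has_grad_continuous (GN x).
split.
- by move=> x; exact: has_grad_comp1 (is_derive_spline (N x)) (GN x).
- by move=> x; apply: cvgM; [exact: cS|apply: cvgM; [exact: cvg_cst|exact: cvg_fst]].
- by move=> x; apply: cvgM; [exact: cS|apply: cvgM; [exact: cvg_cst|exact: cvg_snd]].
- exists (`|(p + 3) / q| + 1) => x xr.
  have N3 : N x <= - 3.
    have : (p + 3) / q <= enorm x ^+ 2.
      have := ler_norm ((p + 3) / q); have := normr_ge0 ((p + 3) / q); nra.
    by rewrite ler_pdivrMr// /N; lra.
  by have [/(_ N3)[/= -> -> _] _ _ _ _] := spline_pieces (N x); rewrite !mul0r.
Qed.

End spline.

(** * The area of the bands of a radially decreasing function *)

Section divergence.
Context {R : realType}.
Local Notation leb := (@lebesgue_measure R).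
Local Notation plane := (measurableTypeR R * measurableTypeR R)%type.
Implicit Types (x y z : R * R) (w f : R * R -> R).

Lemma integrable_bounded_support f (M r : R) : measurable_fun [set: plane] f ->
  (forall x, `|f x| <= M) -> (forall x, r <= enorm x -> f x = 0) ->
  area.-integrable setT (EFin \o f).
Proof.
move=> mf fM fr.
have M1 : 0 < `|M| + 1 by rewrite ltr_wpDl.
have W : bounded_vorticity r (fun x => (`|M| + 1)^-1 * f x).
  split; first exact: measurable_funM.
    move=> x; rewrite normrM gtr0_norm ?invr_gt0// mulrC ler_pdivrMr// mul1r.
    by rewrite (le_trans (fM x))// (le_trans (ler_norm M))// lerDl.
  by move=> x /fr ->; rewrite mulr0.
have := integrable_funZ (`|M| + 1) (integrable_vorticity W).
by apply: eq_integrable => // x _ /=; rewrite mulrA divff ?mul1r// gt_eqF.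
Qed.

Lemma continuous_bounded_support f (r : R) : continuous f ->
  (forall x, r <= enorm x -> f x = 0) -> exists M : R, forall x, `|f x| <= M.
Proof.
move=> cf fr.
have cA : compact (`[- `|r|, `|r|] `*` `[- `|r|, `|r|] : set (R * R)).
  by apply: compact_setX; exact: segment_compact.
have /compact_bounded[M [_ HM]] := continuous_compact (continuous_subspaceT cf) cA.
exists (`|M| + 1) => x.
have [x1|x1] := leP r (enorm x); first by rewrite fr// normr0 ltW// ltr_wpDl.
apply: HM; first by rewrite (le_lt_trans (ler_norm M))// ltrDl.
exists x => //; have rr := ler_norm r; split; rewrite /= in_itv/= -ler_norml.
  by rewrite (le_trans (ler_enorm1 x))// ltW// (lt_le_trans x1).
by rewrite (le_trans (ler_enorm2 x))// ltW// (lt_le_trans x1).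
Qed.

Lemma integrable_continuous f (r : R) : continuous f ->
  (forall x, r <= enorm x -> f x = 0) -> area.-integrable setT (EFin \o f).
Proof.
move=> cf fr; have [M HM] := continuous_bounded_support cf fr.
by apply: (integrable_bounded_support _ HM fr); exact: continuous_measurable2.
Qed.

Lemma L1norm_le r w : 0 <= r -> bounded_vorticity r w -> L1norm w <= 8 * r ^+ 2.
Proof.
move=> r0 W; have [mw w1 w0] := W.
have I := integrable_funZ r (integrable_sing r (0 : R * R)).
have Iw := integrable_norm (integrable_vorticity W).
apply: (@le_trans _ _ (\int[area]_y (r * sing r (0 - y)))); last first.
  rewrite RintegralZl//; last exact: integrable_sing.
  have := Rintegral_sing_le (0 : R * R) r0; nra.
rewrite /L1norm -[leLHS]ger0_norm; last exact: L1norm_ge0.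
apply: normr_Rintegral_le_ae => //.
  by move=> y; rewrite mulr_ge0// sing_ge0.
apply: ae_imp (ae_neq 0) => y y0; rewrite normr_id.
have [wy|wy] := eqVneq (w y) 0.
  by rewrite wy normr0 mulr_ge0// sing_ge0.
have yr : enorm y <= r.
  by rewrite ltW// ltNge; apply: contra wy => /w0 ->.
by rewrite /sing sub0r enormN yr (le_trans (w1 y))// ler_pdivlMr ?enorm_gt0// mul1r.
Qed.

Lemma integral_derivative_compact (f g : R -> R) (r : R) : 0 < r ->
  (forall t : R, is_derive t 1 f (g t)) -> continuous g ->
  (forall t : R, r <= `|t| -> f t = 0 /\ g t = 0) ->
  (\int[leb]_t (g t)%:E = 0)%E.
Proof.
move=> r0 df cg fr.
have -> : (\int[leb]_t (g t)%:E = \int[leb]_(t in `[(- r)%R, r]) (g t)%:E)%E.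
  rewrite [RHS]integral_mkcond; apply: eq_integral => t _.
  rewrite patchE mem_setE in_itv/= -ler_norml; case: ifPn => // h.
  by have [|_ ->] := fr t; rewrite ?ltW// ltNge.
rewrite (is_derive_FTC2 _ _ (fun t _ => df t)).
- have [|-> _] := fr r; first by rewrite gtr0_norm.
  have [|-> _] := fr (- r); first by rewrite normrN gtr0_norm.
  by rewrite subrr.
- by rewrite gtrN.
- exact: continuous_subspaceT.
Qed.

Lemma Rintegral_partial_eq0 f g1 g2 : C1_compact f g1 g2 ->
  \int[area]_x g1 x = 0 /\ \int[area]_x g2 x = 0.
Proof.
move=> C; have [r Hr] := C1_support C.
have I1 : area.-integrable setT (EFin \o g1).
  by apply: (integrable_continuous (r := r) (C1_continuous1 C)) => x /Hr[].
have I2 : area.-integrable setT (EFin \o g2).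
  by apply: (integrable_continuous (r := r) (C1_continuous2 C)) => x /Hr[].
have r1 : 0 < `|r| + 1 by rewrite ltr_wpDl.
have rr : r <= `|r| + 1 by rewrite (le_trans (ler_norm r))// lerDl.
split.
- rewrite /Rintegral -(integral21_prod_meas1 I1) (_ : fubini_G _ _ = cst 0%E) ?integral0//.
  apply/funext => y; rewrite /fubini_G/=.
  apply: (@integral_derivative_compact (fun t => f (t, y)) (fun t => g1 (t, y)) (`|r| + 1)) => //.
  + move=> t; have := @has_grad_curve _ f id (cst y) t _ _ _ _ (C1_grad C (t, y))
      (is_derive_id t 1) (is_derive_cst y t 1).
    by rewrite mulr1 mulr0 addr0.
  + move=> t; apply: (@continuous_comp _ _ _ (fun t => (t, y)) g1); last exact: (C1_continuous1 C).
    by apply: (@cvg_pair _ _ _ (nbhs t) (nbhs t) (nbhs y)); [exact: cvg_id|exact: cvg_cst].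
  + move=> t ht; have [|-> -> _] := Hr (t, y); last by [].
    by rewrite (le_trans rr)// (le_trans ht)// (ler_enorm1 (t, y)).
- rewrite /Rintegral -(integral12_prod_meas1 I2) (_ : fubini_F _ _ = cst 0%E) ?integral0//.
  apply/funext => y; rewrite /fubini_F/=.
  apply: (@integral_derivative_compact (fun t => f (y, t)) (fun t => g2 (y, t)) (`|r| + 1)) => //.
  + move=> t; have := @has_grad_curve _ f (cst y) id t _ _ _ _ (C1_grad C (y, t))
      (is_derive_cst y t 1) (is_derive_id t 1).
    by rewrite mulr1 mulr0 add0r.
  + move=> t; apply: (@continuous_comp _ _ _ (fun t => (y, t)) g2); last exact: (C1_continuous2 C).
    by apply: (@cvg_pair _ _ _ (nbhs t) (nbhs y) (nbhs t)); [exact: cvg_cst|exact: cvg_id].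
  + move=> t ht; have [|-> _ ->] := Hr (y, t); last by [].
    by rewrite (le_trans rr)// (le_trans ht)// (ler_enorm2 (y, t)).
Qed.

(** Twice the bound 16 of the test functions times the bound 32 of the area of
their support. *)
Definition band_constant : R := 1024.

Lemma band_constant_gt0 : 0 < band_constant.
Proof. by rewrite /band_constant ltr0n. Qed.

(** The divergence of the field [f(x) * x] has integral zero, so the integral of the
radial decrease [- x . grad f] is twice that of [f]. The radial decrease is
nonnegative and at least [kappa] on [B]. *)
Lemma radial_band_area f g1 g2 (kappa : R) (B : set (R * R)) :
  C1_compact f g1 g2 ->
  (forall x, 0 <= f x <= 16) ->
  (forall x, 2 <= enorm x -> [/\ f x = 0, g1 x = 0 & g2 x = 0]) ->
  0 < kappa -> measurable (B : set plane) ->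
  (forall x, x.1 * g1 x + x.2 * g2 x <= 0) ->
  (forall x, B x -> x.1 * g1 x + x.2 * g2 x <= - kappa) ->
  L1norm (\1_B) <= band_constant / kappa.
Proof.
move=> C f16 f2 kappa0 mB rad radB.
have cf := continuous_has_grad (C1_grad C); have mf := continuous_measurable2 cf.
have C1 : C1_compact (fun y => y.1 * f y) (fun y => f y + y.1 * g1 y) (fun y => y.1 * g2 y).
  split.
  - move=> x; have := has_gradM (has_grad_fst x) (C1_grad C x).
    by rewrite mulr1 mulr0 addr0 addrC.
  - move=> x; apply: cvgD; first exact: cf.
    by apply: cvgM; [exact: cvg_fst|exact: (C1_continuous1 C)].
  - by move=> x; apply: cvgM; [exact: cvg_fst|exact: (C1_continuous2 C)].
  - by exists 2 => x /f2[-> -> ->]; rewrite !mulr0 addr0.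
have C2 : C1_compact (fun y => y.2 * f y) (fun y => y.2 * g1 y) (fun y => f y + y.2 * g2 y).
  split.
  - move=> x; have := has_gradM (has_grad_snd x) (C1_grad C x).
    by rewrite mulr1 mulr0 addr0 (addrC (f x)).
  - by move=> x; apply: cvgM; [exact: cvg_snd|exact: (C1_continuous1 C)].
  - move=> x; apply: cvgD; first exact: cf.
    by apply: cvgM; [exact: cvg_snd|exact: (C1_continuous2 C)].
  - by exists 2 => x /f2[-> -> ->]; rewrite !mulr0 addr0.
have [Z1 _] := Rintegral_partial_eq0 C1; have [_ Z2] := Rintegral_partial_eq0 C2.
have If : area.-integrable setT (EFin \o f).
  by apply: (integrable_continuous (r := 2) cf) => x /f2[].
have IE1 : area.-integrable setT (EFin \o (fun y => f y + y.1 * g1 y)).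
  apply: (integrable_continuous (r := 2) (C1_continuous1 C1)) => x /f2[-> -> _].
  by rewrite mulr0 addr0.
have IE2 : area.-integrable setT (EFin \o (fun y => f y + y.2 * g2 y)).
  apply: (integrable_continuous (r := 2) (C1_continuous2 C2)) => x /f2[-> _ ->].
  by rewrite mulr0 addr0.
pose D y := - (y.1 * g1 y + y.2 * g2 y).
have DE' y : D y = 2 * f y - ((f y + y.1 * g1 y) + (f y + y.2 * g2 y)) by rewrite /D; ring.
have I2f := integrable_funZ 2 If; have IE12 := integrable_funD IE1 IE2.
have ID : area.-integrable setT (EFin \o D).
  have := integrable_funB I2f IE12; congr (_.-integrable _ _).
  by apply/funext => y; rewrite /= -DE'.
have DE : \int[area]_y D y = 2 * \int[area]_y f y.
  under eq_Rintegral do rewrite DE'.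
  by rewrite RintegralB// RintegralD// Z1 Z2 addr0 subr0 RintegralZl.
have fle : \int[area]_y f y <= 16 * 32.
  have W : bounded_vorticity 2 (fun y => 16^-1 * f y).
    split; first exact: measurable_funM.
      move=> x; have /andP[f0 fl] := f16 x.
      by rewrite normrM !ger0_norm ?invr_ge0// mulrC ler_pdivrMr// mul1r.
    by move=> x /f2[-> _ _]; rewrite mulr0.
  have := L1norm_le (ler0n R 2) W.
  have -> : L1norm (fun y => 16^-1 * f y) = 16^-1 * \int[area]_y f y.
    rewrite /L1norm -RintegralZl//; apply: eq_Rintegral => y _.
    by rewrite ger0_norm// mulr_ge0 ?invr_ge0//; case/andP: (f16 y).
  lra.
have mI : measurable_fun [set: plane] (\1_B : R * R -> R) by exact: measurable_indic.
rewrite ler_pdivlMr// mulrC.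
have IB : area.-integrable setT (EFin \o (fun y => kappa * `|\1_B y : R|)).
  apply: (@integrable_dominated _ plane R area _ D) => //.
    by apply: measurable_funM => //; exact: measurableT_comp.
  move=> x; rewrite indicE; case: (boolP (x \in B)) => xB /=.
    rewrite normr1 mulr1 ger0_norm ?(ltW kappa0)// /D lerNr.
    by apply: radB; exact/set_mem.
  by rewrite normr0 mulr0 normr0 /D oppr_ge0.
have IBB : area.-integrable setT (EFin \o (fun y => `|\1_B y : R|)).
  have := integrable_funZ kappa^-1 IB.
  by apply: eq_integrable => // x _ /=; rewrite mulrA mulVf ?mul1r// gt_eqF.
rewrite /L1norm -RintegralZl//.
have : \int[area]_y (kappa * `|\1_B y : R|) <= \int[area]_y D y.
  apply: le_Rintegral => // x _; rewrite indicE; case: (boolP (x \in B)) => xB /=.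
    by rewrite normr1 mulr1 /D lerNr; apply: radB; exact/set_mem.
  by rewrite normr0 mulr0 /D oppr_ge0.
rewrite DE /band_constant; lra.
Qed.

End divergence.

(** * The velocity field of the unit disk *)

Section unit_disk.
Context {R : realType}.
Local Notation leb := (@lebesgue_measure R).
Local Notation plane := (measurableTypeR R * measurableTypeR R)%type.
Implicit Types (x y z : R * R) (w f : R * R -> R).

Lemma atan_add_inv (q : R) : 0 < q -> atan q + atan q^-1 = pi / 2.
Proof.
move=> q0; have pi0 := pi_gt0 R.
have a0 : 0 < atan q by rewrite -(atan0 R); exact: lt_atan.
have a1 := atan_ltpi2 q.
suff -> : atan q^-1 = pi / 2 - atan q by rewrite addrC subrK.
rewrite -(@tanK _ (pi / 2 - atan q)); last first.
  by rewrite in_itv/=; apply/andP; split; lra.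
congr atan; rewrite /tan.
have -> : pi / 2 - atan q = - (atan q - pi / 2) by ring.
rewrite sinN cosN.
have S := sinDpihalf (atan q - pi / 2); have Cc := cosDpihalf (atan q - pi / 2).
rewrite subrK in S Cc; rewrite -S -Cc -{1}(atanK q) /tan.
by rewrite invf_div.
Qed.

Definition disk : R * R -> R := \1_(eball (1 : R)).

Lemma diskE x : disk x = if x.1 ^+ 2 + x.2 ^+ 2 < 1 then 1 else 0.
Proof.
have e : enorm x ^+ 2 = x.1 ^+ 2 + x.2 ^+ 2 := sqr_enorm x.
have e0 := enorm_ge0 x; rewrite /disk indicE -e.
have [h|h] := ltP (enorm x ^+ 2) 1.
  by rewrite mem_set// /eball/=; nra.
by rewrite memNset// /eball/=; nra.
Qed.

Lemma bounded_vorticity_disk : bounded_vorticity 1 disk.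
Proof.
split.
- have m1 : measurable_fun [set: plane] (fun x : plane => x.1 ^+ 2 + x.2 ^+ 2).
    by apply: measurable_funD; apply: measurable_funX.
  have mb : measurable_fun [set: plane] (fun x : plane => x.1 ^+ 2 + x.2 ^+ 2 < 1).
    exact: measurable_fun_ltr.
  have : measurable_fun [set: plane] (fun x : plane => if x.1 ^+ 2 + x.2 ^+ 2 < 1 then (1 : R) else 0).
    exact: measurable_fun_ifT.
  by apply: eq_measurable_fun => x _; rewrite diskE.
- by move=> x; rewrite diskE; case: ifP => _; rewrite ?normr1 ?normr0.
- by move=> x; rewrite diskE -sqr_enorm; case: ltP => // h1 h2; exfalso; nra.
Qed.

Let chord (t s : R) : R :=
  ((1 - t) / ((1 - t) ^+ 2 + s ^+ 2) + (1 + t) / ((1 + t) ^+ 2 + s ^+ 2)).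

Lemma continuous_chord (t : R) : `|t| < 1 -> continuous (chord t).
Proof.
rewrite ltr_norml => /andP[t1 t2].
have CD (a : R) : 0 < a -> continuous (fun s : R => a / (a ^+ 2 + s ^+ 2)).
  move=> a0 s; apply: cvgM; first exact: cvg_cst.
  apply: cvgV; first by rewrite lt0r_neq0// ltr_pwDl ?exprn_gt0// sqr_ge0.
  by apply: cvgD; [exact: cvg_cst|exact: exprn_continuous].
by move=> s; apply: cvgD; apply: CD; lra.
Qed.

(** The kernels at a point of the disk and at the opposite point add up, on each
vertical chord, to the derivative of a sum of two arctangents. The arguments of
these are inverse to each other at the ends of the chord, so that all chords
contribute the same amount. *)
Lemma integral_chord (t : R) : `|t| < 1 ->
  (\int[leb]_(s in `[(- Num.sqrt (1 - t ^+ 2))%R, Num.sqrt (1 - t ^+ 2)]) (chord t s)%:E = pi%:E)%E.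
Proof.
rewrite ltr_norml => /andP[t1 t2].
have pp : 0 < 1 - t by lra.
have qq : 0 < 1 + t by lra.
have hh : 0 < 1 - t ^+ 2 by nra.
set h := Num.sqrt _; have h0 : 0 < h by rewrite sqrtr_gt0.
have h2 : h ^+ 2 = (1 - t) * (1 + t) by rewrite sqr_sqrtr ?(ltW hh)//; ring.
pose F s := atan (s / (1 - t)) + atan (s / (1 + t)).
have D (a s : R) : 0 < a -> is_derive s 1 (fun s : R => atan (s / a)) (a / (a ^+ 2 + s ^+ 2)).
  move=> a0.
  have := @is_derive1_comp R atan (fun s => s / a) s _ _ (is_derive1_atan (s / a)) (is_derive_mulr a^-1 s).
  move=> H; apply: (is_derive_eq H); field.
  by rewrite !gt_eqF// ltr_pwDl ?exprn_gt0// sqr_ge0.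
have DF (s : R) : is_derive s 1 F (chord t s) by exact: is_deriveD (D _ s pp) (D _ s qq).
rewrite (@is_derive_FTC2 _ F); [|by rewrite gtrN|].
- congr EFin; rewrite /F !mulNr !atanN -!opprD opprK.
  have -> : h / (1 + t) = (h / (1 - t))^-1.
    by rewrite invf_div; apply/eqP; rewrite eqr_div ?(gt_eqF qq) ?(gt_eqF h0)// -expr2 h2.
  by rewrite atan_add_inv ?divr_gt0// -splitr.
- by apply: continuous_subspaceT => s; apply: continuous_chord; rewrite ltr_norml t1.
Qed.

Let e1 : R * R := (1, 0).

Lemma biot_savart1_disk : biot_savart1 disk (1, 0) = pi.
Proof.
have W := bounded_vorticity_disk; have [md _ _] := W.
have I1 := integrable_kern1 (e1 : R * R) W.
have R0 := area_preserving_reflection (0 : R * R).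
have I2 := area_preserving_integrable R0 I1.
have E2 := area_preserving_integral R0 (integrable_measurable I1).
suff : \int[area]_y (kern1 (e1 - y) * disk y) + \int[area]_y (kern1 (e1 - (0 - y)) * disk (0 - y)) = 2 * pi.
  by rewrite E2 -/(biot_savart1 disk e1) -/e1; move: (biot_savart1 _ _) => u; lra.
rewrite -RintegralD//.
have IS := integrable_funD I1 I2.
rewrite /Rintegral -(integral12_prod_meas1 IS).
transitivity (fine (\int[leb]_t (if t \in `](-1)%R, 1%R[%classic then pi%:E else 0%E))%E).
  congr fine; apply: eq_integral => t _; rewrite /fubini_F/=.
  rewrite mem_setE in_itv/= -ltr_norml; case: ifPn => ht.
    rewrite -(integral_chord ht).
    have h0 : 0 <= 1 - t ^+ 2 by move: ht; rewrite ltr_norml => /andP[*]; nra.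
    rewrite integral_itv_bndoo//; last first.
      apply/measurable_EFinP; apply: measurable_funTS.
      by apply: continuous_measurable_fun; exact: continuous_chord.
    rewrite [RHS]integral_mkcond; apply: eq_integral => s _.
    rewrite patchE mem_setE in_itv/= -ltr_norml.
    rewrite !diskE /= !add0r !sqrrN.
    have -> : (t ^+ 2 + s ^+ 2 < 1) = (`|s| < Num.sqrt (1 - t ^+ 2)).
      have [s1|s1] := ltP (t ^+ 2 + s ^+ 2) 1.
        by rewrite -sqrtr_sqr ltr_sqrt; [lra|move: (sqr_ge0 s); lra].
      by apply/esym/negbTE; rewrite -leNgt -sqrtr_sqr ler_sqrt; [lra|exact: sqr_ge0].
    case: ifP => _; last by rewrite !mulr0 addr0.
    rewrite !mulr1 /kern1 /chord !sqr_enorm /=; congr EFin; congr (_ / _ + _ / _); ring.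
  rewrite -(@integral0 _ _ _ leb setT); apply: eq_integral => s _.
  rewrite !diskE/= !add0r !sqrrN.
  case: ltP => h; last by rewrite !mulr0 addr0.
  exfalso; move/negP : ht; apply; rewrite -(ltr_pXn2r (n := 2))// ?nnegrE// expr1n real_normK ?num_real//; nra.
rewrite -integral_mkcond integral_cst//= lebesgue_measure_itv/= lte_fin ifT; last by lra.
by rewrite -EFinD opprK/= mulrC.
Qed.

Lemma disk_rotation (al : R) x : disk (rotation al x) = disk x.
Proof. by rewrite !diskE -!sqr_enorm enorm_rotation. Qed.

(** The rotation that takes [(1, 0)] to [x] preserves the disk and reduces the claim
to that point. *)
Lemma disk_radial x : enorm x = 1 -> x.1 * biot_savart1 disk x + x.2 * biot_savart2 disk x = pi.
Proof.
move=> x1; have W := bounded_vorticity_disk; have [md _ _] := W.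
have cs : x.1 ^+ 2 + x.2 ^+ 2 = 1 by rewrite -sqr_enorm x1 expr1n.
have J1 := integrable_kern1 x W; have J2 := integrable_kern2 x W.
have K1 := integrable_funZ x.1 J1; have K2 := integrable_funZ x.2 J2.
rewrite /biot_savart1 /biot_savart2 -RintegralZl// -RintegralZl// -RintegralD//.
have mI := integrable_measurable (integrable_funD K1 K2).
rewrite -(area_preserving_integral (area_preserving_unit_matrix cs) mI) -biot_savart1_disk.
apply: eq_Rintegral => y _.
have DE : disk (x.1 * y.1 - x.2 * y.2, x.2 * y.1 + x.1 * y.2) = disk y.
  rewrite !diskE /=; congr (if _ < 1 then _ else _).
  transitivity ((x.1 ^+ 2 + x.2 ^+ 2) * (y.1 ^+ 2 + y.2 ^+ 2)); first by ring.
  by rewrite cs mul1r.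
rewrite DE !mulrA -mulrDl; congr (_ * _).
rewrite /kern1 /kern2 -mulrDl !sqr_enorm /=; congr (_ / _).
  transitivity ((x.1 ^+ 2 + x.2 ^+ 2) * (1 - y.1)); first by ring.
  by rewrite cs mul1r.
transitivity ((x.1 ^+ 2 + x.2 ^+ 2) * ((1 - y.1) ^+ 2 + (0 - y.2) ^+ 2)); first by ring.
by rewrite cs mul1r.
Qed.

End unit_disk.

(** * Polar coordinates *)

Section polar_coordinates.
Context {R : realType}.
Local Notation plane := (measurableTypeR R * measurableTypeR R)%type.
Implicit Types (x y z : R * R) (f : R * R -> R) (g : R -> R).

Lemma polar_exists x : exists t : R, x = polar (enorm x) t.
Proof.
have [->|x0] := eqVneq x 0; first by exists 0; rewrite enorm0 /polar !mul0r.
have r0 : 0 < enorm x by rewrite enorm_gt0.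
have E := sqr_enorm x; set r := enorm x in r0 E *.
pose c := x.1 / r.
have rc : r * c = x.1 by rewrite /c mulrC divfK// gt_eqF.
have c1 : -1 <= c <= 1.
  by rewrite -ler_norml normrM normfV (gtr0_norm r0) ler_pdivrMr// mul1r ler_enorm1.
have s : r * Num.sqrt (1 - c ^+ 2) = `|x.2|.
  rewrite -{1}(gtr0_norm r0) -sqrtr_sqr -sqrtrM ?sqr_ge0// -sqrtr_sqr; congr Num.sqrt.
  by rewrite mulrBr mulr1 -exprMn rc E addrC addKr.
have [x2|x2] := leP 0 x.2.
  exists (acos c); rewrite /polar acosK ?in_itv//= sin_acos// rc s ger0_norm//.
  by case: x {x0 r0 E r c rc c1 s x2}.
exists (- acos c); rewrite /polar cosN sinN acosK ?in_itv//= sin_acos// rc mulrN s ltr0_norm// opprK.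
by case: x {x0 r0 E r c rc c1 s x2}.
Qed.

Lemma polar_dot (r s t u : R) : dot (polar r t) (polar s u) = r * s * cos (t - u).
Proof. by rewrite /dot /polar cosB /=; ring. Qed.

Lemma periodic_int (g : R -> R) (T a : R) (n : int) : (forall t, g (t + T) = g t) ->
  g (a + n%:~R * T) = g a.
Proof.
move=> gT.
have P (k : nat) b : g (b + k%:R * T) = g b.
  elim: k b => [|k IH] b; first by rewrite mul0r addr0.
  by rewrite -natr1 mulrDl mul1r addrA gT.
case: (intP n) => [|k|k]; first by rewrite mul0r addr0.
  exact: P.
rewrite -[LHS](P k.+1); congr g; rewrite mulrNz mulNr; exact: subrK.
Qed.

(** Closeness of two angles is expressed by the cosine of their difference, which
makes a choice of representatives modulo [2 * pi] unnecessary. *)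
Lemma angular_continuity g (t0 e : R) : continuous g -> (forall t, g (t + 2 * pi) = g t) ->
  0 < e -> exists2 c : R, 0 < c < 1 & forall t, c < cos (t - t0) -> `|g t - g t0| < e.
Proof.
move=> cg gT e0; have pi0 := pi_gt0 R.
have /cvgrPdist_lt/(_ _ e0)/nbhs_ballP[d /= d0 Hd] := cg t0.
pose dd := Num.min (d / 2) (pi / 2).
have dd0 : 0 < dd by rewrite lt_min !divr_gt0.
have dd1 : dd < d by rewrite (@le_lt_trans _ _ (d / 2))// ?ge_min ?lexx//; lra.
have dd2 : dd <= pi / 2 by rewrite ge_min lexx orbT.
have cd1 : cos dd < 1.
  by rewrite -(cos0 R) ltr_cos// in_itv/= ?lexx; apply/andP; split; lra.
exists (Num.max 2^-1 (cos dd)); first by rewrite lt_max gt_max cd1 !andbT; apply/andP; split; [apply/orP; left|]; lra.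
move=> t; rewrite gt_max => /andP[_ tc].
pose n := Num.floor ((t - t0 + pi) / (2 * pi)).
pose v := t - t0 - n%:~R * (2 * pi).
have pp : 0 < 2 * pi :> R by lra.
have v1 : - pi <= v <= pi.
  have := Num.Theory.floor_le ((t - t0 + pi) / (2 * pi)); have := Num.Theory.floorD1_gt ((t - t0 + pi) / (2 * pi)).
  rewrite -/n intrD ltr_pdivrMr// ler_pdivlMr// /v => h1 h2.
  by apply/andP; split; lra.
have cv : cos v = cos (t - t0).
  rewrite /v -mulNr -intrN (@periodic_int (@cos R))// => u.
  by have := @cosD2pi R u; rewrite mulr_natl.
have gv : g (t0 + v) = g t.
  rewrite -(@periodic_int g (2 * pi) t (- n))// intrN mulNr; congr g; rewrite /v; ring.
have vd : `|v| < dd.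
  rewrite -ltr_cos ?in_itv/=; last by rewrite (ltW dd0)/=; lra.
    by case: (ger0P v) => _; rewrite ?cosN cv.
  by rewrite normr_ge0 ler_norml.
rewrite -gv distrC; apply: Hd; rewrite /ball/= opprD addrA subrr sub0r normrN.
exact: lt_trans vd dd1.
Qed.

Lemma open_enormP (A : set (R * R)) :
  (forall x, A x -> exists2 d : R, 0 < d & forall y, enorm (y - x) < d -> A y) -> open A.
Proof.
move=> H; rewrite openE => x /H[d d0 Hd]; apply/nbhs_ballP; exists (d / 2) => /=.
  by rewrite divr_gt0.
move=> y; rewrite -ball_normE /= => xy; apply: Hd; rewrite enormBC.
by rewrite (le_lt_trans (enorm_le_maxnorm _))// -normE_maxnorm; lra.
Qed.

Lemma enorm_ball_nbhs (A : set (R * R)) x : open A -> A x ->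
  exists2 d : R, 0 < d & forall y, enorm (y - x) < d -> A y.
Proof.
move=> oA Ax; have /nbhs_ballP[d /= d0 Hd] : nbhs x A by exact: open_nbhs_nbhs.
exists d => // y xy; apply: Hd; rewrite -ball_normE /= normE_maxnorm.
by rewrite (le_lt_trans (maxnorm_le_enorm _))// enormBC.
Qed.

Section kelvin_sets.
Variable g : R -> R.
Hypotheses (cg : continuous g) (gT : forall t, g (t + 2 * pi) = g t).
Hypothesis g2 : forall t, - 2^-1 < g t.

(** A point has several pairs of polar coordinates; the function [g], being
continuous and periodic, has the same value at all its angles. *)
Lemma kelvin_setP (r t : R) : 0 <= r -> kelvin_set g (polar r t) <-> r < 1 + g t.
Proof.
move=> r0; split=> [[r' [t' [r'0 rg E]]]|h]; last by exists r, t.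
have rr : r = r' by rewrite -(enorm_polar t r0) E enorm_polar.
rewrite -rr in rg E r'0.
have [r00|rn0] := eqVneq r 0; first by rewrite r00; have := g2 t; lra.
have rp : 0 < r by rewrite lt0r rn0.
suff -> : g t = g t' by [].
have c1 : cos (t - t') = 1.
  have := polar_dot r r t t'; rewrite E polar_dot subrr cos0 mulr1.
  by rewrite -{1}[r * r]mulr1 => /mulfI; rewrite mulf_neq0// => ->.
apply/eqP; rewrite -subr_eq0 -normr_le0; apply/ler_addgt0Pr => e e0; rewrite add0r.
have [c /andP[_ c2] Hc] := angular_continuity t' cg gT e0.
by apply/ltW/Hc; rewrite c1.
Qed.

Lemma open_kelvin_set : open (kelvin_set g).
Proof.
apply: open_enormP => x; have [t0 ->] := polar_exists x; set r0 := enorm x.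
have r00 : 0 <= r0 := enorm_ge0 x.
move=> /(kelvin_setP t0 r00) rg.
have [r0z|r0nz] := eqVneq r0 0.
  exists 2^-1 => // y; rewrite r0z /polar !mul0r => yd.
  have [u yu] := polar_exists y; rewrite yu; apply/(kelvin_setP u (enorm_ge0 y)).
  by move: yd; rewrite (_ : (0, 0) = 0)// subr0; have := g2 u; lra.
have r0p : 0 < r0 by rewrite lt0r r0nz.
pose e := (1 + g t0 - r0) / 2.
have e0 : 0 < e by rewrite /e; lra.
have [c /andP[c0 c1] Hc] := angular_continuity t0 cg gT e0.
exists (Num.min e (r0 * (1 - c))); first by rewrite lt_min e0 mulr_gt0// subr_gt0.
move=> y; rewrite lt_min => /andP[ye yc].
have [u yu] := polar_exists y; set r := enorm y in yu *.
have rr : 0 <= r := enorm_ge0 y.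
rewrite yu; apply/(kelvin_setP u rr).
have rle : r < r0 + e.
  have := ler_enormD (y - polar r0 t0) (polar r0 t0); rewrite subrK enorm_polar// -/r; lra.
suff : `|g u - g t0| < e by rewrite ltr_norml => /andP[h _]; rewrite /e in rle h *; lra.
apply: Hc; rewrite ltNge; apply/negP => hc.
(* the law of cosines *)
have E : enorm (y - polar r0 t0) ^+ 2 = r ^+ 2 + r0 ^+ 2 - 2 * (r * r0 * cos (u - t0)).
  have p0 : r0 ^+ 2 = (polar r0 t0).1 ^+ 2 + (polar r0 t0).2 ^+ 2.
    by rewrite -sqr_enorm enorm_polar.
  rewrite sqr_enorm -(polar_dot r r0 u t0) -yu /r sqr_enorm p0.
  by move: (polar r0 t0) => p; rewrite /dot /=; ring.
have rrc : r * r0 * cos (u - t0) <= r * r0 * c by rewrite ler_wpM2l// mulr_ge0.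
have : enorm (y - polar r0 t0) ^+ 2 < (r0 * (1 - c)) ^+ 2.
  by rewrite ltrXn2r// ?enorm_ge0//.
have : (r - c * r0) ^+ 2 + r0 ^+ 2 * (2 * c * (1 - c)) + (r0 * (1 - c)) ^+ 2 = r ^+ 2 + r0 ^+ 2 - 2 * (r * r0 * c) by ring.
have : 0 <= (r - c * r0) ^+ 2 by exact: sqr_ge0.
have : 0 <= r0 ^+ 2 * (2 * c * (1 - c)) by rewrite mulr_ge0 ?sqr_ge0// mulr_ge0; lra.
move: E rrc; lra.
Qed.

End kelvin_sets.

(** The derivative of [f] along a ray is the radial derivative [x . grad f] divided
by [|x|], and [|x| < 2]. *)
Lemma ray_decrease f (f1 f2 : R * R -> R) (a b k t r s : R) : 0 < a -> b <= 2 -> 0 <= k ->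
  (forall x, has_grad f x (f1 x) (f2 x)) ->
  (forall x, a < enorm x < b -> x.1 * f1 x + x.2 * f2 x <= - k) ->
  a < r -> r <= s -> s < b ->
  f (polar s t) + k / 2 * (s - r) <= f (polar r t).
Proof.
move=> a0 b2 k0 G rad ar; rewrite le_eqVlt => /predU1P[->|rs] sb; first by rewrite subrr mulr0 addr0.
have D (u : R) : is_derive u 1 (fun u => f (u * cos t, u * sin t))
    (f1 (polar u t) * cos t + f2 (polar u t) * sin t).
  exact: (has_grad_curve (G _) (is_derive_mulr _ _) (is_derive_mulr _ _)).
have cF : {within `[r, s], continuous (fun u => f (u * cos t, u * sin t))}.
  by apply: continuous_subspaceT => u; exact: is_derive_continuous1 (D u).
have [u] := MVT rs (fun u _ => D u) cF.
rewrite in_itv/= => /andP[ru us] E.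
have u0 : 0 < u by lra.
have := rad (polar u t); rewrite (enorm_polar _ (ltW u0)) => /(_ ltac:(lra)).
rewrite /polar /= -/(polar u t) in E * => Hr.
have X : u * (f1 (polar u t) * cos t + f2 (polar u t) * sin t) <= - k.
  by apply: le_trans Hr; rewrite /polar; lra.
move: E X; set q := f1 _ * _ + _ => E X.
have q2 : q <= - (k / 2) by nra.
have : q * (s - r) <= - (k / 2) * (s - r) by rewrite ler_wpM2r// subr_ge0 ltW.
lra.
Qed.

Definition box x (d : R) : set (R * R) :=
  (`](x.1 - d)%R, (x.1 + d)%R[ `*` `](x.2 - d)%R, (x.2 + d)%R[)%classic.

Lemma boxE x (d : R) y : box x d y <-> maxnorm (y - x) < d.
Proof.
by rewrite /box /maxnorm gt_max /= !in_itv/= !ltr_distl; split=> [[-> ->]|/andP].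
Qed.

Lemma measurable_box x (d : R) : measurable (box x d : set plane).
Proof. by apply: measurableX; exact: measurable_itv. Qed.

Lemma area_box_gt0 x (d : R) : 0 < d -> (0 < area (box x d))%E.
Proof.
move=> d0; rewrite /box product_measure1E//= !lebesgue_measure_itv/= !lte_fin.
rewrite !ifT; [|lra|lra].
by rewrite -!EFinB -EFinM lte_fin mulr_gt0//; lra.
Qed.

Lemma Rintegral_gt0_open (U : set (R * R)) f x0 : open U -> U x0 -> continuous f ->
  (forall x, U x -> 0 <= f x) -> 0 < f x0 ->
  area.-integrable setT (EFin \o (fun x => \1_U x * f x)) ->
  0 < \int[area]_x (\1_U x * f x).
Proof.
move=> oU Ux0 cf f0 fx0 I.
have oV : open (U `&` [set x | f x0 / 2 < f x]).
  apply: openI => //; have /continuousP := cf; move=> /(_ `](f x0 / 2), +oo[%classic (interval_open _ _)).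
  rewrite (_ : f @^-1` _ = [set x | f x0 / 2 < f x])//=.
  - by apply; rewrite /= .
  - by apply/seteqP; split => y /=; rewrite in_itv/= andbT.
have [d d0 Hd] := enorm_ball_nbhs oV (conj Ux0 (ltac:(by rewrite /=; lra) : f x0 / 2 < f x0)).
pose B := box x0 (d / 2).
have d20 : 0 < d / 2 by rewrite divr_gt0.
have BV y : B y -> U y /\ f x0 / 2 < f y.
  move=> /boxE yd; apply: Hd; rewrite (le_lt_trans (enorm_le_maxnorm _))//; lra.
have mB : measurable (B : set plane) by exact: measurable_box.
have aB : (0 < area B)%E by exact: area_box_gt0.
have lower : ((f x0 / 2)%:E * area B <= \int[area]_x (\1_U x * f x)%:E)%E.
  apply: (@le_trans _ _ (\int[area]_(x in (B : set plane)) (f x0 / 2)%:E)%E).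
    by rewrite integral_cst.
  rewrite [leLHS]integral_mkcond.
  apply: ge0_le_integral => //.
  - by move=> y _; rewrite patchE; case: ifP => // _; rewrite lee_fin; lra.
  - by apply/(measurable_restrictT _ _).1 => //; exact: measurable_cst.
  - by case/integrableP : I.
  - move=> y _; rewrite patchE indicE; case: ifPn => [/set_mem/BV[Uy fy]|_].
      by rewrite mem_set// mul1r lee_fin ltW.
    case: (boolP (y \in U)) => [/set_mem/f0|_]; rewrite lee_fin ?mul1r//.
    by rewrite mul0r.
apply: fine_gt0; apply/andP; split.
  apply: lt_le_trans lower; apply: mule_gt0 => //; rewrite lte_fin; lra.
exact: (integrable_lty measurableT I).
Qed.

Lemma has_grad_enorm x : x != 0 -> has_grad (@enorm R) x (x.1 / enorm x) (x.2 / enorm x).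
Proof.
move=> x0; have e0 : 0 < enorm x by rewrite enorm_gt0.
have h : 0 < enorm x ^+ 2 by rewrite exprn_gt0.
have := has_grad_comp1 (is_derive1_sqrt h) (has_grad_sqr_enorm x).
rewrite (_ : _ \o _ = @enorm R); last first.
  by apply/funext => y; rewrite /= sqrtr_sqr ger0_norm ?enorm_ge0.
rewrite sqrtr_sqr (gtr0_norm e0) => H.
by apply: (has_grad_eq H); field; rewrite gt_eqF.
Qed.

End polar_coordinates.

(** * Functions of a level variable *)

Section level_sets.
Context {R : realType}.
Local Notation plane := (measurableTypeR R * measurableTypeR R)%type.
Implicit Types (x y z : R * R) (f : R * R -> R).

Lemma continuous_near f (h : R * R -> R) x (d : R) : 0 < d ->
  (forall y, enorm (y - x) < d -> f y = h y) ->
  {for x, continuous f} -> {for x, continuous h}.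
Proof.
move=> d0 E cf; apply: continuous_enormP => e e0.
have /cvgrPdist_le/(_ _ e0)/nbhs_ballP[d' /= d'0 Hd] := cf.
exists (Num.min d d'); first by rewrite lt_min d0.
move=> y; rewrite lt_min => /andP[yd yd'].
rewrite -!E ?subrr ?enorm0// distrC; apply: Hd; rewrite -ball_normE /= normE_maxnorm.
by rewrite (le_lt_trans (maxnorm_le_enorm _))// enormBC.
Qed.

Variables (Psi f1 f2 : R * R -> R) (a k kappa c : R).
Hypothesis GPsi : forall x, has_grad Psi x (f1 x) (f2 x).
Hypotheses (cf1 : continuous f1) (cf2 : continuous f2).
Hypotheses (a0 : 0 < a) (a1 : a <= 2^-1) (k0 : 0 < k) (kappa0 : 0 < kappa).
Hypothesis rad : forall x, 1 - a < enorm x < 1 + a -> x.1 * f1 x + x.2 * f2 x <= - k.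
Hypothesis high : forall x, 1 - a < enorm x <= 1 - a / 2 -> 3 * kappa <= Psi x - c.
Hypothesis low : forall x, 1 + a / 2 <= enorm x < 1 + a -> Psi x - c <= - (3 * kappa).

(** The rescaled value of [Psi - c] near the unit circle, frozen at the values 3 and
-3 further inside and outside, where the spline is flat. Functions of it are
thereby defined and of class C1 on the whole plane, although nothing is known
about [Psi] far from the circle. *)
Definition level x : R :=
  if enorm x <= 1 - a / 2 then 3 else if 1 + a / 2 <= enorm x then - 3
  else (Psi x - c) / kappa.

Lemma level_in x : enorm x <= 1 - a / 2 -> level x = 3.
Proof. by rewrite /level => ->. Qed.

Lemma level_out x : 1 + a / 2 <= enorm x -> level x = - 3.
Proof.
move=> h; rewrite /level h; case: leP => // h'; exfalso.
have := a0; lra.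
Qed.

Lemma level_mid x : 1 - a / 2 < enorm x < 1 + a / 2 -> level x = (Psi x - c) / kappa.
Proof. by move=> /andP[h1 h2]; rewrite /level leNgt h1 /= leNgt h2. Qed.

Lemma level_inside x : `|level x| < 3 -> 1 - a / 2 < enorm x < 1 + a / 2.
Proof.
have [h|h] := leP (enorm x) (1 - a / 2); first by rewrite level_in// gtr0_norm ?ltxx.
have [h'|//] := leP (1 + a / 2) (enorm x).
by rewrite level_out// normrN gtr0_norm ?ltxx.
Qed.

Lemma level_annulus (eta : R -> R) x : (forall t, 3 <= t -> eta t = eta 3) ->
  (forall t, t <= -3 -> eta t = eta (-3)) ->
  1 - a < enorm x < 1 + a -> eta (level x) = eta ((Psi x - c) / kappa).
Proof.
move=> e1 e2 /andP[h1 h2].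
have [h|h] := leP (enorm x) (1 - a / 2).
  rewrite level_in// [RHS]e1// ler_pdivlMr//; apply: high; lra.
have [h'|h'] := leP (1 + a / 2) (enorm x).
  rewrite level_out// [RHS]e2// ler_pdivrMr// mulNr; apply: low; lra.
by rewrite level_mid// h.
Qed.

(** The hypotheses [high] and [low] make the frozen and the genuine values
indistinguishable for [eta] on two overlapping annuli, so that near every point
the function is either constant or a smooth function of [Psi]. *)
Lemma level_C1 (eta eta' : R -> R) :
  (forall t : R, is_derive t 1 eta (eta' t)) -> continuous eta' ->
  (forall t, 3 <= `|t| -> eta' t = 0) ->
  (forall t, 3 <= t -> eta t = eta 3) -> (forall t, t <= -3 -> eta t = 0) ->
  C1_compact (eta \o level) (fun x => eta' (level x) * (f1 x / kappa))
                            (fun x => eta' (level x) * (f2 x / kappa)).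
Proof.
move=> De ce' f' e3 em3.
have e'3 (t : R) : 3 <= t -> eta' t = eta' 3.
  by move=> h; rewrite !f'// ?(gtr0_norm (ltr0n R 3))// ler_normr h.
have e'm3 (t : R) : t <= -3 -> eta' t = eta' (-3).
  by move=> h; rewrite !f'// ?normrN ?(gtr0_norm (ltr0n R 3))// ler_normr; apply/orP; right; lra.
have em3' (t : R) : t <= -3 -> eta t = eta (-3) by move=> h; rewrite !em3.
have loc x : exists2 d : R, 0 < d &
   (forall y, enorm (y - x) < d -> eta' (level y) = 0 /\ eta (level y) = eta (level x)) \/
   (forall y, enorm (y - x) < d -> 1 - a < enorm y < 1 + a).
  have N y d : enorm (y - x) < d -> enorm x - d < enorm y < enorm x + d.
    move=> yd; have := ler_enormD (y - x) x; have := ler_enormB y (y - x).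
    by rewrite subrK opprB addrC subrK => h1 h2; apply/andP; lra.
  have [h|h] := ltP (enorm x) (1 - a / 2).
    exists (1 - a / 2 - enorm x); [lra|left => y /N/andP[y1 y2]].
    by rewrite !level_in ?f' ?gtr0_norm//; lra.
  have [h'|h'] := ltP (1 + a / 2) (enorm x).
    exists (enorm x - (1 + a / 2)); [lra|left => y /N/andP[y1 y2]].
    by rewrite !level_out ?f' ?normrN ?gtr0_norm//; lra.
  exists (a / 2); first by rewrite divr_gt0.
  right => y /N/andP[y1 y2]; apply/andP; lra.
pose Z x := (Psi x - c) / kappa.
have GZ x : has_grad Z x (f1 x / kappa) (f2 x / kappa).
  have := has_gradM (has_grad_cst kappa^-1 x) (has_gradD (GPsi x) (has_grad_cst (- c) x)).
  rewrite (_ : (fun y => kappa^-1 * _) = Z); last by apply/funext => y; rewrite /Z mulrC.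
  by move=> H; apply: (has_grad_eq H); ring.
have G x : has_grad (eta \o level) x (eta' (level x) * (f1 x / kappa)) (eta' (level x) * (f2 x / kappa)).
  have [d d0 [H|H]] := loc x.
    have [-> _] := H x ltac:(by rewrite subrr enorm0).
    rewrite !mul0r; apply: (has_grad_near d0 _ (has_grad_cst (eta (level x)) x)).
    by move=> y /H[_ /= ->].
  have Hx := H x ltac:(by rewrite subrr enorm0).
  rewrite (level_annulus e'3 e'm3 Hx).
  apply: (has_grad_near d0 _ (has_grad_comp1 (De (Z x)) (GZ x))).
  by move=> y /H h /=; rewrite (level_annulus e3 em3' h).
have CC (F : R * R -> R) : continuous F -> continuous (fun x => eta' (level x) * (F x / kappa)).
  move=> cF x; have [d d0 [H|H]] := loc x.
    apply: (continuous_near (f := cst 0) d0); last exact: cst_continuous.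
    by move=> y /H[-> _]; rewrite mul0r.
  apply: (continuous_near (f := fun x => eta' (Z x) * (F x / kappa)) d0).
    by move=> y /H h; rewrite (level_annulus e'3 e'm3 h).
  apply: cvgM; last by apply: cvgM; [exact: cF|exact: cvg_cst].
  by apply: (continuous_comp (has_grad_continuous (GZ x))); exact: ce'.
split; [exact: G|exact: CC|exact: CC|].
exists 2 => x x2 /=; have l : 1 + a / 2 <= enorm x by have := a1; lra.
rewrite !level_out//.
by rewrite em3// f' ?normrN ?gtr0_norm// !mul0r.
Qed.

Lemma spline_level_C1 : C1_compact (spline \o level)
  (fun x => spline' (level x) * (f1 x / kappa)) (fun x => spline' (level x) * (f2 x / kappa)).
Proof.
apply: level_C1; [exact: is_derive_spline|exact: continuous_spline'|..].
- by move=> t /spline_flat[].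
- by move=> t t3; have [_ _ _ _ /(_ t3)[-> _ _]] := spline_pieces t;
    have [_ _ _ _ /(_ (lexx _))[-> _ _]] := spline_pieces (3 : R).
- by move=> t t3; have [/(_ t3)[-> _ _]] := spline_pieces t.
Qed.

Lemma spline'_level_C1 : C1_compact (spline' \o level)
  (fun x => spline'' (level x) * (f1 x / kappa)) (fun x => spline'' (level x) * (f2 x / kappa)).
Proof.
apply: level_C1; [exact: is_derive_spline'|exact: continuous_spline''|..].
- by move=> t /spline_flat[].
- by move=> t t3; rewrite !(spline_flat _).1// ler_normr ?t3// lexx.
- by move=> t t3; rewrite (spline_flat _).1// ler_normr; apply/orP; right; lra.
Qed.

Lemma measurable_level : measurable_fun [set: plane] level.
Proof.
apply: measurable_fun_ifT => //.
  apply: (measurable_fun_ler (f := @enorm R)) => //; exact: measurable_enorm.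
apply: measurable_fun_ifT => //.
  by apply: measurable_fun_ler => //; exact: measurable_enorm.
apply: measurable_funM => //; apply: measurable_funB => //.
by apply: continuous_measurable2 => x; exact: has_grad_continuous.
Qed.

(** The spline of [level / s] decreases radially, at a rate of order
[k / (s * kappa)] on the band. *)
Lemma level_band_area (s : R) : 0 < s <= 1 ->
  L1norm (\1_[set x | `|level x| <= s]) <= band_constant / 4 * kappa / k * s.
Proof.
move=> /andP[s0 s1]; have a0' := a0; have a1' := a1.
have sv3 (t : R) : 3 <= `|t| -> 3 <= `|t * s^-1|.
  move=> t3; rewrite normrM (gtr0_norm (_ : 0 < s^-1)) ?invr_gt0// ler_pdivlMr//; nra.
have De (t : R) : is_derive t 1 (fun t : R => spline (t * s^-1)) (spline' (t * s^-1) * s^-1).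
  exact: (@is_derive1_comp R spline (fun t => t * s^-1) t _ _ (is_derive_spline (t * s^-1)) (is_derive_mulr _ _)).
have cs : continuous (fun t : R => spline' (t * s^-1)).
  move=> t; apply: (@continuous_comp R R R (fun t => t * s^-1) spline'); last exact: continuous_spline'.
  by apply: cvgM; [exact: cvg_id|exact: cvg_cst].
have C : C1_compact ((fun t : R => spline (t * s^-1)) \o level)
   (fun x => spline' (level x * s^-1) * s^-1 * (f1 x / kappa))
   (fun x => spline' (level x * s^-1) * s^-1 * (f2 x / kappa)).
  apply: (@level_C1 (fun t : R => spline (t * s^-1)) (fun t : R => spline' (t * s^-1) * s^-1) De).
  - move=> t; apply: cvgM; last exact: cvg_cst.
    exact: cs.
  - by move=> t /sv3/spline_flat[-> _]; rewrite mul0r.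
  - move=> t t3; have h (u : R) : 3 <= u -> 3 <= u * s^-1 by rewrite ler_pdivlMr//; nra.
    have [_ _ _ _ /(_ (h _ t3))[-> _ _]] := spline_pieces (t * s^-1).
    by have [_ _ _ _ /(_ (h _ (lexx _)))[-> _ _]] := spline_pieces ((3 : R) * s^-1).
  - move=> t t3; have h : t * s^-1 <= - 3 by rewrite ler_pdivrMr//; nra.
    by have [/(_ h)[-> _ _]] := spline_pieces (t * s^-1).
have q0 x : 0 <= spline' (level x * s^-1) <= 6 by have [] := spline_bounds (level x * s^-1).
have out x : 3 <= `|level x| -> spline' (level x * s^-1) = 0 by move=> /sv3/spline_flat[].
have R1 x : x.1 * (spline' (level x * s^-1) * s^-1 * (f1 x / kappa)) +
   x.2 * (spline' (level x * s^-1) * s^-1 * (f2 x / kappa)) =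
   spline' (level x * s^-1) * (s^-1 / kappa) * (x.1 * f1 x + x.2 * f2 x) by ring.
have sk : 0 < s^-1 / kappa by rewrite divr_gt0// invr_gt0.
have -> : band_constant / 4 * kappa / k * s = band_constant / (4 * (s^-1 / kappa) * k).
  by field; rewrite !gt_eqF.
apply: (radial_band_area C).
- by move=> x /=; have [] := spline_bounds (level x * s^-1).
- move=> x x2 /=; have l3 : level x = -3 by rewrite level_out//; lra.
  have [h1 _ _ _ _] := spline_pieces (level x * s^-1).
  have h3 : level x * s^-1 <= -3 by rewrite l3 ler_pdivrMr//; nra.
  by have [-> -> _] := h1 h3; rewrite !mul0r.
- by rewrite mulr_gt0// mulr_gt0.
- exact: measurable_normr_le measurable_level.
- move=> x; rewrite R1; have [h|h] := leP 3 `|level x|; first by rewrite out// !mul0r.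
  have /andP[h1 h2] := level_inside h; have /andP[q1 q2] := q0 x.
  apply: mulr_ge0_le0; first by rewrite mulr_ge0// ltW.
  have : x.1 * f1 x + x.2 * f2 x <= - k by apply: rad; lra.
  by have := k0; lra.
- move=> x /= ls; rewrite R1.
  have h : `|level x| < 3 by lra.
  have /andP[h1 h2] := level_inside h.
  have r : x.1 * f1 x + x.2 * f2 x <= - k by apply: rad; lra.
  have q4 : 4 <= spline' (level x * s^-1).
    by apply: spline'_ge4; rewrite -ler_norml normrM (gtr0_norm (_ : 0 < s^-1)) ?invr_gt0// ler_pdivrMr// mul1r.
  have : 4 * (s^-1 / kappa) <= spline' (level x * s^-1) * (s^-1 / kappa) by rewrite ler_wpM2r// ltW.
  have : 0 < 4 * (s^-1 / kappa) by rewrite mulr_gt0.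
  move: (4 * (s^-1 / kappa)) (spline' _ * _) r (k0) => u v; nra.
Qed.

End level_sets.

(** * Steady flows have constant stream function on the boundary of a patch *)

Section stationary_boundary.
Context {R : realType}.
Local Notation plane := (measurableTypeR R * measurableTypeR R)%type.
Implicit Types (x y z : R * R) (f h : R * R -> R).

Lemma C1_compactM_punctured f f1 f2 h h1 h2 (rho : R) : 0 < rho -> C1_compact f f1 f2 ->
  (forall x, enorm x < rho -> [/\ f x = 0, f1 x = 0 & f2 x = 0]) ->
  (forall x, x != 0 -> has_grad h x (h1 x) (h2 x)) ->
  (forall x, x != 0 -> {for x, continuous h1} /\ {for x, continuous h2}) ->
  C1_compact (fun x => f x * h x) (fun x => f x * h1 x + h x * f1 x)
    (fun x => f x * h2 x + h x * f2 x).
Proof.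
move=> rho0 C f0 Gh ch.
have cM (k k' : R * R -> R) : continuous k' -> (forall x, enorm x < rho -> k' x = 0) ->
    (forall x, x != 0 -> {for x, continuous k}) ->
    continuous (fun x => f x * k x + h x * k' x).
  move=> ck' k'0 ck x; have [->|x0] := eqVneq x 0.
    apply: (continuous_near (f := cst 0) rho0); last exact: cst_continuous.
    by move=> y; rewrite subr0 => yr; have [-> _ _] := f0 y yr; rewrite k'0// mulr0 mul0r addr0.
  apply: cvgD; apply: cvgM.
  + exact: (has_grad_continuous (C1_grad C x)).
  + exact: ck.
  + exact: (has_grad_continuous (Gh x x0)).
  + exact: ck'.
split.
- move=> x; have [->|x0] := eqVneq x 0; last exact: has_gradM (C1_grad C x) (Gh x x0).
  have [|-> -> ->] := f0 0; first by rewrite enorm0.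
  rewrite !mul0r !mulr0 !addr0; apply: (has_grad_near rho0 _ (has_grad_cst 0 0)).
  by move=> y; rewrite subr0 => /f0[-> _ _]; rewrite mul0r.
- apply: cM; [exact: C1_continuous1 C|by move=> x /f0[]|by move=> x /ch[]].
- apply: cM; [exact: C1_continuous2 C|by move=> x /f0[]|by move=> x /ch[]].
- have [r Hr] := C1_support C; exists r => x /Hr[-> -> ->].
  by rewrite !mul0r !mulr0 addr0.
Qed.

(** With [p1], [p2] the gradient of a stream function, the integrand is the
derivative of the test function along the flow: the flow preserves the patch. *)
Definition stationary (K : set (R * R)) (p1 p2 : R * R -> R) : Prop :=
  forall chi g1 g2, C1_compact chi g1 g2 ->
    \int[area]_x (\1_K x * (p2 x * g1 x - p1 x * g2 x)) = 0.

(** For [lam = 1] this is minus the cotangent of half the angle between [x] and the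
direction [t]: it increases with the polar angle of [x] and is infinite in the
direction [t]. For [lam > 1] it is of class C1 away from the origin, and it
still increases with the polar angle outside of the sector where the cosine of
the angle to the direction [t] exceeds [1 / lam]. *)
Definition slope (lam t : R) x : R :=
  (x.1 * sin t - x.2 * cos t) / (lam * enorm x - (x.1 * cos t + x.2 * sin t)).

(** The gradient is orthogonal to [x], since the function is homogeneous of degree
zero, and the sign of its angular component is that of the numerator of [N]. *)
Lemma slope_grad (lam t : R) x : 1 < lam -> x != 0 ->
  let N := (enorm x - lam * (x.1 * cos t + x.2 * sin t)) /
    (enorm x * (lam * enorm x - (x.1 * cos t + x.2 * sin t)) ^+ 2) in
  [/\ has_grad (slope lam t) x (- x.2 * N) (x.1 * N),
      0 < lam * enorm x - (x.1 * cos t + x.2 * sin t) & 0 < enorm x].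
Proof.
move=> l1 x0 N; have r0 : 0 < enorm x by rewrite enorm_gt0.
have dl : `|x.1 * cos t + x.2 * sin t| <= enorm x.
  have := normr_dot_le x (polar 1 t); rewrite enorm_polar// mulr1 /dot /polar /=.
  by rewrite !mul1r.
have D0 : 0 < lam * enorm x - (x.1 * cos t + x.2 * sin t).
  have := ler_norm (x.1 * cos t + x.2 * sin t); nra.
split => //.
have Gq : has_grad (fun y : R * R => y.1 * sin t - y.2 * cos t) x (sin t) (- cos t).
  have := has_grad_linear (sin t) (- cos t) x.
  by congr has_grad; apply/funext => y; rewrite mulrN.
have Gp : has_grad (fun y : R * R => lam * enorm y - (y.1 * cos t + y.2 * sin t)) x
    (lam * (x.1 / enorm x) - cos t) (lam * (x.2 / enorm x) - sin t).
  have := has_gradD (has_gradM (has_grad_cst lam x) (has_grad_enorm x0))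
    (has_grad_linear (- cos t) (- sin t) x).
  rewrite !mulr0 !addr0; congr has_grad.
  by apply/funext => y; ring.
have dV (u : R) : u != 0 -> is_derive u 1 (fun v : R => v^-1) (- (u ^- 2)).
  move=> u0; have := @is_deriveV R id u 1 1 u0 (is_derive_id u 1).
  by rewrite /GRing.scale/= mulr1.
have Gi := has_grad_comp1 (dV _ (lt0r_neq0 D0)) Gp.
have := has_gradM Gq Gi.
have P1 : forall C S r : R, r ^+ 2 = x.1 ^+ 2 + x.2 ^+ 2 -> C ^+ 2 + S ^+ 2 = 1 ->
   - (x.1 * S - x.2 * C) * (lam * x.1 - r * C) + r * (lam * r - (x.1 * C + x.2 * S)) * S =
   - x.2 * (r - lam * (x.1 * C + x.2 * S)).
  move=> C S r E cs.
  transitivity (- lam * (x.1 * S - x.2 * C) * x.1 + lam * r ^+ 2 * S - r * x.2 * (C ^+ 2 + S ^+ 2)); first by ring.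
  by rewrite E cs; ring.
have P2 : forall C S r : R, r ^+ 2 = x.1 ^+ 2 + x.2 ^+ 2 -> C ^+ 2 + S ^+ 2 = 1 ->
   - (x.1 * S - x.2 * C) * (lam * x.2 - r * S) - r * (lam * r - (x.1 * C + x.2 * S)) * C =
   x.1 * (r - lam * (x.1 * C + x.2 * S)).
  move=> C S r E cs.
  transitivity (- lam * (x.1 * S - x.2 * C) * x.2 - lam * r ^+ 2 * C + r * x.1 * (C ^+ 2 + S ^+ 2)); first by ring.
  by rewrite E cs; ring.
have {}P1 := P1 _ _ _ (sqr_enorm x) (cos2Dsin2 t).
have {}P2 := P2 _ _ _ (sqr_enorm x) (cos2Dsin2 t).
move=> H; apply: (has_grad_eq H); move: P1 P2 D0; rewrite /N /=;
  set D := lam * enorm x - _; set n := enorm x - lam * _ => P1 P2 D0.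
- rewrite (mulrA (- x.2)) -P1; field.
  by rewrite (gt_eqF r0) (gt_eqF D0).
- rewrite (mulrA x.1 n) -P2; field.
  by rewrite (gt_eqF r0) (gt_eqF D0).
Qed.

Variable g : R -> R.
Hypotheses (cg : continuous g) (gT : forall t, g (t + 2 * pi) = g t).
Variables (Psi f1 f2 : R * R -> R) (a k kappa : R).
Hypothesis GPsi : forall x, has_grad Psi x (f1 x) (f2 x).
Hypotheses (cf1 : continuous f1) (cf2 : continuous f2).
Hypotheses (a0 : 0 < a) (a1 : a <= 2^-1) (k0 : 0 < k) (kappa0 : 0 < kappa).
Hypothesis ga : forall t, `|g t| <= a / 4.
Hypothesis rad : forall x, 1 - a < enorm x < 1 + a -> x.1 * f1 x + x.2 * f2 x <= - k.
Let b t := Psi (polar (1 + g t) t).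
Hypothesis high : forall x t, 1 - a < enorm x <= 1 - a / 2 -> 3 * kappa <= Psi x - b t.
Hypothesis low : forall x t, 1 + a / 2 <= enorm x < 1 + a -> Psi x - b t <= - (3 * kappa).
Hypothesis sta : stationary (kelvin_set g) f1 f2.

Lemma continuous_boundary_value : continuous b.
Proof.
move=> t; apply: (@continuous_comp _ _ _ (fun t => polar (1 + g t) t) Psi); last first.
  exact: has_grad_continuous (GPsi _).
have c1 : {for t, continuous (fun t => 1 + g t)}.
  by apply: cvgD; [exact: cvg_cst|exact: cg].
apply: (@cvg_pair _ _ _ (nbhs t) (nbhs _) (nbhs _)); apply: cvgM => //.
  exact: continuous_cos.
exact: continuous_sin.
Qed.

Lemma kelvin_point x : 1 - a < enorm x < 1 + a -> exists t, [/\ x = polar (enorm x) t,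
  kelvin_set g x -> b t <= Psi x & ~ kelvin_set g x -> Psi x <= b t].
Proof.
have a0' := a0; have a1' := a1; have k0' := k0.
move=> /andP[h1 h2]; have [t xt] := polar_exists x; exists t.
have g2 u : - 2^-1 < g u by have := ga u; rewrite ler_norml => /andP[? _]; lra.
have /andP[gt1 gt2] : - (a / 4) <= g t <= a / 4 by rewrite -ler_norml.
have RD := @ray_decrease R Psi f1 f2 (1 - a) (1 + a) k t.
split=> // Kx.
- have : enorm x < 1 + g t by apply/(kelvin_setP cg gT g2 t (enorm_ge0 x)); rewrite -xt.
  move=> lt; rewrite [in leRHS]xt /b.
  have := RD (enorm x) (1 + g t) ltac:(lra) ltac:(lra) (ltW k0') GPsi rad h1 (ltW lt) ltac:(lra).
  have : 0 <= k / 2 * (1 + g t - enorm x) by rewrite mulr_ge0; lra.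
  lra.
- have le : 1 + g t <= enorm x.
    by rewrite leNgt; apply/negP => lt; apply: Kx; rewrite xt; apply/(kelvin_setP cg gT g2 t (enorm_ge0 x)).
  rewrite [in leLHS]xt /b.
  have := RD (1 + g t) (enorm x) ltac:(lra) ltac:(lra) (ltW k0') GPsi rad ltac:(lra) le h2.
  have : 0 <= k / 2 * (enorm x - (1 + g t)) by rewrite mulr_ge0; lra.
  lra.
Qed.

(** Suppose that the boundary values at the angles [u1] and [u2] differ, and choose a
level [c] of [Psi] in between that is attained inside the patch at the angle
[u1]. Since [Psi] decreases radially, it exceeds the boundary value on the patch;
the points of the patch in a thin band around the level [c] therefore avoid a
sector around [u2]. The test function is a bump in [Psi] around this level times
an angular coordinate that increases outside of the sector. The flow is
tangent to the level lines of [Psi] and turns in one direction, because of the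
radial decrease, so the integral in the definition of stationarity is
positive. *)
Lemma boundary_value_constant t1 t2 : b t1 = b t2.
Proof.
have a0' := a0; have a1' := a1; have k0' := k0; have kappa0' := kappa0.
have lam_bounds (q : R) : 0 < q -> q < 1 -> 1 < 2 / (1 + q) /\ 2 / (1 + q) * q < 1.
  by move=> q0 q1; split; [rewrite ltr_pdivlMr|rewrite mulrAC ltr_pdivrMr]; lra.
have far (r : R) : 2 <= r -> 1 + a / 2 <= r by lra.
have widen (r : R) : 1 - a / 2 < r -> r < 1 + a / 2 -> 1 - a < r < 1 + a by lra.
have away (r : R) : 1 - a / 2 < r -> 0 < r by lra.
have separated (bt b2 v c q : R) : bt <= v -> - ((b2 - c) / 2) < bt - b2 ->
  v - c < 3 * q -> q <= (b2 - c) / 6 -> False by lra.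
have annular (r g1 : R) : r < 1 + g1 -> g1 <= a / 4 -> r < 1 + a / 2 by lra.
suff H u1 u2 : b u1 < b u2 -> False.
  by have [/H//|/H//|] := ltgtP (b t1) (b t2).
move=> {t1 t2} b12.
have g2 u : - 2^-1 < g u by have := ga u; rewrite ler_norml => /andP[? _]; lra.
have /andP[gt1 gt2] : - (a / 4) <= g u1 <= a / 4 by rewrite -ler_norml.
(* a point of the patch at which Psi lies between the two boundary values *)
have [r0 [r01 r02 P1 P2]] : exists r0, [/\ 1 - a / 2 < r0, r0 < 1 + g u1,
    b u1 < Psi (polar r0 u1) & Psi (polar r0 u1) < b u2].
  have cr : {for (1 + g u1), continuous (fun r => Psi (polar r u1))}.
    apply: (@continuous_comp _ _ _ (fun r => polar r u1) Psi); last exact: has_grad_continuous (GPsi _).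
    by apply: (@cvg_pair _ _ _ (nbhs _) (nbhs _) (nbhs _)); apply: cvgM; by [exact: cvg_id|exact: cvg_cst].
  have b120 : 0 < b u2 - b u1 by rewrite subr_gt0.
  have /cvgrPdist_lt/(_ _ b120)/nbhs_ballP[d /= d0 Hd] := cr.
  exists (1 + g u1 - Num.min (d / 2) (a / 8)).
  have m0 : 0 < Num.min (d / 2) (a / 8) by rewrite lt_min !divr_gt0.
  have m1 : Num.min (d / 2) (a / 8) <= d / 2 by rewrite ge_min lexx.
  have m2 : Num.min (d / 2) (a / 8) <= a / 8 by rewrite ge_min lexx orbT.
  move: (Num.min _ _) m0 m1 m2 => m m0 m1 m2.
  split; [lra|lra| |].
    have := @ray_decrease R Psi f1 f2 (1 - a) (1 + a) k u1 (1 + g u1 - m) (1 + g u1) ltac:(lra) ltac:(lra) (ltW k0') GPsi rad ltac:(lra) ltac:(lra) ltac:(lra).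
    have : 0 < k / 2 * (1 + g u1 - (1 + g u1 - m)) by rewrite mulr_gt0; lra.
    by rewrite -/(b u1); lra.
  have := Hd (1 + g u1 - m); rewrite /ball/= opprB addrC subrK gtr0_norm// => /(_ ltac:(lra)).
  by rewrite -/(b u1) ltr_norml => /andP[]; lra.
pose y0 := polar r0 u1; pose c := Psi y0.
have r00 : 0 < r0 by lra.
have ey0 : enorm y0 = r0 by rewrite enorm_polar// ltW.
pose ka := Num.min kappa ((b u2 - c) / 6).
have ka0 : 0 < ka by rewrite lt_min kappa0' divr_gt0// subr_gt0.
have ka1 : ka <= kappa by rewrite ge_min lexx.
have ka2 : ka <= (b u2 - c) / 6 by rewrite ge_min lexx orbT.
have hi x : 1 - a < enorm x <= 1 - a / 2 -> 3 * ka <= Psi x - c.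
  by move=> h; have := high u2 h; rewrite /c /y0; lra.
have lo x : 1 + a / 2 <= enorm x < 1 + a -> Psi x - c <= - (3 * ka).
  by move=> h; have := low u1 h; rewrite /c /y0; lra.
pose l := level Psi a ka c.
have C := spline'_level_C1 GPsi cf1 cf2 a0 a1 ka0 hi lo.
have e0 : 0 < (b u2 - c) / 2 by rewrite divr_gt0// subr_gt0.
have bT t : b (t + 2 * pi) = b t.
  have c2 : cos (t + 2 * pi) = cos t by rewrite mulr_natl cosD2pi.
  have s2 : sin (t + 2 * pi) = sin t by rewrite mulr_natl sinD2pi.
  by rewrite /b gT /polar c2 s2.
have [cc /andP[c0 c1] Hc] := angular_continuity u2 continuous_boundary_value bT e0.
pose lam := 2 / (1 + cc).
have l1 : 1 < lam := (lam_bounds _ c0 c1).1.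
have lcc : lam * cc < 1 := (lam_bounds _ c0 c1).2.
pose xi := slope lam u2.
pose N x := (enorm x - lam * (x.1 * cos u2 + x.2 * sin u2)) /
    (enorm x * (lam * enorm x - (x.1 * cos u2 + x.2 * sin u2)) ^+ 2).
have lin x (s c' : R) : {for x, continuous (fun x : R * R => x.1 * c' + x.2 * s)}.
  by apply: cvgD; (apply: cvgM; [|exact: cvg_cst]); [exact: cvg_fst|exact: cvg_snd].
have cen x : x != 0 -> {for x, continuous (@enorm R)}.
  by move=> /has_grad_enorm; exact: has_grad_continuous.
have cN x : x != 0 -> {for x, continuous N}.
  move=> x0; have [_ D0 r0'] := slope_grad u2 l1 x0.
  have cD : {for x, continuous (fun x => lam * enorm x - (x.1 * cos u2 + x.2 * sin u2))}.
    by apply: cvgB; [apply: cvgM; [exact: cvg_cst|exact: cen]|exact: lin].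
  apply: cvgM.
    apply: cvgB; first exact: cen.
    by apply: cvgM; [exact: cvg_cst|exact: lin].
  apply: cvgV; first by rewrite mulf_neq0 ?expf_neq0// gt_eqF.
  by apply: cvgM; [exact: cen|apply: cvgM; exact: cD].
have flat x : enorm x <= 1 - a / 2 -> spline' (l x) = 0 /\ spline'' (l x) = 0.
  by move=> h; apply: spline_flat; rewrite /l level_in// gtr0_norm.
have CX : C1_compact (fun x => (spline' \o l) x * xi x)
    (fun x => (spline' \o l) x * (- x.2 * N x) + xi x * (spline'' (l x) * (f1 x / ka)))
    (fun x => (spline' \o l) x * (x.1 * N x) + xi x * (spline'' (l x) * (f2 x / ka))).
  apply: (C1_compactM_punctured (rho := 1 - a / 2) _ C); first lra.
  - by move=> x hx; have [/= s1 s2] := flat x (ltW hx); rewrite s1 -/l s2 !mul0r.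
  - by move=> x x0; have [] := slope_grad u2 l1 x0.
  - move=> x x0; split; (apply: cvgM; [|exact: cN]); last exact: cvg_fst.
    by apply: cvgN; exact: cvg_snd.
have := sta CX.
pose G x := spline' (l x) * (N x * (- (x.1 * f1 x + x.2 * f2 x))).
have GE x : f2 x * ((spline' \o l) x * (- x.2 * N x) + xi x * (spline'' (l x) * (f1 x / ka))) -
  f1 x * ((spline' \o l) x * (x.1 * N x) + xi x * (spline'' (l x) * (f2 x / ka))) = G x.
  by rewrite /G /=; ring.
under eq_Rintegral do rewrite GE.
have cG : continuous G.
  rewrite (_ : G = (fun x => f2 x * ((spline' \o l) x * (- x.2 * N x) + xi x * (spline'' (l x) * (f1 x / ka))) -
    f1 x * ((spline' \o l) x * (x.1 * N x) + xi x * (spline'' (l x) * (f2 x / ka))))); last first.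
    by apply/funext => x; rewrite -GE.
  move=> x; apply: cvgB; apply: cvgM.
  + exact: cf2.
  + exact: (C1_continuous1 CX).
  + exact: cf1.
  + exact: (C1_continuous2 CX).
have supp x : 2 <= enorm x -> G x = 0.
  move=> x2; have l3 : l x = - 3 by apply: level_out => //; exact: far.
  by rewrite /G l3 (spline_flat _).1 ?mul0r// normrN gtr0_norm.
have [M HM] := continuous_bounded_support cG supp.
have oK := open_kelvin_set cg gT g2.
have Gpos x : kelvin_set g x -> `|l x| < 3 -> 0 < N x * (- (x.1 * f1 x + x.2 * f2 x)).
  move=> Kx lx; have /andP[h1 h2] := level_inside a0 lx.
  have xa := widen _ h1 h2.
  have [t [xt bt _]] := kelvin_point xa.
  have x0 : x != 0 by rewrite -enorm_gt0; exact: away _ h1.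
  have [_ D0 r0'] := slope_grad u2 l1 x0.
  have lt : Psi x - c < 3 * ka.
    move: lx; rewrite /l level_mid ?h1// normrM (gtr0_norm (_ : 0 < ka^-1)) ?invr_gt0// ltr_pdivrMr//.
    by move=> h; apply: le_lt_trans h; exact: ler_norm.
  have ct : cos (t - u2) <= cc.
    rewrite leNgt; apply/negP => /Hc; rewrite ltr_norml => /andP[h3 _].
    exact: separated _ _ _ _ _ (bt Kx) h3 lt ka2.
  rewrite mulr_gt0//; last first.
    by rewrite oppr_gt0 (le_lt_trans (rad xa))// oppr_lt0.
  rewrite /N divr_gt0//; last by rewrite mulr_gt0// exprn_gt0.
  have -> : x.1 * cos u2 + x.2 * sin u2 = enorm x * cos (t - u2).
    have := polar_dot (enorm x) 1 t u2; rewrite -xt mulr1 => <-.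
    by rewrite /dot /polar /= !mul1r.
  rewrite subr_gt0 mulrCA gtr_pMr//.
  by rewrite (le_lt_trans _ lcc)// ler_wpM2l// ltW// (lt_trans ltr01 l1).
have G0 x : kelvin_set g x -> 0 <= G x.
  move=> Kx; rewrite /G; have [h|h] := leP 3 `|l x|; first by rewrite (spline_flat h).1 mul0r.
  rewrite mulr_ge0//; last exact: ltW (Gpos x Kx h).
  by have [_ /andP[]] := spline_bounds (l x).
have Ky0 : kelvin_set g y0 by apply/(kelvin_setP cg gT g2 _ (ltW r00)).
have ly0 : l y0 = 0.
  by rewrite /l level_mid ?subrr ?mul0r// ey0 r01 (annular _ _ r02 gt2).
have Gy0 : 0 < G y0.
  rewrite /G mulr_gt0//; last by apply: Gpos => //; rewrite ly0 normr0.
  by rewrite ly0 (lt_le_trans _ (spline'_ge4 _))// lerN10 ler01.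
have mK := open_measurable2 oK.
have I : area.-integrable setT (EFin \o (fun x => \1_(kelvin_set g) x * G x)).
  apply: (integrable_bounded_support (M := M) (r := 2)).
  - apply: measurable_funM; last exact: continuous_measurable2.
    exact: measurable_indic.
  - move=> x; rewrite indicE normrM; case: (x \in _); rewrite ?normr1 ?normr0 ?mul1r ?mul0r//.
    exact: le_trans (HM x).
  - by move=> x /supp ->; rewrite mulr0.
have := Rintegral_gt0_open oK Ky0 cG G0 Gy0 I.
by move=> /[swap] ->; rewrite ltxx.
Qed.

End stationary_boundary.

(** * Patches close to the unit disk *)

Section perturbed_disks.
Context {R : realType}.
Local Notation plane := (measurableTypeR R * measurableTypeR R)%type.
Implicit Types (x y z : R * R) (w f h : R * R -> R).

Definition relative_stream (Omega : R) w x : R :=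
  stream w x + Omega / 2 * enorm x ^+ 2.

Lemma relative_stream_grad (Omega r : R) w x : bounded_vorticity r w ->
  has_grad (relative_stream Omega w) x (rel1 Omega w x) (rel2 Omega w x).
Proof.
move=> W.
by apply: (has_grad_eq (has_gradD (stream_grad x W) (has_gradM
  (has_grad_cst (Omega / 2) x) (has_grad_sqr_enorm x)))); rewrite /rel1 /rel2;
  congr (_ + _); field.
Qed.

Lemma rel_continuous (Omega r : R) w : bounded_vorticity r w ->
  continuous (rel1 Omega w) /\ continuous (rel2 Omega w).
Proof.
move=> W; have [c1 c2] := biot_savart_continuous W.
split=> x; apply: cvgD; apply: cvgM; try exact: cvg_cst.
- exact: c1.
- exact: cvg_fst.
- exact: c2.
- exact: cvg_snd.
Qed.

Lemma bounded_vorticity_widen (r r' : R) w : r <= r' -> bounded_vorticity r w ->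
  bounded_vorticity r' w.
Proof. by move=> rr [mw w1 w0]; split=> // x r'x; apply: w0; exact: le_trans rr r'x. Qed.

Lemma bounded_vorticity_indic (r : R) (K : set (R * R)) : measurable (K : set plane) ->
  (forall x, r <= enorm x -> ~ K x) -> bounded_vorticity r (\1_K).
Proof.
move=> mK Kr; split; first exact: measurable_indic.
- by move=> x; rewrite indicE; case: (x \in K); rewrite ?normr1 ?normr0.
- by move=> x /Kr nK; rewrite indicE memNset.
Qed.

Lemma bounded_vorticity_sub (r : R) (K : set (R * R)) : measurable (K : set plane) ->
  1 <= r -> (forall x, r <= enorm x -> ~ K x) ->
  bounded_vorticity r (fun y => \1_K y - disk y).
Proof.
move=> mK r1 Kr; have [m1 _ z1] := bounded_vorticity_indic mK Kr.
have [m2 _ z2] := bounded_vorticity_widen r1 (@bounded_vorticity_disk R).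
split; first exact: measurable_funB.
- move=> x; rewrite indicE /disk indicE; case: (x \in K); case: (x \in _);
    by rewrite ?subrr ?subr0 ?sub0r ?normrN ?normr0 ?normr1.
- by move=> x xr; rewrite z1// z2// subrr.
Qed.

(** The patch and the disk differ only where [`|1 - |x| ^ 2|] is at most [3 * e];
this is a band of a radially decreasing function. *)
Lemma thin_annulus_area : exists2 q : R, 0 < q & forall (e : R) (K : set (R * R)),
  0 < e -> e <= 4^-1 -> measurable (K : set plane) ->
  (forall x, enorm x < 1 - e -> K x) -> (forall x, 1 + e <= enorm x -> ~ K x) ->
  L1norm (fun y => \1_K y - disk y) <= q * e.
Proof.
have q0 := @band_constant_gt0 R.
exists (3 * (band_constant / 2)); first by rewrite mulr_gt0// divr_gt0.
move=> e K e0 e4 mK Kin Kout.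
pose s := 3 * e.
have s0 : 0 < s by rewrite /s; lra.
have s1 : s <= 3 / 4 by rewrite /s; lra.
have is0 : 0 < s^-1 by rewrite invr_gt0.
pose N x : R := s^-1 - s^-1 * enorm x ^+ 2.
have NE x : N x = (1 - enorm x ^+ 2) / s by rewrite /N; ring.
have far x : 2 <= enorm x -> N x <= -3.
  by move=> x2; rewrite NE ler_pdivrMr//; nra.
have farS x : 2 <= enorm x -> spline (N x) = 0 /\ spline' (N x) = 0.
  by move=> /far h; have [/(_ h)[-> -> _] _ _ _ _] := spline_pieces (N x).
have C := spline_radial_C1 s^-1 is0; rewrite -/N /= in C.
have R1 x : x.1 * (spline' (N x) * (- 2 * s^-1 * x.1)) + x.2 * (spline' (N x) * (- 2 * s^-1 * x.2)) =
   - (spline' (N x) * (2 * s^-1 * enorm x ^+ 2)) by rewrite sqr_enorm; ring.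
have S6 x : 0 <= spline' (N x) <= 6 by have [] := spline_bounds (N x).
pose B : set (R * R) := [set x | `|N x| <= 1].
have mN : measurable_fun [set: plane] N.
  by apply: measurable_funB => //; apply: measurable_funM => //; apply: measurable_funX; exact: measurable_enorm.
have mB : measurable (B : set plane) by exact: measurable_normr_le mN.
have AB : L1norm (\1_B) <= band_constant / (2 * s^-1).
  apply: (radial_band_area C) => //.
  - by move=> x; have [] := spline_bounds (N x).
  - by move=> x /farS[s1x s2x] /=; rewrite s1x s2x !mul0r.
  - by rewrite mulr_gt0.
  - move=> x; rewrite R1 oppr_le0 mulr_ge0//; first by have /andP[] := S6 x.
    by rewrite mulr_ge0 ?sqr_ge0// mulr_ge0// ltW.
  - move=> x Bx; rewrite R1 lerN2.
    have q4 : 4 <= spline' (N x) by apply: spline'_ge4; rewrite -ler_norml.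
    have e2 : 4^-1 <= enorm x ^+ 2.
      move: Bx; rewrite /B /= ler_norml => /andP[_]; rewrite NE ler_pdivrMr//; lra.
    have : 4 * (4^-1 * (2 * s^-1)) <= spline' (N x) * (enorm x ^+ 2 * (2 * s^-1)).
      apply: ler_pM => //; first by rewrite !mulr_ge0// ltW.
      by rewrite ler_wpM2r// mulr_ge0// ltW.
    by rewrite (mulrC (2 * s^-1)) mulrA divff ?mul1r// lt0r_neq0.
have W := bounded_vorticity_sub mK (_ : 1 <= 2) (r := 2).
have {}W : bounded_vorticity 2 (fun y => \1_K y - disk y).
  by apply: W => [|x x2]; [lra|apply: Kout; lra].
have WB : bounded_vorticity 2 (\1_B).
  apply: bounded_vorticity_indic => // x /far Nx; rewrite /B /= => /ler_normlP[]; lra.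
apply: (le_trans (y := L1norm (\1_B))); last first.
  apply: (le_trans AB); rewrite invfM invrK /s; lra.
apply: le_Rintegral => //.
- exact: (integrable_norm (integrable_vorticity W)).
- exact: (integrable_norm (integrable_vorticity WB)).
move=> x _; rewrite [\1_B x]indicE.
case: (boolP (x \in B)) => [xB|xB].
  by rewrite normr1; have [_ w1 _] := W.
rewrite normr0 normr_le0 subr_eq0 diskE indicE -sqr_enorm.
have e0x := enorm_ge0 x.
have out : s < `|1 - enorm x ^+ 2|.
  rewrite ltNge; apply: contra xB => h; apply/mem_set; rewrite /B /= NE.
  by rewrite normrM (gtr0_norm is0) ler_pdivrMr// mul1r.
move: out; rewrite ltr_normr => /orP[h|h].
  rewrite ifT; last lra.
  by rewrite mem_set//; apply: Kin; rewrite /s in h; nra.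
rewrite ifF; last by apply/negbTE; rewrite -leNgt; lra.
by rewrite memNset//; apply: Kout; rewrite /s in h; nra.
Qed.

Lemma inv_2pi_bounds : 0 <= (2 * pi)^-1 :> R /\ (2 * pi)^-1 <= 4^-1 :> R.
Proof.
have pi2 := pi_ge2 R; have pi0 := pi_gt0 R.
split; first by rewrite invr_ge0 mulr_ge0// ltW.
by rewrite lef_pV2 ?posrE//; lra.
Qed.

Lemma disk_quotient (r : R) : (2 * pi)^-1 * (r * pi) = r / 2.
Proof. by rewrite mulrC -mulf_div divff ?mulr1// lt0r_neq0// pi_gt0. Qed.

Lemma near_disk_arith (sg a r Om p q1 q2 : R) : 0 < sg -> sg <= 4^-1 -> a <= sg / 8 ->
  1 - a < r -> r < 1 + a -> 0 <= p -> p <= 4^-1 -> `|q1| <= 4 * (sg / 16) ->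
  `|q2| <= 4 * (sg / 16) -> Om <= 2^-1 - sg + sg / 8 ->
  - (r / 2) - p * (q1 + q2) + Om * r ^+ 2 <= - (sg / 2).
Proof.
move=> sg0 sg4 a2 r1 r2 p0 p4; rewrite !ler_norml => /andP[h1 h2] /andP[h3 h4] O.
have T2 : - (p * (q1 + q2)) <= sg / 8 by nra.
have T3 : Om * r ^+ 2 <= (2^-1 - sg + sg / 8) * (1 + 3 * a).
  have rr : r ^+ 2 <= 1 + 3 * a by nra.
  apply: (@le_trans _ _ ((2^-1 - sg + sg / 8) * r ^+ 2)).
    by rewrite ler_wpM2r// sqr_ge0.
  by rewrite ler_wpM2l//; lra.
have : (2^-1 - sg + sg / 8) * (1 + 3 * a) <= 2^-1 - 7 / 8 * sg + 3 / 2 * a by nra.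
lra.
Qed.

(** For the disk, the outward derivative of the relative stream function on the unit
circle is [Omega - 1 / 2], which is at most [- 7 / 8 * sg]. The log-Lipschitz bound
extends the estimate to an annulus, and the velocity depends continuously on
the vorticity in L1. *)
Lemma near_disk_radial (sg : R) : 0 < sg <= 4^-1 ->
  exists a L : R, [/\ 0 < a <= 2^-1, 0 < L &
   forall w (Omega : R), bounded_vorticity 2 w ->
   bounded_vorticity 2 (fun y => w y - disk y) ->
   L1norm (fun y => w y - disk y) <= L -> Omega <= 2^-1 - sg + sg / 8 ->
   forall x, 1 - a < enorm x < 1 + a ->
     x.1 * rel1 Omega w x + x.2 * rel2 Omega w x <= - (sg / 2)].
Proof.
move=> /andP[sg0 sg4]; pose e := sg / 16.
have e0 : 0 < e by rewrite divr_gt0.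
have e32 : 0 < e / 32 by rewrite divr_gt0.
have [d d0 Hd] := modulus_small (rho := 3 : R) ltac:(by []) e32.
exists (Num.min d (sg / 8)), (e ^+ 2 / 32); split.
- by rewrite lt_min d0 divr_gt0//= ge_min; apply/orP; right; lra.
- by rewrite divr_gt0// exprn_gt0.
move=> w Omega W Wd WL Ob x.
have a1 : Num.min d (sg / 8) <= d by rewrite ge_min lexx.
have a2 : Num.min d (sg / 8) <= sg / 8 by rewrite ge_min lexx orbT.
move: (Num.min _ _) a1 a2 => a a1 a2 /andP[x1 x2].
have xle2 : enorm x <= 2 by lra.
have WD := @bounded_vorticity_disk R.
have WD2 : bounded_vorticity 2 (@disk R) by apply: bounded_vorticity_widen WD; lra.
pose r := enorm x.
have r0 : 0 < r by rewrite /r; lra.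
pose u : R * R := (x.1 / r, x.2 / r).
have u1 : enorm u = 1.
  rewrite /enorm /u /= !exprMn -mulrDl -sqr_enorm -/r exprVn divff ?sqrtr1//.
  by rewrite expf_neq0// gt_eqF.
have xu : enorm (x - u) = `|r - 1|.
  have -> : x - u = ((r - 1) * (x.1 / r), (r - 1) * (x.2 / r)).
    have rr : r != 0 by rewrite gt_eqF.
    by case: x {x1 x2 xle2} @r @u r0 u1 rr => p q r u r0 u1 rr; congr pair; rewrite /=; field.
  rewrite /enorm /= !exprMn -mulrDr sqrtrM ?sqr_ge0// sqrtr_sqr.
  by have := u1; rewrite /enorm /u /= !exprMn => ->; rewrite mulr1.
have D1 := disk_radial u1.
have [E1 E2] : `|biot_savart1 disk x - biot_savart1 disk u| <= e /\
               `|biot_savart2 disk x - biot_savart2 disk u| <= e.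
  have [->|xnu] := eqVneq x u; first by rewrite !subrr normr0 !(ltW e0).
  have xu0 : 0 < enorm (x - u) by rewrite enorm_gt0 subr_eq0.
  have xud : enorm (x - u) < d by rewrite xu ltr_norml /r; apply/andP; split; lra.
  have x3 : enorm x + 1 <= 3 by lra.
  have u3 : enorm u + 1 <= 3 by rewrite u1; lra.
  have [B1 B2] := biot_savart_loglip WD xnu (ltr0n R 3) x3 u3.
  have Me : enorm (x - u) * (32 * ln (1 + 2 * 3 / enorm (x - u))) <= e.
    by rewrite mulrCA mulrC -ler_pdivlMr//; exact: Hd.
  by split; [exact: (le_trans B1)|exact: (le_trans B2)].
have [F1 F2] : `|biot_savart1 w x - biot_savart1 disk x| <= e /\
               `|biot_savart2 w x - biot_savart2 disk x| <= e.
  have [-> ->] := biot_savartB x W WD2.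
  have e16 : 0 < e / 16 by rewrite divr_gt0.
  have [B1 B2] := biot_savart_le x Wd e16.
  have LE : L1norm (fun y => w y - disk y) / (e / 16) + 8 * (e / 16) <= e.
    have : L1norm (fun y => w y - disk y) / (e / 16) <= e / 2 by rewrite ler_pdivrMr//; lra.
    lra.
  by split; [apply: (le_trans B1)|apply: (le_trans B2)].
have D2 : x.1 * biot_savart1 disk u + x.2 * biot_savart2 disk u = r * pi.
  rewrite -D1 /u /=; field; by rewrite gt_eqF.
have c1 : `|x.1| <= 2 := le_trans (ler_enorm1 x) xle2.
have c2 : `|x.2| <= 2 := le_trans (ler_enorm2 x) xle2.
pose A1 := biot_savart1 w x - biot_savart1 disk u.
pose A2 := biot_savart2 w x - biot_savart2 disk u.
have A1e : `|x.1 * A1| <= 4 * e.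
  rewrite normrM (_ : 4 * e = 2 * (2 * e)); last by ring.
  apply: ler_pM => //; rewrite /A1.
  by rewrite -(subrKA (biot_savart1 disk x)) (le_trans (ler_normD _ _))// mulr_natl mulr2n lerD.
have A2e : `|x.2 * A2| <= 4 * e.
  rewrite normrM (_ : 4 * e = 2 * (2 * e)); last by ring.
  apply: ler_pM => //; rewrite /A2.
  by rewrite -(subrKA (biot_savart2 disk x)) (le_trans (ler_normD _ _))// mulr_natl mulr2n lerD.
have T : x.1 * rel1 Omega w x + x.2 * rel2 Omega w x =
   - (2 * pi)^-1 * (r * pi) - (2 * pi)^-1 * (x.1 * A1 + x.2 * A2) + Omega * r ^+ 2.
  by rewrite -D2 /rel1 /rel2 /A1 /A2 /r sqr_enorm; ring.
rewrite T mulNr disk_quotient.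
have [p0 p4] := inv_2pi_bounds.
by apply: (near_disk_arith (a := a)).
Qed.

Lemma relative_stream_disk (Omega r t u : R) :
  relative_stream Omega disk (polar r t) = relative_stream Omega disk (polar r u).
Proof.
suff H v : relative_stream Omega disk (polar r v) = relative_stream Omega disk (r, 0).
  by rewrite !H.
have [md _ _] := @bounded_vorticity_disk R.
have -> : polar r v = rotation v (r, 0).
  by rewrite /polar /rotation /= !mulr0 subr0 addr0 ![_ * r]mulrC.
rewrite /relative_stream enorm_rotation -stream_rotation//.
have -> : disk \o rotation v = disk by apply/funext => y; exact: disk_rotation.
by [].
Qed.

Lemma relative_stream_near_disk (e : R) : 0 < e -> exists2 L : R, 0 < L &
  forall w (Omega : R), bounded_vorticity 2 w -> bounded_vorticity 2 (fun y => w y - disk y) ->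
   L1norm (fun y => w y - disk y) <= L -> forall x, enorm x <= 2 ->
   `|relative_stream Omega w x - relative_stream Omega disk x| <= e.
Proof.
(* 68 = 4^-1 * 17 * 16, from the bounds on (2 * pi)^-1, on 1 + 4 ^+ 2, and on
   the two halves of the cut-off potential *)
move=> e0; pose eta := e / 68.
have eta0 : 0 < eta by rewrite divr_gt0.
exists (8 * eta ^+ 2); first by rewrite mulr_gt0// exprn_gt0.
move=> w Omega W Wd WL x x2.
have WD := @bounded_vorticity_disk R.
have -> : relative_stream Omega w x - relative_stream Omega disk x =
   - (2 * pi)^-1 * potential (fun y => w y - disk y) x.
  rewrite /relative_stream (streamE _ W) (streamE _ WD) /potential.
  have -> : \int[area]_y (ln (enorm (x - y)) * (w y - disk y)) =
    \int[area]_y (ln (enorm (x - y)) * w y) - \int[area]_y (ln (enorm (x - y)) * disk y).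
    rewrite -RintegralB//; [|exact: integrable_ln W|exact: integrable_ln WD].
    by apply: eq_Rintegral => y _; rewrite mulrBr.
  ring.
have x4 : enorm x + 2 <= 4 by lra.
have B := potential_le Wd eta0 x4.
have [p0 p4] := inv_2pi_bounds.
have {}p4 : `|- (2 * pi)^-1| <= 4^-1 :> R by rewrite normrN ger0_norm.
rewrite normrM (_ : e = 4^-1 * (17 * (8 * eta + 8 * eta))); last by rewrite /eta; field.
apply: ler_pM => //; apply: (le_trans B).
rewrite (_ : 1 + 4 ^+ 2 = 17); last by ring.
rewrite ler_wpM2l// lerD2r ler_pdivrMr//; lra.
Qed.

End perturbed_disks.

(** * Kelvin waves as stable patches *)

Section stable_patches.
Context {R : realType}.
Local Notation plane := (measurableTypeR R * measurableTypeR R)%type.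
Implicit Types (x y z : R * R) (K : set (R * R)).

(** What the stability argument uses about a uniformly rotating patch [K]: near the
unit circle, [K] is the set where the relative stream function exceeds its
boundary value [c], and that function decreases radially. *)
Record stable_patch (Omega a k kappa c : R) K : Prop := {
  patch_measurable : measurable (K : set plane);
  patch_parameters : [/\ 0 < a, a <= 2^-1, 0 < k & 0 < kappa];
  patch_stationary : stationary K (rel1 Omega (\1_K)) (rel2 Omega (\1_K));
  patch_radial : forall x, 1 - a < enorm x < 1 + a ->
    x.1 * rel1 Omega (\1_K) x + x.2 * rel2 Omega (\1_K) x <= - k;
  patch_high : forall x, 1 - a < enorm x <= 1 - a / 2 ->
    3 * kappa <= relative_stream Omega (\1_K) x - c;
  patch_low : forall x, 1 + a / 2 <= enorm x < 1 + a ->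
    relative_stream Omega (\1_K) x - c <= - (3 * kappa);
  patch_in : forall x, enorm x <= 1 - a / 2 -> K x;
  patch_out : forall x, 1 + a / 2 <= enorm x -> ~ K x;
  patch_sign : forall x, 1 - a < enorm x < 1 + a ->
    (K x -> c <= relative_stream Omega (\1_K) x) /\
    (~ K x -> relative_stream Omega (\1_K) x <= c)
}.

(** In the frame that rotates with the patch the solution does not depend on time,
so both sides of the weak identity are explicit. *)
Lemma rotating_stationary (Omega r : R) K :
  bounded_vorticity r (\1_K) ->
  weak_solution (\1_K) (fun t => rotated (Omega * t) (\1_K)) ->
  stationary K (rel1 Omega (\1_K)) (rel2 Omega (\1_K)).
Proof.
move=> W sol chi g1 g2 C.
have mr s : measurable_fun [set: plane] (rotated (Omega * s) (\1_K : R * R -> R)).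
  by have [m1 _ _] := bounded_vorticity_rotation (- (Omega * s)) W; exact: m1.
have := weak_identity C sol ler01 (fun s _ => mr s) (w := fun=> \1_K)
  (fun s _ => ex_intro _ r W) (fun s _ => ltac:(by apply: aeW)).
rewrite subrr /Rintegral integral_cst//= lebesgue_measure_itv/= lte_fin ltr01 -EFinB subr0 mule1.
by move=> /esym H; exact: H.
Qed.

(** The values [d1], [d2] are those of the disk at two points of a ray, [p1] and [p2]
those of the patch; the radial decrease across the gap beats the two errors. *)
Lemma stream_margin (k a gap d1 d2 p1 p2 : R) : 0 < k -> 0 < a ->
  3 / 8 * a <= gap -> d2 + k / 2 * gap <= d1 ->
  `|p1 - d1| <= k * a / 64 -> `|p2 - d2| <= k * a / 64 ->
  3 * (k * a / 32) <= p1 - p2.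
Proof.
move=> k0 a0 ag; rewrite !ler_norml => dec /andP[h1 h2] /andP[h3 h4].
have : k / 2 * (3 / 8 * a) <= k / 2 * gap by rewrite ler_wpM2l//; lra.
have : 0 < k * a by rewrite mulr_gt0.
lra.
Qed.

(** The relative stream function of the disk is radial and strictly decreasing near
the unit circle. That of the patch is uniformly close to it, which gives the
bounds away from the boundary; near the boundary the patch has its own radial
decrease, and its boundary value is constant. *)
Lemma perturbed_disk_stable (sg : R) : 0 < sg <= 4^-1 ->
  exists2 e : R, 0 < e & forall (Omega : R) (g : R -> R), continuous g ->
    (forall t, g (t + 2 * pi) = g t) -> (forall t, `|g t| <= e) ->
    Omega <= 2^-1 - sg + sg / 8 ->
    weak_solution (\1_(kelvin_set g)) (fun t => rotated (Omega * t) (\1_(kelvin_set g))) ->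
    exists a k kappa c, stable_patch Omega a k kappa c (kelvin_set g).
Proof.
move=> sg01; have /andP[sg0 sg4] := sg01.
have [a [L [/andP[a0 a1] L0 rad]]] := near_disk_radial sg01.
pose k := sg / 2; have k0 : 0 < k by rewrite divr_gt0.
have e30 : 0 < k * a / 64 by rewrite divr_gt0 ?mulr_gt0.
have [L' L'0 close] := relative_stream_near_disk e30.
have [q q0 annulus] := @thin_annulus_area R.
pose e := Num.min (a / 8) (Num.min (L / q) (L' / q)).
have e0 : 0 < e by rewrite !lt_min; apply/and3P; split; exact: divr_gt0.
have e1 : e <= a / 8 by rewrite ge_min lexx.
have e2 : e <= L / q by rewrite !ge_min lexx !orbT.
have e3 : e <= L' / q by rewrite !ge_min lexx !orbT.
exists e => // Omega g cg gT ge Ob sol; move: e e0 e1 e2 e3 ge => e e0 e1 e2 e3 ge.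
set K := kelvin_set g in sol *.
have g2 t : - 2^-1 < g t by have := ge t; rewrite ler_norml => /andP[? _]; lra.
have gb t : - e <= g t <= e by rewrite -ler_norml.
have Kin x : enorm x < 1 - e -> K x.
  have [t xt] := polar_exists x; move=> xe; rewrite xt; apply/(kelvin_setP cg gT g2 t (enorm_ge0 x)).
  by have := gb t; clear -xe; lra.
have Kout x : 1 + e <= enorm x -> ~ K x.
  have [t xt] := polar_exists x; move=> xe; rewrite xt => /(kelvin_setP cg gT g2 t (enorm_ge0 x)).
  by have := gb t; clear -xe; lra.
have mK := open_measurable2 (open_kelvin_set cg gT g2).
have e4 : e <= 4^-1 by clear -e1 a1; lra.
have Area := annulus e K e0 e4 mK Kin Kout.
have AL : q * e <= L by rewrite mulrC -ler_pdivlMr.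
have AL' : q * e <= L' by rewrite mulrC -ler_pdivlMr.
have W : bounded_vorticity 2 (\1_K) by apply: bounded_vorticity_indic => // x x2; apply: Kout; clear -x2 e4; lra.
have Wd : bounded_vorticity 2 (fun y => \1_K y - disk y).
  by apply: bounded_vorticity_sub => // [|x x2]; [clear; lra|apply: Kout; clear -x2 e4; lra].
have WD : bounded_vorticity 2 (@disk R).
  by apply: bounded_vorticity_widen (@bounded_vorticity_disk R); clear; lra.
have W0 : bounded_vorticity 2 (fun y => disk y - disk y :> R).
  rewrite (_ : (fun y => disk y - disk y) = cst 0); last by apply/funext => y; rewrite subrr.
  by split=> // x; rewrite normr0.
have radK := rad _ Omega W Wd (le_trans Area AL) Ob.
have radD := rad _ Omega WD W0 ltac:(by rewrite /L1norm; under eq_Rintegral do rewrite subrr normr0; rewrite /Rintegral integral0; exact: ltW) Ob.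
have {}close x : enorm x <= 2 -> `|relative_stream Omega (\1_K) x - relative_stream Omega disk x| <= k * a / 64.
  by apply: close => //; exact: le_trans Area AL'.
have sta : stationary K (rel1 Omega (\1_K)) (rel2 Omega (\1_K)) by exact: (rotating_stationary W sol).
have GK x := relative_stream_grad Omega x W.
have GD x := relative_stream_grad Omega x WD.
have [c1 c2] := rel_continuous Omega W.
pose P := relative_stream Omega (\1_K).
pose D := relative_stream Omega (@disk R).
pose b t := P (polar (1 + g t) t).
pose kappa := k * a / 32.
have kappa0 : 0 < kappa by rewrite divr_gt0 ?mulr_gt0.
have gb8 t : - (a / 8) <= g t <= a / 8 by have := gb t; clear -e1; lra.
have bclose t : `|b t - D (polar (1 + g t) t)| <= k * a / 64.
  by apply: close; rewrite enorm_polar; have := gb8 t; clear -a0 a1; lra.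
have high x t : 1 - a < enorm x <= 1 - a / 2 -> 3 * kappa <= P x - b t.
  move=> /andP[x1 x2]; have g8 := gb8 t; have [u xu] := polar_exists x.
  have ub : 1 + g t < 1 + a by clear -g8 a0; lra.
  have gap : 3 / 8 * a <= 1 + g t - enorm x by clear -g8 x2; lra.
  have ord : enorm x <= 1 + g t by clear -gap a0; lra.
  have x2' : enorm x <= 2 by clear -x2 a0; lra.
  have a12 : 1 + a <= 2 by clear -a1; lra.
  have a10 : 0 < 1 - a by clear -a1; lra.
  have := ray_decrease t a10 a12 (ltW k0) GD radD x1 ord ub.
  rewrite (relative_stream_disk _ (enorm x) t u) -xu -/D => dec.
  exact: stream_margin k0 a0 gap dec (close x x2') (bclose t).
have low x t : 1 + a / 2 <= enorm x < 1 + a -> P x - b t <= - (3 * kappa).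
  move=> /andP[x1 x2]; have g8 := gb8 t; have [u xu] := polar_exists x.
  have lb : 1 - a < 1 + g t by clear -g8 a0; lra.
  have gap : 3 / 8 * a <= enorm x - (1 + g t) by clear -g8 x1; lra.
  have ord : 1 + g t <= enorm x by clear -gap a0; lra.
  have x2' : enorm x <= 2 by clear -x2 a1; lra.
  have a12 : 1 + a <= 2 by clear -a1; lra.
  have a10 : 0 < 1 - a by clear -a1; lra.
  have := ray_decrease t a10 a12 (ltW k0) GD radD lb ord x2.
  rewrite (relative_stream_disk _ (enorm x) t u) -xu -/D => dec.
  rewrite -opprB lerN2.
  exact: stream_margin k0 a0 gap dec (bclose t) (close x x2').
have ga t : `|g t| <= a / 4 by rewrite (le_trans (ge t)); clear -e1 a0; lra.
have const t u : b t = b u := boundary_value_constant cg gT GK c1 c2 a0 a1 k0 kappa0 ga radK high low sta t u.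
exists a, k, kappa, (b 0); split => //.
- by move=> x /high; apply.
- by move=> x /low; apply.
- by move=> x x1; apply: Kin; clear -x1 e1 a0; lra.
- by move=> x x1; apply: Kout; clear -x1 e1 a0; lra.
- move=> x /(kelvin_point cg gT GK a0 a1 k0 ga radK)[t [_]].
  by rewrite -/P -/(b t) (const t 0).
Qed.

End stable_patches.

Section kelvin_waves.
Context {R : realType}.

(** The limit of the angular velocities stays below [1 / 2] by [sg = 1 / (2 * m)].
The profile is periodic as a sum of cosines. *)
Lemma kelvin_stable_patch (m : nat) (g : R -> R -> R) (Omega : R -> R) : (2 <= m)%N ->
  kelvin_family m g Omega -> exists2 beta1 : R, 0 < beta1 &
    forall beta, 0 < beta <= beta1 ->
    exists a k kappa c, stable_patch (Omega beta) a k kappa c (kelvin_set (g beta)).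
Proof.
move=> m2 [smooth modes _ small cvgO rot].
have m2R : 2 <= m%:R :> R by rewrite ler_nat.
pose sg : R := (2 * m%:R)^-1.
have sg0 : 0 < sg <= 4^-1.
  by rewrite /sg invr_gt0 mulr_gt0//= ?lef_pV2 ?posrE ?mulr_gt0//; lra.
have Oinf : (m%:R - 1) / (2 * m%:R) = 2^-1 - sg :> R.
  by rewrite /sg; field; lra.
have [e e0 He] := perturbed_disk_stable sg0.
have sg8 : 0 < sg / 8 by rewrite divr_gt0//; case/andP: sg0.
have close : \forall beta \near (0 : R)^'+, Omega beta <= 2^-1 - sg + sg / 8.
  move/cvgrPdist_le : cvgO => /(_ _ sg8); apply: filterS => beta.
  by rewrite Oinf ler_norml => /andP[h1 h2]; lra.
have good : \forall beta \near (0 : R)^'+, 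
    exists a k kappa c, stable_patch (Omega beta) a k kappa c (kelvin_set (g beta)).
  near=> beta; apply: He.
  - move=> t; have sm : forall n (theta : R), derivable (derive1n n (g beta)) theta 1 by near: beta.
    exact/differentiable_continuous/derivable1_diffP/(sm 0%N).
  - have [A HA] : exists A : nat -> R, forall theta,
      (fun n => \sum_(2 <= k < n) A k * cos ((k * m)%:R * theta)) @ \oo
        --> g beta theta - beta * cos (m%:R * theta) by near: beta.
    have per (n : nat) (t : R) : cos (n%:R * (t + 2 * pi)) = cos (n%:R * t).
      have pc (s : R) : cos (s + 2 * pi) = cos s by rewrite mulr_natl cosD2pi.
      by rewrite mulrDr -[RHS](@periodic_int R (@cos R) (2 * pi) (n%:R * t) n pc) -pmulrn.
    move=> t; have := HA (t + 2 * pi); rewrite per.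
    under eq_fun do under eq_bigr do rewrite per.
    move=> /cvg_lim - /(_ (@Rhausdorff R)); have /cvg_lim -/(_ (@Rhausdorff R)) -> := HA t.
    by move=> /addIr.
  - have sm : forall theta, `|g beta theta| <= e /\ `|derive1 (g beta) theta| <= e.
      by near: beta; exact: small.
    by move=> t; case: (sm t).
  - by near: beta.
  - suff : yudovich_solution (kelvin_set (g beta))
      (fun t => rotated (Omega beta * t) (kelvin_wave (g beta))) by case.
    by near: beta.
have /nbhs_ballP[d /= d0 Hd] := good.
exists (d / 2); first by rewrite divr_gt0.
move=> beta /andP[b0 b1]; apply: Hd => //.
by rewrite /ball/= sub0r normrN gtr0_norm//; lra.
Unshelve. all: by end_near. Qed.

End kelvin_waves.

(** * Double integrals over the plane *)

Lemma integral_EFin d (T : measurableType d) (R : realType) (mu : {measure set T -> \bar R})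
    (f : T -> R) : mu.-integrable setT (EFin \o f) ->
  (\int[mu]_x (f x)%:E)%E = (\int[mu]_x f x)%:E.
Proof. by move=> I; rewrite /Rintegral fineK//; exact: (integrable_fin_num measurableT I). Qed.

Section double_integrals.
Context {R : realType}.
Local Notation plane := (measurableTypeR R * measurableTypeR R)%type.
Implicit Types (x y z : R * R) (a b w f : R * R -> R).

Lemma sigma_finite_area : sigma_finite [set: plane] (area : set plane -> \bar R).
Proof.
have /sigma_finiteP[F [TF ndF Foo]] := sigma_finiteT (@lebesgue_measure R).
exists (fun n => F n `*` F n).
  rewrite -setXTT TF predeqE => -[x y]; split.
    move=> [/= [n _ Fnx] [k _ Fky]]; exists (maxn n k) => //; split.
    - by move: x Fnx; exact/subsetPset/ndF/leq_maxl.
    - by move: y Fky; exact/subsetPset/ndF/leq_maxr.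
  by move=> [n _ []/= ? ?]; split; exists n.
move=> k; have [? ?] := Foo k.
split; first exact: measurableX.
by rewrite product_measure1E// lte_mul_pinfty// ge0_fin_numE.
Qed.
(** The area measure under a name of its own, to carry the sigma-finite structure
on which Fubini's theorem relies. *)
Definition planar : set plane -> \bar R := area.
HB.instance Definition _ := Measure.copy planar (area : measure plane R).
HB.instance Definition _ := Measure_isSigmaFinite.Build _ plane R planar sigma_finite_area.

Lemma measurable_difference (F : R * R -> R) : measurable_fun [set: plane] F ->
  measurable_fun [set: (plane * plane)%type] (fun p : plane * plane => F (p.1 - p.2)).
Proof.
move=> mF; apply: (measurableT_comp mF).
apply/measurable_fun_pairP; split => /=.
- apply: measurable_funB; apply: measurableT_comp => //.
- apply: measurable_funB; apply: measurableT_comp => //.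
Qed.

Lemma double_integral_swap (G : (R * R) * (R * R) -> R) (M r r' : R) a b : 0 <= M ->
  bounded_vorticity r a -> bounded_vorticity r' b ->
  measurable_fun [set: (plane * plane)%type] G ->
  (forall x y, `|G (x, y)| <= M * (enorm (x - y))^-1) ->
  \int[area]_x (a x * \int[area]_y (G (x, y) * b y)) =
  \int[area]_y (b y * \int[area]_x (G (x, y) * a x)).
Proof.
move=> M0 A B mG GM; have [ma a1 _] := A; have [mb b1 _] := B.
pose f (p : plane * plane) : \bar R := (a p.1 * G p * b p.2)%:E.
have mf : measurable_fun [set: (plane * plane)%type] f.
  apply/measurable_EFinP; apply: measurable_funM; [apply: measurable_funM => //|].
  - exact: (measurableT_comp (ma : measurable_fun [set: plane] a)).
  - exact: (measurableT_comp (mb : measurable_fun [set: plane] b)).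
have int1 x : area.-integrable setT (EFin \o (fun y => G (x, y) * b y)).
  have [I _] := Rintegral_inv_le x B ltr01.
  apply: (@integrable_dominated _ plane R area _ (fun y => M * ((enorm (x - y))^-1 * `|b y|))).
  - apply: measurable_funM => //; exact: (measurableT_comp mG (pair1_measurable x)).
  - exact: integrable_funZ.
  - by move=> y; rewrite normrM mulrA ler_wpM2r.
have int2 y : area.-integrable setT (EFin \o (fun x => G (x, y) * a x)).
  have [I _] := Rintegral_inv_le y A ltr01.
  apply: (@integrable_dominated _ plane R area _ (fun x => M * ((enorm (y - x))^-1 * `|a x|))).
  - apply: measurable_funM => //; exact: (measurableT_comp mG (pair2_measurable y)).
  - exact: integrable_funZ.
  - by move=> x; rewrite normrM mulrA ler_wpM2r// enormBC.
have fin : (\int[area]_x \int[area]_y `|f (x, y)| < +oo)%E.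
  pose c := M * (L1norm b + 8).
  have inner x : (\int[area]_y `|f (x, y)| <= (c * `|a x|)%:E)%E.
    have [I IB] := Rintegral_inv_le x B ltr01.
    have I2 := integrable_funZ (`|a x| * M) I.
    apply: (@le_trans _ _ (\int[area]_y (`|a x| * M * ((enorm (x - y))^-1 * `|b y|))%:E)%E).
      apply: ge0_le_integral => //.
      - have : measurable_fun [set: plane] (f \o (fun y : plane => (x, y))).
          exact: (measurableT_comp mf (pair1_measurable x)).
        by move=> h; exact: measurableT_comp.
      - by case/integrableP : I2.
      - move=> y _; rewrite /f /= lee_fin !normrM -!mulrA ler_wpM2l// mulrA.
        by rewrite ler_wpM2r.
    rewrite (integral_EFin I2) lee_fin RintegralZl//.
    rewrite (_ : c * `|a x| = `|a x| * M * (L1norm b / 1 + 8 * 1)); last by rewrite /c divr1 mulr1; ring.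
    by rewrite ler_wpM2l// mulr_ge0.
  have Ia := integrable_funZ c (integrable_norm (integrable_vorticity A)).
  apply: (@le_lt_trans _ _ (\int[area]_x (c * `|a x|)%:E)%E); last first.
    by rewrite (integral_EFin Ia) ltry.
  apply: ge0_le_integral => //.
  - by move=> x _; exact: integral_ge0.
  - have mabs : measurable_fun [set: (plane * plane)%type] (abse \o f) by exact: measurableT_comp.
    have h := @measurable_fun_fubini_tonelli_F _ _ plane plane R planar (abse \o f) mabs (fun _ => abse_ge0 _).
    exact: h.
  - by case/integrableP : Ia.
have If := (@integrable12ltyP _ _ plane plane R planar planar f mf).2 fin.
have : (\int[area]_x \int[area]_y f (x, y) = \int[area]_y \int[area]_x f (x, y))%E :=
  @Fubini _ _ plane plane R planar planar f If.
move=> /(congr1 fine) E; rewrite /Rintegral; etransitivity; [|etransitivity; [exact: E|]].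
- congr fine; apply: eq_integral => x _.
  rewrite EFinM -(integral_EFin (int1 x)).
  rewrite -(integralZl measurableT (int1 x) (a x)).
  apply: eq_integral => y _.
  by rewrite /f /= -EFinM mulrA.
- congr fine; apply: eq_integral => y _.
  rewrite EFinM -(integral_EFin (int2 y)).
  rewrite -(integralZl measurableT (int2 y) (b y)).
  apply: eq_integral => x _.
  by rewrite /f /= -EFinM; congr EFin; ring.
Qed.

End double_integrals.

(** * Stationarity tested with the singular kernel *)

Section quadratic_estimate.
Context {R : realType}.
Local Notation plane := (measurableTypeR R * measurableTypeR R)%type.
Implicit Types (x y z : R * R) (w f : R * R -> R).

Lemma C1_lipschitz f g1 g2 : C1_compact f g1 g2 ->
  exists2 M : R, 0 <= M & forall x y, `|f x - f y| <= M * enorm (x - y).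
Proof.
move=> C; have [r Hr] := C1_support C.
have [M1 H1] := continuous_bounded_support (C1_continuous1 C) (fun x h => let: And3 _ e _ := Hr x h in e).
have [M2 H2] := continuous_bounded_support (C1_continuous2 C) (fun x h => let: And3 _ _ e := Hr x h in e).
exists (M1 + M2); first by rewrite addr_ge0//; [apply: le_trans (H1 0)|apply: le_trans (H2 0)].
move=> x y.
have D (t : R) : is_derive t 1 (fun t => f (y.1 + t * (x.1 - y.1), y.2 + t * (x.2 - y.2)))
   (g1 (y.1 + t * (x.1 - y.1), y.2 + t * (x.2 - y.2)) * (x.1 - y.1) +
    g2 (y.1 + t * (x.1 - y.1), y.2 + t * (x.2 - y.2)) * (x.2 - y.2)).
  have L (u v : R) : is_derive t 1 (fun t : R => u + t * v) v.
    by have := is_deriveD (is_derive_cst u t 1) (is_derive_mulr v t); rewrite add0r.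
  exact: (has_grad_curve (C1_grad C _) (L _ _) (L _ _)).
have cF : {within `[0, 1], continuous (fun t => f (y.1 + t * (x.1 - y.1), y.2 + t * (x.2 - y.2)))}.
  by apply: continuous_subspaceT => u; exact: is_derive_continuous1 (D u).
have [t _] := MVT (@ltr01 R) (fun u _ => D u) cF.
rewrite !mul1r !mul0r !addr0 subr0 mulr1 !(addrC y.1) !(addrC y.2) !subrK -!surjective_pairing => ->.
move: (_, _) => p; rewrite (le_trans (ler_normD _ _))// !normrM mulrDl.
by apply: lerD; apply: ler_pM => //; [exact: (ler_enorm1 (x - y))|exact: (ler_enorm2 (x - y))].
Qed.

(** The gradient of [ln (|z| ^ 2 + e ^ 2) / 2]. *)
Definition regkern1 (e : R) z : R := z.1 / (enorm z ^+ 2 + e ^+ 2).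
Definition regkern2 (e : R) z : R := z.2 / (enorm z ^+ 2 + e ^+ 2).

(** The regularisation is at the scale [eta ^ 2]: at distances beyond [eta] the
relative error is at most [eta ^ 4 / r ^ 2], hence at most [eta * r]. *)
Lemma regular_coord_close (u r eta : R) : 0 < eta -> 0 < r -> `|u| <= r ->
  `|u / (r ^+ 2 + (eta ^+ 2) ^+ 2) - u / r ^+ 2| <= eta + (if r <= eta then r^-1 else 0).
Proof.
move=> eta0 r0 ur.
have r20 : 0 < r ^+ 2 by rewrite exprn_gt0.
have e20 : 0 < (eta ^+ 2) ^+ 2 by rewrite !exprn_gt0.
set e2 := (eta ^+ 2) ^+ 2 in e20 *.
have -> : u / (r ^+ 2 + e2) - u / r ^+ 2 = - (u * (e2 / (r ^+ 2 * (r ^+ 2 + e2)))).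
  by field; rewrite !gt_eqF// addr_gt0.
rewrite normrN normrM (gtr0_norm (_ : 0 < e2 / _)); last by rewrite divr_gt0// mulr_gt0// addr_gt0.
apply: (@le_trans _ _ (r * (e2 / (r ^+ 2 * (r ^+ 2 + e2))))).
  by rewrite ler_wpM2r// divr_ge0 ?mulr_ge0// ltW// addr_gt0.
have -> : r * (e2 / (r ^+ 2 * (r ^+ 2 + e2))) = r^-1 * (e2 / (r ^+ 2 + e2)).
  by field; rewrite !gt_eqF// addr_gt0.
have [re|re] := leP r eta.
  apply: (@le_trans _ _ r^-1); last by rewrite lerDr ltW.
  rewrite ler_piMr ?invr_ge0 ?(ltW r0)// ler_pdivrMr ?addr_gt0// mul1r lerDr ltW//.
rewrite addr0 -ler_pdivlMl ?invr_gt0// invrK ler_pdivrMr ?addr_gt0//.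
have -> : e2 = eta * (eta * eta ^+ 2) by rewrite /e2; ring.
have : eta * (eta * eta ^+ 2) <= r * (eta * r ^+ 2).
  apply: ler_pM => //; rewrite ?(ltW re)// ?mulr_ge0 ?sqr_ge0 ?(ltW eta0)//.
  by rewrite ler_wpM2l ?(ltW eta0)// lerXn2r ?nnegrE ?(ltW eta0) ?(ltW r0) ?(ltW re).
have : 0 <= r * eta * (eta * (eta * eta ^+ 2)) by rewrite !mulr_ge0 ?sqr_ge0// ltW.
lra.
Qed.

Lemma regkern_close (eta : R) z : 0 < eta ->
  `|regkern1 (eta ^+ 2) z - kern1 z| <= eta + sing eta z /\
  `|regkern2 (eta ^+ 2) z - kern2 z| <= eta + sing eta z.
Proof.
move=> eta0; have [->|z0] := eqVneq z 0.
  rewrite /regkern1 /regkern2 /kern1 /kern2 !mul0r subrr normr0.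
  by rewrite addr_ge0 ?sing_ge0// ltW.
have r0 : 0 < enorm z by rewrite enorm_gt0.
by split; apply: regular_coord_close => //; [exact: ler_enorm1|exact: ler_enorm2].
Qed.

Lemma regular_log_grad (e : R) y x : e != 0 ->
  has_grad (fun x => 2^-1 * ln (enorm (x - y) ^+ 2 + e ^+ 2)) x (regkern1 e (x - y)) (regkern2 e (x - y)).
Proof.
move=> e0; have h : 0 < enorm (x - y) ^+ 2 + e ^+ 2.
  by rewrite ltr_wpDl ?sqr_ge0// exprn_even_gt0.
have G1 := has_gradD (has_grad_fst x) (has_grad_cst (- y.1) x).
have G2 := has_gradD (has_grad_snd x) (has_grad_cst (- y.2) x).
have Gs : has_grad (fun z : R * R => enorm (z - y) ^+ 2 + e ^+ 2) x (2 * (x.1 - y.1)) (2 * (x.2 - y.2)).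
  rewrite (_ : (fun z => _) = (fun z => (z.1 - y.1) * (z.1 - y.1) + (z.2 - y.2) * (z.2 - y.2) + e ^+ 2)).
    by apply: (has_grad_eq (has_gradD (has_gradD (has_gradM G1 G1) (has_gradM G2 G2)) (has_grad_cst (e ^+ 2) x))); ring.
  by apply/funext => z; rewrite sqr_enorm !expr2.
by apply: (has_grad_eq (has_gradM (has_grad_cst 2^-1 x) (has_grad_comp1 (is_derive1_ln h) Gs)));
  rewrite /regkern1 /regkern2 /=; field; rewrite gt_eqF.
Qed.

Lemma continuous_regkern (e : R) y : e != 0 ->
  continuous (fun x => regkern1 e (x - y)) /\ continuous (fun x => regkern2 e (x - y)).
Proof.
move=> e0.
have c1 x : {for x, continuous (fun z : R * R => z.1 - y.1)} by apply: cvgB; [exact: cvg_fst|exact: cvg_cst].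
have c2 x : {for x, continuous (fun z : R * R => z.2 - y.2)} by apply: cvgB; [exact: cvg_snd|exact: cvg_cst].
have cD x : {for x, continuous (fun z : R * R => (enorm (z - y) ^+ 2 + e ^+ 2)^-1)}.
  apply: cvgV; first by rewrite gt_eqF// ltr_wpDl ?sqr_ge0// exprn_even_gt0.
  rewrite (_ : (fun z => enorm (z - y) ^+ 2 + e ^+ 2) = (fun z => (z.1 - y.1) * (z.1 - y.1) + (z.2 - y.2) * (z.2 - y.2) + e ^+ 2)); last first.
    by apply/funext => z; rewrite sqr_enorm !expr2.
  rewrite sqr_enorm /= !(expr2 (_ - _)).
  apply: cvgD; last exact: cvg_cst.
  by apply: cvgD; apply: cvgM; [exact: c1|exact: c1|exact: c2|exact: c2].
by split=> x; apply: cvgM; [exact: c1|exact: cD|exact: c2|exact: cD].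
Qed.

Lemma kern1N z : kern1 (- z) = - kern1 z.
Proof. by rewrite /kern1 enormN mulNr. Qed.

Lemma kern2N z : kern2 (- z) = - kern2 z.
Proof. by rewrite /kern2 enormN mulNr. Qed.

(** Stationarity tested with [q(x) * ln |x - y|]: the terms that contain the gradient
of [q] cancel since it is parallel to [(p1, p2)]. The logarithm is regularised at
the scale [eta ^ 2], with an error of order [eta]. *)
Lemma stationary_kernel K p1 p2 q s rho y : measurable (K : set plane) ->
  bounded_vorticity 2 (\1_K) -> continuous p1 -> continuous p2 ->
  stationary K p1 p2 -> 0 < rho ->
  C1_compact q (fun x => s x * p1 x) (fun x => s x * p2 x) ->
  (forall x, enorm x < rho -> q x = 0 /\ s x = 0) ->
  \int[area]_x ((q x * p2 x * kern1 (x - y) - q x * p1 x * kern2 (x - y)) * \1_K x) = 0.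
Proof.
move=> mK W c1 c2 sta rho0 C q0; have [mI _ I0] := W.
have cq := continuous_has_grad (C1_grad C); have mq := continuous_measurable2 cq.
have [r Hr] := C1_support C.
have bnd p : continuous p -> exists M : R, forall x, `|q x * p x| <= M.
  move=> cp; apply: (continuous_bounded_support (r := r)).
    by move=> x; apply: cvgM; [exact: cq|exact: cp].
  by move=> x /Hr[-> _ _]; rewrite mul0r.
have [M1 H1] := bnd _ c1; have [M2 H2] := bnd _ c2.
pose M := Num.max M1 M2.
have qM x : `|q x * p1 x| <= M /\ `|q x * p2 x| <= M by rewrite !le_max H1 H2 orbT.
have M0 : 0 <= M by case: (qM 0) => h _; exact: le_trans (normr_ge0 _) h.
have m1 := continuous_measurable2 c1; have m2 := continuous_measurable2 c2.
set J := Rintegral _ _ _.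
have bound (eta : R) : 0 < eta -> `|J| <= 80 * M * eta.
  move=> eta0; have e0 : eta ^+ 2 != 0 by rewrite expf_neq0// gt_eqF.
  have [k1 k2] := continuous_regkern y e0.
  have CX := C1_compactM_punctured rho0 C _ (fun x _ => regular_log_grad y x e0) (fun x _ => conj (k1 x) (k2 x)).
  have {}CX := CX ltac:(by move=> x /q0[-> ->]; rewrite !mul0r).
  have := sta _ _ _ CX.
  set J' := Rintegral _ _ _ => J'0.
  have -> : J = J - J' by rewrite J'0 subr0.
  pose F x := (q x * p2 x * kern1 (x - y) - q x * p1 x * kern2 (x - y)) * \1_K x.
  pose F' x := (q x * p2 x * regkern1 (eta ^+ 2) (x - y) - q x * p1 x * regkern2 (eta ^+ 2) (x - y)) * \1_K x.
  have J'E : J' = \int[area]_x F' x.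
    by apply: eq_Rintegral => x _; rewrite /F'; ring.
  have mk1 : measurable_fun [set: plane] (fun x : plane => kern1 (x - y)).
    rewrite (_ : (fun x => _) = (fun x => - kern1 (y - x))); last first.
      by apply/funext => x; rewrite -kern1N opprB.
    by apply: measurable_funN; exact: measurable_sub_kernel measurable_kern1.
  have mk2 : measurable_fun [set: plane] (fun x : plane => kern2 (x - y)).
    rewrite (_ : (fun x => _) = (fun x => - kern2 (y - x))); last first.
      by apply/funext => x; rewrite -kern2N opprB.
    by apply: measurable_funN; exact: measurable_sub_kernel measurable_kern2.
  have mF : measurable_fun [set: plane] F.
    by apply: measurable_funM => //; apply: measurable_funB; apply: measurable_funM => //; exact: measurable_funM.
  have mF' : measurable_fun [set: plane] F'.
    apply: measurable_funM => //; apply: measurable_funB; apply: measurable_funM; try exact: measurable_funM.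
    - exact: continuous_measurable2 k1.
    - exact: continuous_measurable2 k2.
  have Is : area.-integrable setT (EFin \o (fun x => sing eta (x - y))).
    by have := integrable_sing eta y; congr (_.-integrable _ _); apply/funext => x /=; rewrite /sing enormBC.
  have IK := integrable_vorticity W.
  have Ib : area.-integrable setT (EFin \o (fun x => 2 * M * (eta * \1_K x + sing eta (x - y)))).
    by apply: integrable_funZ; apply: integrable_funD => //; exact: integrable_funZ.
  have [Ii _] := Rintegral_inv_le y W ltr01.
  have IF : area.-integrable setT (EFin \o F).
    apply: (@integrable_dominated _ plane R area _ _ mF (integrable_funZ (2 * M) Ii)) => x.
    rewrite /F normrM [leRHS]mulrA ler_wpM2r// (le_trans (ler_normB _ _))// (enormBC y).
    rewrite -[leRHS]mulrA mulr_natl mulr2n; have [h1 h2] := qM x.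
    by apply: lerD; rewrite normrM; apply: ler_pM => //; [exact: normr_kern1_le|exact: normr_kern2_le].
  have FF' x : `|F x - F' x| <= 2 * M * (eta * \1_K x + sing eta (x - y)).
    have [h1 h2] := qM x; have [d1 d2] := regkern_close (x - y) eta0.
    have -> : F x - F' x = (q x * p1 x * (regkern2 (eta ^+ 2) (x - y) - kern2 (x - y)) -
       q x * p2 x * (regkern1 (eta ^+ 2) (x - y) - kern1 (x - y))) * \1_K x by rewrite /F /F'; ring.
    have B : `|q x * p1 x * (regkern2 (eta ^+ 2) (x - y) - kern2 (x - y)) -
       q x * p2 x * (regkern1 (eta ^+ 2) (x - y) - kern1 (x - y))| <= 2 * M * (eta + sing eta (x - y)).
      rewrite (le_trans (ler_normB _ _))// -[leRHS]mulrA mulr_natl mulr2n.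
      by apply: lerD; rewrite normrM; apply: ler_pM.
    have s0 := sing_ge0 eta (x - y).
    rewrite normrM indicE; case: (x \in K); rewrite ?normr1 ?normr0 ?mulr1 ?mulr0 ?add0r//.
    by rewrite !mulr_ge0.
  have IF' : area.-integrable setT (EFin \o F').
    apply: (@integrable_dominated _ plane R area _ _ mF' (integrable_funD (integrable_norm IF) Ib)) => x /=.
    rewrite -[F' x](subKr (F x)) (le_trans (ler_normB _ _))//.
    by rewrite lerD2l.
  rewrite J'E /J -RintegralB//.
  apply: (le_trans (normr_Rintegral_le (integrable_funB IF IF') Ib FF')).
  rewrite RintegralZl//; last by apply: integrable_funD => //; exact: integrable_funZ.
  rewrite RintegralD//; last exact: integrable_funZ.
  rewrite RintegralZl//.
  have K32 : \int[area]_x \1_K x <= 32 :> R.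
    have := L1norm_le (ler0n R 2) W; rewrite /L1norm.
    under eq_Rintegral => x _ do rewrite ger0_norm//.
    by rewrite (_ : 8 * 2 ^+ 2 = 32 :> R)//; ring.
  have S8 : \int[area]_x sing eta (x - y) <= 8 * eta.
    rewrite (_ : (fun x => sing eta (x - y)) = (fun x => sing eta (y - x))).
      exact: Rintegral_sing_le (ltW eta0).
    by apply/funext => x; rewrite /sing enormBC.
  rewrite (_ : 80 * M * eta = 2 * M * (eta * 32 + 8 * eta)); last by ring.
  rewrite ler_wpM2l ?mulr_ge0// lerD// ler_wpM2l// ltW//.
apply/eqP; rewrite -normr_eq0 eq_le normr_ge0 andbT; apply/ler_addgt0Pr => e e0; rewrite add0r.
have M81 : 0 < 80 * M + 1 by rewrite ltr_wpDl// mulr_ge0.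
have := bound (e / (80 * M + 1)) ltac:(by rewrite divr_gt0).
move=> h; apply: (le_trans h).
by rewrite mulrA ler_pdivrMr// mulrC ler_wpM2l ?(ltW e0)// lerDl.
Qed.

Variables (Omega a k kappa c : R) (K : set (R * R)).
Hypothesis SP : stable_patch Omega a k kappa c K.
Let p1 := rel1 Omega (\1_K).
Let p2 := rel2 Omega (\1_K).
Let l := level (relative_stream Omega (\1_K)) a kappa c.

Lemma patch_vorticity : bounded_vorticity 2 (\1_K).
Proof.
have [[a0 a1 _ _] mK] := (patch_parameters SP, patch_measurable SP).
by apply: bounded_vorticity_indic => // x x2; apply: (patch_out SP); lra.
Qed.

Lemma patch_test : C1_compact (spline \o l) (fun x => spline' (l x) * (p1 x / kappa))
  (fun x => spline' (l x) * (p2 x / kappa)).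
Proof.
have [a0 a1 k0 kappa0] := patch_parameters SP.
have W := patch_vorticity; have [c1 c2] := rel_continuous Omega W.
exact: (spline_level_C1 (fun x => relative_stream_grad Omega x W) c1 c2 a0 a1 kappa0 (patch_high SP) (patch_low SP)).
Qed.

Lemma patch_weight : C1_compact (spline' \o l) (fun x => spline'' (l x) * (p1 x / kappa))
  (fun x => spline'' (l x) * (p2 x / kappa)).
Proof.
have [a0 a1 k0 kappa0] := patch_parameters SP.
have W := patch_vorticity; have [c1 c2] := rel_continuous Omega W.
exact: (spline'_level_C1 (fun x => relative_stream_grad Omega x W) c1 c2 a0 a1 kappa0 (patch_high SP) (patch_low SP)).
Qed.

Lemma patch_weight_out x : 2 <= enorm x -> spline' (l x) = 0.
Proof.
have [a0 a1 _ _] := patch_parameters SP => x2.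
have -> : l x = - 3 by apply: level_out => //; lra.
by rewrite (spline_flat _).1// normrN gtr0_norm.
Qed.

Lemma patch_field_bounded : exists2 M : R, 0 <= M & forall x, enorm x <= 3 -> `|p1 x| <= M /\ `|p2 x| <= M.
Proof.
have W := patch_vorticity.
pose L := L1norm (\1_K : R * R -> R) / 1 + 8 * 1.
have L0 : 0 <= L by rewrite /L divr1 mulr1 addr_ge0// L1norm_ge0.
have [q0 q4] := @inv_2pi_bounds R.
exists (L + `|Omega| * 3) => [|x x3]; first by rewrite addr_ge0// mulr_ge0.
have [B1 B2] := biot_savart_le x W ltr01.
have E (u v : R) : `|u| <= L -> `|v| <= enorm x -> `|- (2 * pi)^-1 * u + Omega * v| <= L + `|Omega| * 3.
  move=> uL vx; rewrite (le_trans (ler_normD _ _))// !normrM normrN lerD//.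
    rewrite (ger0_norm q0) -[leRHS]mul1r ler_pM//; lra.
  by rewrite ler_wpM2l// (le_trans vx).
by split; apply: E; [|exact: ler_enorm1| |exact: ler_enorm2].
Qed.

Lemma modulus_ge1 (t : R) : 0 < t -> 1 <= 1 + ln (1 + 10 / t).
Proof.
by move=> t0; rewrite lerDl ln_ge0// lerDl; apply: divr_ge0 => //; exact: ltW.
Qed.

(** The log-Lipschitz bound on the velocity holds on bounded sets only; if one of the
points is far away, its weight vanishes and so does that of the other one,
unless the points are at distance at least 1. *)
Lemma weighted_field_modulus : exists2 C : R, 0 <= C & forall x y, x != y ->
  `|spline' (l x) * p1 x - spline' (l y) * p1 y| <= C * enorm (x - y) * (1 + ln (1 + 10 / enorm (x - y))) /\
  `|spline' (l x) * p2 x - spline' (l y) * p2 y| <= C * enorm (x - y) * (1 + ln (1 + 10 / enorm (x - y))).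
Proof.
have W := patch_vorticity; have [M M0 HM] := patch_field_bounded.
have [N N0 Lq] := C1_lipschitz patch_weight.
have q6 x : `|spline' (l x)| <= 6.
  by have [_ /andP[h1 h2] _ _ _] := spline_bounds (l x); rewrite ger0_norm.
have [i0 i4] := @inv_2pi_bounds R.
pose C := 6 * (32 + `|Omega|) + M * N + 6 * M.
have C0 : 0 <= C by rewrite /C !addr_ge0// !mulr_ge0// addr_ge0.
exists C => // x y xy.
have z0 : 0 < enorm (x - y) by rewrite enorm_gt0 subr_eq0.
have m1 := modulus_ge1 z0.
have ln0 : 0 <= ln (1 + 10 / enorm (x - y)) by lra.
have zm : enorm (x - y) <= enorm (x - y) * (1 + ln (1 + 10 / enorm (x - y))) by rewrite ler_pMr.
set z := enorm (x - y) in z0 ln0 zm Lq *; set m := 1 + ln _ in m1 zm *.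
have zm0 : 0 <= z * m by rewrite mulr_ge0//; lra.
have inner (p : R * R -> R) : enorm x <= 3 -> enorm y <= 3 -> `|p x - p y| <= (32 + `|Omega|) * (z * m) ->
    (forall u, enorm u <= 3 -> `|p u| <= M) ->
    `|spline' (l x) * p x - spline' (l y) * p y| <= C * z * m.
  move=> x3 y3 Hp Mp.
  have -> : spline' (l x) * p x - spline' (l y) * p y =
    spline' (l x) * (p x - p y) + p y * (spline' (l x) - spline' (l y)) by ring.
  rewrite (le_trans (ler_normD _ _))// !normrM.
  have A1 : `|spline' (l x)| * `|p x - p y| <= 6 * ((32 + `|Omega|) * (z * m)) by exact: ler_pM.
  have A2 : `|p y| * `|spline' (l x) - spline' (l y)| <= M * (N * (z * m)).
    apply: ler_pM => //; first exact: Mp.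
    by rewrite (le_trans (Lq x y))// ler_wpM2l// mulr_ge0.
  have : 0 <= 6 * M * (z * m) by rewrite mulr_ge0// mulr_ge0.
  rewrite /C -(mulrA _ z m) !mulrDl; move: (z * m) A1 A2 => t; lra.
have outer (p : R * R -> R) (u v : R * R) : 3 < enorm u -> z = enorm (u - v) ->
    (forall u, enorm u <= 3 -> `|p u| <= M) ->
    `|spline' (l u) * p u - spline' (l v) * p v| <= C * z * m.
  move=> u3 zE Mp; rewrite (patch_weight_out (x := u)) ?mul0r ?sub0r ?normrN; last lra.
  have [v2|v2] := leP 2 (enorm v).
    by rewrite patch_weight_out// mul0r normr0 -mulrA mulr_ge0.
  have z1 : 1 <= z.
    have := ler_enormD (u - v) v; rewrite subrK -zE; lra.
  rewrite normrM; apply: (@le_trans _ _ (6 * M)).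
    by apply: ler_pM => //; apply: Mp; lra.
  have h1 : 6 * M <= C by rewrite /C lerDr addr_ge0// !mulr_ge0// addr_ge0.
  apply: (le_trans h1); rewrite -mulrA ler_peMr//; nra.
have both (p : R * R -> R) : (enorm x <= 3 -> enorm y <= 3 -> `|p x - p y| <= (32 + `|Omega|) * (z * m)) ->
    (forall u, enorm u <= 3 -> `|p u| <= M) ->
    `|spline' (l x) * p x - spline' (l y) * p y| <= C * z * m.
  move=> Hp Mp; have [x3|x3] := leP (enorm x) 3; last exact: outer.
  have [y3|y3] := leP (enorm y) 3; first by apply: inner => //; exact: Hp.
  by rewrite distrC; apply: outer => //; rewrite /z enormBC.
have diff (b : R * R -> R) (u v : R) : `|b x - b y| <= z * (32 * ln (1 + 2 * 5 / z)) -> `|u - v| <= z ->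
    `|(- (2 * pi)^-1 * b x + Omega * u) - (- (2 * pi)^-1 * b y + Omega * v)| <= (32 + `|Omega|) * (z * m).
  move=> hb huv.
  have -> : (- (2 * pi)^-1 * b x + Omega * u) - (- (2 * pi)^-1 * b y + Omega * v) =
    - (2 * pi)^-1 * (b x - b y) + Omega * (u - v) by ring.
  rewrite (le_trans (ler_normD _ _))// !normrM normrN (ger0_norm i0) [leRHS]mulrDl lerD//.
    apply: (@le_trans _ _ (1 * (z * (32 * ln (1 + 2 * 5 / z))))).
      by apply: ler_pM => //; lra.
    rewrite mul1r mulrCA ler_wpM2l// ler_wpM2l ?(ltW z0)// /m (_ : 2 * 5 = 10 :> R); last by ring.
    by rewrite lerDr.
  by rewrite ler_wpM2l// (le_trans huv).
have BL : enorm x <= 3 -> enorm y <= 3 -> `|biot_savart1 (\1_K) x - biot_savart1 (\1_K) y| <= z * (32 * ln (1 + 2 * 5 / z)) /\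
   `|biot_savart2 (\1_K) x - biot_savart2 (\1_K) y| <= z * (32 * ln (1 + 2 * 5 / z)).
  by move=> x3 y3; apply: (biot_savart_loglip W) => //; lra.
split; apply: both.
- by move=> x3 y3; have [h _] := BL x3 y3; apply: diff => //; exact: (ler_enorm1 (x - y)).
- by move=> u /HM[].
- by move=> x3 y3; have [_ h] := BL x3 y3; apply: diff => //; exact: (ler_enorm2 (x - y)).
- by move=> u /HM[].
Qed.

End quadratic_estimate.

(** * The defect evolves quadratically *)

Section patch_quadratic.
Context {R : realType}.
Local Notation plane := (measurableTypeR R * measurableTypeR R)%type.
Implicit Types (x y z : R * R) (w f : R * R -> R).
Variables (Omega a k kappa c : R) (K : set (R * R)).
Hypothesis SP : stable_patch Omega a k kappa c K.
Let p1 := rel1 Omega (\1_K).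
Let p2 := rel2 Omega (\1_K).
Let l := level (relative_stream Omega (\1_K)) a kappa c.
Let WK := patch_vorticity SP.

(** At distances below [eta], the excess [ln (eta / z)] of the logarithm is at most
[eta / z]. *)
Lemma modulus_split (C z eta : R) : 0 <= C -> 0 < z -> 0 < eta ->
  C * (1 + ln (1 + 10 / z)) <=
  C * (1 + ln (1 + 10 / eta) + eta * (if z <= eta then z^-1 else 0)).
Proof.
move=> C0 z0 eta0; apply: ler_wpM2l => //; rewrite -addrA lerD2l.
have p (t : R) : 0 < t -> 0 < 1 + 10 / t by move=> t0; rewrite addr_gt0// divr_gt0.
have [ze|ze] := leP z eta.
  have h : 1 + 10 / z <= (1 + 10 / eta) * (eta / z).
    rewrite (_ : (1 + 10 / eta) * (eta / z) = eta / z + 10 / z); last by field; rewrite !gt_eqF.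
    by rewrite lerD2r ler_pdivlMr// mul1r.
  apply: (@le_trans _ _ (ln ((1 + 10 / eta) * (eta / z)))).
    rewrite ler_ln ?posrE //; [exact: p|apply: mulr_gt0; [exact: p|exact: divr_gt0]].
  rewrite lnM ?posrE ?p ?divr_gt0// lerD2l.
  have := @ln_sublinear R (eta / z); rewrite divr_gt0// => /(_ isT)/ltW; done.
rewrite mulr0 addr0 ler_ln ?posrE ?p// lerD2l ler_wpM2l// lef_pV2 ?posrE//; exact: ltW.
Qed.

Let Th1 x := spline' (l x) * p1 x.
Let Th2 x := spline' (l x) * p2 x.

Lemma weighted_field_continuous : continuous Th1 /\ continuous Th2.
Proof.
have [c1 c2] := rel_continuous Omega WK.
have cq := continuous_has_grad (C1_grad (patch_weight SP)).
by split=> x; apply: cvgM; [exact: cq|exact: c1|exact: cq|exact: c2].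
Qed.

Lemma weighted_field_bounded :
  exists2 M : R, 0 <= M & forall x, `|Th1 x| <= M /\ `|Th2 x| <= M.
Proof.
have [t1 t2] := weighted_field_continuous.
have [M1 H1] := continuous_bounded_support (r := 2) t1 ltac:(by move=> x x2; rewrite /Th1 (patch_weight_out SP x2) mul0r).
have [M2 H2] := continuous_bounded_support (r := 2) t2 ltac:(by move=> x x2; rewrite /Th2 (patch_weight_out SP x2) mul0r).
exists (Num.max M1 M2); first by rewrite le_max (le_trans _ (H1 0)).
by move=> x; rewrite !le_max H1 H2 orbT.
Qed.

Let G (xy : (R * R) * (R * R)) : R :=
  Th2 xy.1 * kern1 (xy.1 - xy.2) - Th1 xy.1 * kern2 (xy.1 - xy.2).

Lemma measurable_patch_kernel : measurable_fun [set: (plane * plane)%type] G.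
Proof.
have [t1 t2] := weighted_field_continuous.
apply: measurable_funB; apply: measurable_funM.
- exact: (measurableT_comp (continuous_measurable2 t2)).
- exact: measurable_difference measurable_kern1.
- exact: (measurableT_comp (continuous_measurable2 t1)).
- exact: measurable_difference measurable_kern2.
Qed.

Lemma patch_kernel_bound : exists2 M : R, 0 <= M & forall x y, `|G (x, y)| <= M * (enorm (x - y))^-1.
Proof.
have [M M0 HM] := weighted_field_bounded.
exists (M + M); first exact: addr_ge0.
move=> x y; rewrite /G /= (le_trans (ler_normB _ _))// mulrDl; have [h1 h2] := HM x.
apply: lerD; rewrite normrM ler_pM//.
- exact: normr_kern1_le.
- exact: normr_kern2_le.
Qed.

(** Stationarity of the patch, tested with the logarithmic kernel of pole [y]
weighted by [spline' (l x)]. *)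
Lemma patch_kernel_cancel y : \int[area]_x (G (x, y) * \1_K x) = 0.
Proof.
have [a0 a1 k0 kappa0] := patch_parameters SP.
have [c1 c2] := rel_continuous Omega WK.
have C : C1_compact (spline' \o l) (fun x => (spline'' (l x) / kappa) * p1 x) (fun x => (spline'' (l x) / kappa) * p2 x).
  have := patch_weight SP; by congr C1_compact; apply/funext => x; rewrite mulrA mulrAC.
have rho0 : 0 < 1 - a / 2 by lra.
apply: (stationary_kernel y (patch_measurable SP) WK c1 c2 (patch_stationary SP) rho0 C) => x xr.
have l3 : l x = 3 by apply: level_in; exact: ltW.
by rewrite /= l3 !(spline_flat _).1 ?(spline_flat _).2 ?mul0r// gtr0_norm.
Qed.

Lemma deviation_vorticity r w : bounded_vorticity r w -> (forall x, 0 <= w x) ->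
  bounded_vorticity (`|r| + 2) (fun x => w x - \1_K x).
Proof.
move=> [mw w1 wr] w0; have [mK _ Kr] := WK; split; first exact: measurable_funB.
- move=> x; have := w0 x; have := w1 x; rewrite ler_norml indicE => /andP[_].
  by case: (x \in K); rewrite /= ler_norml => *; apply/andP; split; lra.
- move=> x rx; have := ler_norm r; have := normr_ge0 r => h1 h2.
  by rewrite wr ?Kr ?subrr//; lra.
Qed.

(** Write [w = \1_K + rho]. The velocity relative to the frame that is generated by
[\1_K] is tangent to the level lines of the test function, so only the velocity
generated by [rho] contributes. Its integral against [\1_K] vanishes by
[patch_kernel_cancel], and the integral against [rho] is a quadratic form with
kernel [G]. The symmetric part of [G] is a difference of two values of the
weighted field times an inverse distance, so by [weighted_field_modulus] its
singularity is only logarithmic. *)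
Lemma quadratic_estimate : exists2 C : R, 0 < C & forall w r (eta : R),
  bounded_vorticity r w -> (forall x, 0 <= w x) -> 0 < eta ->
  `|\int[area]_x (w x * advection Omega (fun x => spline' (l x) * (p1 x / kappa))
       (fun x => spline' (l x) * (p2 x / kappa)) w x)| <=
  C * (L1norm (fun x => w x - \1_K x) ^+ 2 * (1 + ln (1 + 10 / eta)) +
       8 * eta ^+ 2 * L1norm (fun x => w x - \1_K x)).
Proof.
have [a0 a1 k0 kappa0] := patch_parameters SP.
have [M M0 GM] := patch_kernel_bound.
have mG := measurable_patch_kernel.
have [C C0 HC] := weighted_field_modulus SP.
have [i0 i4] := @inv_2pi_bounds R.
pose d := (2 * pi)^-1 / kappa.
have d0 : 0 <= d by rewrite divr_ge0// ltW.
exists (d * C + 1); first by rewrite ltr_wpDl// mulr_ge0.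
move=> w r eta W w0 eta0; have [mw w1 _] := W.
pose rho x := w x - \1_K x.
have Wr : bounded_vorticity (`|r| + 2) rho := deviation_vorticity W w0.
set N := L1norm _; have N0 : 0 <= N := L1norm_ge0 _.
have [t1 t2] := weighted_field_continuous.
have [b1 b2] := biot_savart_continuous Wr.
pose A x := Th2 x * biot_savart1 rho x - Th1 x * biot_savart2 rho x.
have cA : continuous A.
  by move=> x; apply: cvgB; apply: cvgM; [exact: t2|exact: b1|exact: t1|exact: b2].
have oA x : 2 <= enorm x -> A x = 0.
  by move=> x2; rewrite /A /Th1 /Th2 (patch_weight_out SP x2) !mul0r subrr.
have [MA HA] := continuous_bounded_support cA oA.
have mA := continuous_measurable2 cA.
have IA (f : R * R -> R) : measurable_fun [set: plane] f -> (forall x, `|f x| <= 1) ->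
    area.-integrable setT (EFin \o (fun x => f x * A x)).
  move=> mf f1; apply: (integrable_bounded_support (M := MA) (r := 2)).
  - exact: measurable_funM.
  - by move=> x; rewrite normrM -[leRHS]mul1r ler_pM.
  - by move=> x /oA ->; rewrite mulr0.
have AE x : A x = \int[area]_y (G (x, y) * rho y).
  have J1 := integrable_kern1 x Wr; have J2 := integrable_kern2 x Wr.
  rewrite /A /biot_savart1 /biot_savart2 -!RintegralZl// -RintegralB//; last 2 first.
  - exact: integrable_funZ.
  - exact: integrable_funZ.
  by apply: eq_Rintegral => y _; rewrite /G /=; ring.
have [mK K1 _] := WK; have [mr r1 _] := Wr.
have advE x : advection Omega (fun x => spline' (l x) * (p1 x / kappa))
       (fun x => spline' (l x) * (p2 x / kappa)) w x = d * A x.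
  have [E1 E2] := biot_savartB x W WK.
  rewrite /advection /A /Th1 /Th2 -/rho in E1 E2 *; rewrite -E1 -E2 /d /p1 /p2 /rel1 /rel2; ring.
have -> : \int[area]_x (w x * advection Omega (fun x => spline' (l x) * (p1 x / kappa))
       (fun x => spline' (l x) * (p2 x / kappa)) w x) = d * \int[area]_x (rho x * A x).
  have -> : \int[area]_x (rho x * A x) = \int[area]_x (w x * A x).
    have Z : \int[area]_x (\1_K x * A x) = 0.
      under eq_Rintegral do rewrite AE.
      rewrite (double_integral_swap M0 WK Wr mG GM).
      under eq_Rintegral do rewrite patch_kernel_cancel mulr0.
      by rewrite /Rintegral integral0.
    rewrite -[RHS]subr0 -Z -RintegralB//; [|exact: IA|exact: IA].
    by apply: eq_Rintegral => x _; rewrite /rho mulrBl.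
  rewrite -RintegralZl//; last exact: IA.
  by apply: eq_Rintegral => x _; rewrite advE mulrCA.
pose S x y := G (x, y) + G (y, x).
have IG x : area.-integrable setT (EFin \o (fun y => G (x, y) * rho y)).
  have [I _] := Rintegral_inv_le x Wr ltr01.
  apply: (@integrable_dominated _ plane R area _ (fun y => M * ((enorm (x - y))^-1 * `|rho y|))).
  - apply: measurable_funM => //; exact: (measurableT_comp mG (pair1_measurable x)).
  - exact: integrable_funZ.
  - by move=> y; rewrite normrM mulrA ler_wpM2r.
have IG' y : area.-integrable setT (EFin \o (fun x => G (x, y) * rho x)).
  have [I _] := Rintegral_inv_le y Wr ltr01.
  apply: (@integrable_dominated _ plane R area _ (fun x => M * ((enorm (y - x))^-1 * `|rho x|))).
  - apply: measurable_funM => //; exact: (measurableT_comp mG (pair2_measurable y)).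
  - exact: integrable_funZ.
  - by move=> x; rewrite normrM mulrA ler_wpM2r// enormBC.
pose ell := 1 + ln (1 + 10 / eta).
have ell0 : 0 <= ell by rewrite /ell; have := modulus_ge1 eta0; lra.
have SB x : `|\int[area]_y (S x y * rho y)| <= 2 * C * (ell * N + 8 * eta ^+ 2).
  have Is := integrable_sing eta x.
  have Irho := integrable_norm (integrable_vorticity Wr).
  have Ib : area.-integrable setT (EFin \o (fun y => 2 * C * (ell * `|rho y| + eta * sing eta (x - y)))).
    by apply: integrable_funZ; apply: integrable_funD; exact: integrable_funZ.
  have IS : area.-integrable setT (EFin \o (fun y => S x y * rho y)).
    have := integrable_funD (IG x) (IG' x); congr (_.-integrable _ _).
    by apply/funext => y; rewrite /S /comp [in RHS]mulrDl.
  apply: (@le_trans _ _ (\int[area]_y (2 * C * (ell * `|rho y| + eta * sing eta (x - y))))).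
    apply: normr_Rintegral_le_ae => //.
      move=> y; rewrite mulr_ge0 ?mulr_ge0// addr_ge0// mulr_ge0 ?sing_ge0//; exact: ltW.
    apply: ae_imp (ae_neq x) => y yx; have xy : x != y by rewrite eq_sym.
    have z0 : 0 < enorm (x - y) by rewrite enorm_gt0 subr_eq0.
    have [D1 D2] := HC x y xy.
    have SE : S x y = kern1 (x - y) * (Th2 x - Th2 y) - kern2 (x - y) * (Th1 x - Th1 y).
      by rewrite /S /G /= -(opprB x y) kern1N kern2N; ring.
    have cancelz (t : R) : (enorm (x - y))^-1 * (C * enorm (x - y) * t) = C * t.
      by field; rewrite gt_eqF.
    have SL : `|S x y| <= 2 * C * (1 + ln (1 + 10 / enorm (x - y))).
      have B (kk D : R) : `|kk| <= (enorm (x - y))^-1 ->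
          `|D| <= C * enorm (x - y) * (1 + ln (1 + 10 / enorm (x - y))) ->
          `|kk * D| <= C * (1 + ln (1 + 10 / enorm (x - y))).
        move=> h1 h2; rewrite normrM; have := ler_pM (normr_ge0 _) (normr_ge0 _) h1 h2.
        by rewrite cancelz.
      rewrite SE (le_trans (ler_normB _ _))// -[leRHS]mulrA mulr_natl mulr2n.
      by apply: lerD; apply: B => //; [exact: normr_kern1_le|exact: normr_kern2_le].
    have C20 : 0 <= 2 * C by rewrite mulr_ge0.
    have := modulus_split C20 z0 eta0; rewrite -/(sing eta (x - y)) -/ell => h.
    rewrite normrM; apply: (@le_trans _ _ (2 * C * (ell + eta * sing eta (x - y)) * `|rho y|)).
      by rewrite ler_wpM2r// (le_trans SL).
    rewrite -mulrA ler_wpM2l// mulrDl lerD2l ler_piMr// mulr_ge0 ?sing_ge0//; exact: ltW.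
  rewrite RintegralZl//; last by apply: integrable_funD; exact: integrable_funZ.
  rewrite RintegralD//; [|exact: integrable_funZ|exact: integrable_funZ].
  rewrite RintegralZl// RintegralZl// ler_wpM2l ?mulr_ge0// lerD2l (_ : 8 * eta ^+ 2 = eta * (8 * eta)); last by ring.
  by rewrite ler_wpM2l ?(ltW eta0)//; exact: Rintegral_sing_le (ltW eta0).
pose A' x := \int[area]_y (G (y, x) * rho y).
have [B B0 HB] := weighted_field_bounded.
(* A' is a combination of the velocities of two densities, hence continuous *)
have B1 : 0 < B + 1 by rewrite ltr_wpDl.
have scaled (Th : R * R -> R) : continuous Th -> (forall x, `|Th x| <= B) ->
    bounded_vorticity (`|r| + 2) (fun x => (B + 1)^-1 * (Th x * rho x)).
  move=> ct hB; have [_ _ rr] := Wr; split.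
  - by do 2 apply: measurable_funM => //; exact: continuous_measurable2.
  - move=> x; rewrite normrM gtr0_norm ?invr_gt0// mulrC ler_pdivrMr// normrM.
    by rewrite mulrC; apply: ler_pM => //; rewrite (le_trans (hB x))// lerDl.
  - by move=> x /rr ->; rewrite !mulr0.
have V1 := scaled _ t1 (fun x => (HB x).1); have V2 := scaled _ t2 (fun x => (HB x).2).
set v1 := (fun x => _ * (Th1 x * rho x)) in V1; set v2 := (fun x => _ * (Th2 x * rho x)) in V2.
have A'E x : A' x = (B + 1) * biot_savart2 v1 x - (B + 1) * biot_savart1 v2 x.
  have J1 := integrable_kern1 x V2; have J2 := integrable_kern2 x V1.
  rewrite /A' /biot_savart1 /biot_savart2 -!RintegralZl// -RintegralB//; last 2 first.
  - exact: integrable_funZ.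
  - exact: integrable_funZ.
  apply: eq_Rintegral => y _; rewrite /G /v1 /v2 /= -(opprB x y) kern1N kern2N.
  by field; rewrite !gt_eqF.
have [d1 _] := biot_savart_continuous V2; have [_ d2] := biot_savart_continuous V1.
have mA' : measurable_fun [set: plane] A'.
  rewrite (_ : A' = fun x => (B + 1) * biot_savart2 v1 x - (B + 1) * biot_savart1 v2 x); last exact/funext.
  by apply: measurable_funB; apply: measurable_funM => //; exact: continuous_measurable2.
pose L1 := L1norm v1 / 1 + 8 * 1; pose L2 := L1norm v2 / 1 + 8 * 1.
have A'B x : `|A' x| <= (B + 1) * L1 + (B + 1) * L2.
  have [_ h1] := biot_savart_le x V1 ltr01; have [h2 _] := biot_savart_le x V2 ltr01.
  rewrite A'E (le_trans (ler_normB _ _))// lerD// normrM gtr0_norm// ler_wpM2l// ltW//.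
have IA' : area.-integrable setT (EFin \o (fun x => rho x * A' x)).
  have [_ _ rr] := Wr.
  apply: (integrable_bounded_support (M := (B + 1) * L1 + (B + 1) * L2) (r := `|r| + 2)).
  - exact: measurable_funM.
  - by move=> x; rewrite normrM -[leRHS]mul1r ler_pM.
  - by move=> x /rr ->; rewrite mul0r.
have SE x : rho x * \int[area]_y (S x y * rho y) = rho x * A x + rho x * A' x.
  rewrite -mulrDr AE -RintegralD//; congr (_ * _).
  by apply: eq_Rintegral => y _; rewrite /S [LHS]mulrDl.
have IAr : area.-integrable setT (EFin \o (fun x => rho x * A x)) by exact: IA.
have X2 : 2 * \int[area]_x (rho x * A x) = \int[area]_x (rho x * \int[area]_y (S x y * rho y)).
  have E1 : \int[area]_x (rho x * A x) = \int[area]_x (rho x * A' x).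
    rewrite -(double_integral_swap M0 Wr Wr mG GM).
    by apply: eq_Rintegral => x _; rewrite AE.
  under [RHS]eq_Rintegral do rewrite SE.
  by rewrite RintegralD// -E1; ring.
have XB : `|\int[area]_x (rho x * \int[area]_y (S x y * rho y))| <= 2 * C * (ell * N + 8 * eta ^+ 2) * N.
  have Irho := integrable_norm (integrable_vorticity Wr).
  rewrite -[leRHS]RintegralZl//.
  apply: normr_Rintegral_le.
  - have := integrable_funD IAr IA'; congr (_.-integrable _ _).
    by apply/funext => x; rewrite /comp SE.
  - exact: (integrable_funZ (2 * C * (ell * N + 8 * eta ^+ 2)) Irho).
  - by move=> x /=; rewrite normrM mulrC ler_wpM2r.
rewrite normrM (ger0_norm d0).
have XX : `|\int[area]_x (rho x * A x)| <= C * (ell * N + 8 * eta ^+ 2) * N.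
  move: XB; rewrite -X2 normrM gtr0_norm// -!mulrA ler_pM2l//.
rewrite -/ell; apply: (@le_trans _ _ (d * (C * (ell * N + 8 * eta ^+ 2) * N))).
  by rewrite ler_wpM2l.
have T0 : 0 <= N ^+ 2 * ell + 8 * eta ^+ 2 * N.
  apply: addr_ge0; first exact: mulr_ge0 (sqr_ge0 _) ell0.
  by apply: mulr_ge0 => //; apply: mulr_ge0 => //; exact: sqr_ge0.
rewrite (_ : d * (C * (ell * N + 8 * eta ^+ 2) * N) = d * C * (N ^+ 2 * ell + 8 * eta ^+ 2 * N)); last by ring.
by rewrite ler_wpM2r// lerDl.
Qed.

End patch_quadratic.

(** * The defect controls the distance to the patch *)

Section bathtub.
Context {R : realType}.
Local Notation plane := (measurableTypeR R * measurableTypeR R)%type.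
Implicit Types (x y z : R * R) (w f : R * R -> R).
Variables (Omega a k kappa c : R) (K : set (R * R)).
Hypothesis SP : stable_patch Omega a k kappa c K.
Let l := level (relative_stream Omega (\1_K)) a kappa c.
Let WK := patch_vorticity SP.

Lemma level_sign x : (K x -> 0 <= l x) /\ (~ K x -> l x <= 0).
Proof.
have [a0 a1 k0 kappa0] := patch_parameters SP.
have [h|h] := leP (enorm x) (1 - a / 2).
  by rewrite /l level_in//; split=> // nK; case: nK; exact: (patch_in SP).
have [h'|h'] := leP (1 + a / 2) (enorm x).
  by rewrite /l level_out//; split=> // Kx; case: (patch_out SP h' Kx).
rewrite /l level_mid ?h//; have [s1 s2] := @patch_sign _ _ _ _ _ _ _ SP x ltac:(lra).
split=> [/s1|/s2] hx; first by rewrite divr_ge0 ?subr_ge0// ltW.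
by rewrite mulr_le0_ge0 ?subr_le0// invr_ge0 ltW.
Qed.

(** The weight changes sign exactly at the boundary of the patch, so the integrand
is nonnegative for [0 <= w <= 1] and vanishes only where [w] agrees with the
patch, up to the boundary. *)
Definition patch_defect w : R :=
  \int[area]_x ((\1_K x - w x) * (spline (l x) - 8)).

Lemma patch_defect_density w x : 0 <= w x <= 1 ->
  [/\ (\1_K x - w x) * (spline (l x) - 8) = `|w x - \1_K x| * `|spline (l x) - 8|,
      `|spline (l x) - 8| <= 8 &
      4 * Num.min `|l x| 1 <= `|spline (l x) - 8|].
Proof.
move=> /andP[w0 w1]; have [/andP[s0 s16] _ _ sp sn] := spline_bounds (l x).
have [l1 l2] := level_sign x.
have B8 : `|spline (l x) - 8| <= 8 by rewrite ler_norml; apply/andP; split; lra.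
have m0 : 0 <= 4 * Num.min `|l x| 1 by rewrite mulr_ge0// le_min normr_ge0 ler01.
rewrite indicE; case: (boolP (x \in K)) => [/set_mem/l1 l0|/negP nK] /=.
  have := sp l0; rewrite -{1}(ger0_norm l0) => h; split => //.
    by rewrite (distrC (w x)) (ger0_norm (_ : 0 <= 1 - w x)) ?subr_ge0// ger0_norm//; exact: le_trans h.
  by rewrite (le_trans h)// ler_norm.
have l0 : l x <= 0 by apply: l2 => Kx; apply: nK; exact/mem_set.
have := sn l0; rewrite -{1}(ler0_norm l0) => h; split => //.
  rewrite subr0 sub0r (ger0_norm w0) distrC (ger0_norm (_ : 0 <= 8 - spline (l x))); last exact: le_trans h.
  by rewrite mulNr -mulrN opprB.
by rewrite (le_trans h)// distrC ler_norm.
Qed.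

Lemma measurable_level_weight : measurable_fun [set: plane] (fun x : plane => spline (l x) - 8).
Proof.
apply: measurable_funB => //.
exact: continuous_measurable2 (continuous_has_grad (C1_grad (patch_test SP))).
Qed.

Lemma integrable_patch_defect r w : bounded_vorticity r w -> (forall x, 0 <= w x) ->
  area.-integrable setT (EFin \o (fun x => (\1_K x - w x) * (spline (l x) - 8))).
Proof.
move=> W w0; have Wr := deviation_vorticity SP W w0; have [mr r1 rr] := Wr.
have [mw w1 _] := W; have [mK _ _] := WK.
apply: (integrable_bounded_support (M := 8) (r := `|r| + 2)).
- apply: measurable_funM; first exact: measurable_funB.
  exact: measurable_level_weight.
- move=> x; have wx : 0 <= w x <= 1 by rewrite w0 -(ger0_norm (w0 x)) w1.
  have [_ B _] := patch_defect_density wx.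
  rewrite normrM distrC -[leRHS]mul1r ler_pM//; exact: r1.
- by move=> x /rr h; rewrite -[\1_K x - _]opprB h oppr0 mul0r.
Qed.

(** Outside of the band of the level variable of width [s], the density of the
defect is at least [4 * s] times that of the distance; the band has area at most
[A * s]. *)
Lemma patch_defect_bounds : exists2 A : R, 0 < A & forall r w,
  bounded_vorticity r w -> (forall x, 0 <= w x) ->
  [/\ 0 <= patch_defect w,
      patch_defect w <= 8 * L1norm (fun x => w x - \1_K x) &
      forall s : R, 0 < s <= 1 ->
        L1norm (fun x => w x - \1_K x) <= A * s + patch_defect w / (4 * s)].
Proof.
have [a0 a1 k0 kappa0] := patch_parameters SP.
have [c1 c2] := rel_continuous Omega WK.
have band s := @level_band_area R _ _ _ a k kappa c (fun x => relative_stream_grad Omega x WK) c1 c2 a0 a1 k0 kappa0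
  (patch_radial SP) (patch_high SP) (patch_low SP) s.
pose A := band_constant / 4 * kappa / k : R.
have A0 : 0 < A by rewrite /A divr_gt0// mulr_gt0// divr_gt0// band_constant_gt0.
exists A => // r w W w0; have [mw w1 _] := W.
have wx x : 0 <= w x <= 1 by rewrite w0 -(ger0_norm (w0 x)) w1.
have ID := integrable_patch_defect W w0.
have Wr := deviation_vorticity SP W w0.
have Irho := integrable_norm (integrable_vorticity Wr).
split.
- apply: Rintegral_ge0 => x _; have [-> _ _] := patch_defect_density (wx x).
  by rewrite mulr_ge0.
- rewrite /L1norm -RintegralZl//; apply: le_Rintegral => //.
    exact: (integrable_funZ 8 Irho).
  by move=> x _; have [-> B _] := patch_defect_density (wx x); rewrite mulrC ler_wpM2r.
move=> s s01; have /andP[s0 s1] := s01.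
pose B : set (R * R) := [set x | `|l x| <= s].
have mB : measurable (B : set plane).
  apply: measurable_normr_le; apply: measurable_level => x.
  exact: relative_stream_grad WK.
have WB : bounded_vorticity 2 (\1_B).
  apply: bounded_vorticity_indic => // x x2; rewrite /B /= /l level_out; [|exact: a0|lra].
  by rewrite normrN gtr0_norm// => h; lra.
have IB := integrable_norm (integrable_vorticity WB).
have s40 : 0 < 4 * s by rewrite mulr_gt0.
apply: (@le_trans _ _ (L1norm (\1_B) + patch_defect w / (4 * s))); last first.
  by rewrite lerD2r; exact: band.
rewrite (mulrC (patch_defect w)) /patch_defect -RintegralZl// -RintegralD//; last exact: integrable_funZ.
apply: le_Rintegral => //.
  by apply: integrable_funD; [exact: IB|exact: integrable_funZ].
move=> x _; have [DE D8 D4] := patch_defect_density (wx x); rewrite DE.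
have [_ r1 _] := Wr.
have [xB|xB] := leP `|l x| s.
  rewrite [\1_B x]indicE mem_set//= normr1 (le_trans (r1 x))// lerDl.
  by rewrite mulr_ge0 ?invr_ge0 ?(ltW s40)// mulr_ge0.
rewrite -[leLHS]add0r lerD// ler_pdivlMl// mulrC ler_wpM2l//.
by apply: le_trans D4; rewrite ler_wpM2l// le_min (ltW xB) s1.
Qed.

(** The defect is a combination of the mass and of the integral to which the weak
identity applies. *)
Lemma patch_defectE r w : bounded_vorticity r w -> (forall x, 0 <= w x) ->
  patch_defect w = \int[area]_x (\1_K x * spline (l x)) - 8 * \int[area]_x \1_K x
    - (\int[area]_x (w x * spline (l x)) - 8 * \int[area]_x w x).
Proof.
move=> W w0.
have IS (v : R * R -> R) (rv : R) : bounded_vorticity rv v -> area.-integrable setT (EFin \o (fun x => v x * spline (l x))).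
  move=> [mv v1 vr]; apply: (integrable_bounded_support (M := 16) (r := rv)).
  - apply: measurable_funM => //.
    exact: continuous_measurable2 (continuous_has_grad (C1_grad (patch_test SP))).
  - move=> x; have [/andP[s0 s16] _ _ _ _] := spline_bounds (l x).
    by rewrite normrM -[leRHS]mul1r ler_pM// ger0_norm.
  - by move=> x /vr ->; rewrite mul0r.
have I1 := IS _ _ WK; have I2 := IS _ _ W.
have J1 := integrable_vorticity WK; have J2 := integrable_vorticity W.
have Z1 := integrable_funZ 8 J1; have Z2 := integrable_funZ 8 J2.
rewrite -!RintegralZl// -!RintegralB//; last 2 first.
- exact: integrable_funB.
- exact: integrable_funB.
by apply: eq_Rintegral => x _; ring.
Qed.

End bathtub.

(** * Comparison with the solution of a differential equation *)

Section growth.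
Context {R : realType}.
Local Notation leb := (@lebesgue_measure R).

Lemma ge0_integral_dominated (D : set R) (f h : R -> \bar R) :
  (forall s, D s -> 0 <= f s)%E -> (forall s, D s -> f s <= h s)%E ->
  (\int[leb]_(s in D) f s <= \int[leb]_(s in D) h s)%E.
Proof.
move=> f0 fh.
have h0 s : D s -> (0 <= h s)%E by move=> Ds; exact: le_trans (f0 s Ds) (fh s Ds).
rewrite !ge0_integralE//; apply: le_ereal_sup => _ [g /= gf <-]; exists g => //= s.
apply: (le_trans (gf s)); rewrite !patchE; case: ifPn => // /set_mem; exact: fh.
Qed.

(** No measurability is required of [f]: the integral is a difference of two
suprema over simple functions, each monotone in its integrand. *)
Lemma normr_Rintegral_dominated (D : set R) (f h : R -> R) (H : R) :
  (forall s, D s -> `|f s| <= h s) -> (\int[leb]_(s in D) (h s)%:E <= H%:E)%E ->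
  `|\int[leb]_(s in D) f s| <= H.
Proof.
move=> fh hH.
have bp : (\int[leb]_(s in D) (EFin \o f)^\+ s <= H%:E)%E.
  apply: le_trans hH; apply: ge0_integral_dominated => s Ds //.
  rewrite funeposE/= ge_max !lee_fin (le_trans (ler_norm _) (fh s Ds))/=.
  exact: le_trans (normr_ge0 _) (fh s Ds).
have bn : (\int[leb]_(s in D) (EFin \o f)^\- s <= H%:E)%E.
  apply: le_trans hH; apply: ge0_integral_dominated => s Ds //.
  rewrite funenegE/= ge_max !lee_fin (le_trans (ler_norm _))/= ?normrN ?fh//.
  exact: le_trans (normr_ge0 _) (fh s Ds).
have p0 : (0 <= \int[leb]_(s in D) (EFin \o f)^\+ s)%E by apply: integral_ge0.
have n0 : (0 <= \int[leb]_(s in D) (EFin \o f)^\- s)%E by apply: integral_ge0.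
rewrite /Rintegral integralE; move: bp bn p0 n0.
move: (\int[leb]_(s in D) _)%E (\int[leb]_(s in D) _)%E => [p| |] [n| |] //=.
rewrite !lee_fin => h1 h2 h3 h4; rewrite ler_norml; apply/andP; split; lra.
Qed.

(** The bound [G] on the rate holds only while [F <= Y], and [F] is not known to be
continuous. The comparison is therefore continued by steps of length [sigma]:
on the last step the rough bound [Q] is used, and the growth [Q * sigma] that
it permits has been reserved in the initial value of [Y]. *)
Lemma growth_comparison (F I Y G : R -> R) (T F0 Q sigma : R) :
  0 <= Q -> 0 < sigma -> F0 + Q * sigma <= Y 0 ->
  (forall t, 0 <= t <= T -> F t = F0 - \int[leb]_(s in `[0, t]) I s) ->
  (forall s, 0 <= s <= T -> `|I s| <= Q) ->
  (forall s, 0 <= s <= T -> F s <= Y s -> `|I s| <= G s) ->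
  (forall s : R, is_derive s 1 Y (G s)) -> continuous G -> (forall s, 0 <= s <= T -> 0 <= G s) ->
  forall t, 0 <= t <= T -> F t <= Y t.
Proof.
move=> Q0 sg0 Y0 FE IQ IG dY cG G0.
suff step n t : 0 <= t <= T -> t <= n%:R * sigma -> F t <= Y t.
  move=> t tT; have := archi_boundP (_ : 0 <= t / sigma).
  case/andP: (tT) => t0 _; rewrite divr_ge0 ?(ltW sg0)// => /(_ isT).
  rewrite ltr_pdivrMr// => /ltW; exact: step.
elim: n t => [|n IH] t tT tn.
  have t0 : t = 0 by apply/eqP; rewrite eq_le; case/andP: tT => -> _; rewrite (le_trans tn)// mul0r.
  rewrite FE// t0 set_itv1 Rintegral_set1 subr0; apply: le_trans Y0.
  by rewrite lerDl mulr_ge0// ltW.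
have /andP[t0 t1] := tT.
have [tz|tnz] := eqVneq t 0.
  by apply: IH => //; rewrite tz mulr_ge0// ltW.
have tp : 0 < t by rewrite lt0r tnz.
pose h s : R := G s + Q * \1_(`]n%:R * sigma, n.+1%:R * sigma] : set R) s.
have hI s : `[0, t]%classic s -> `|I s| <= h s.
  rewrite /= in_itv/= => /andP[s0 st]; have sT : 0 <= s <= T by rewrite s0 (le_trans st).
  rewrite /h indicE; case: (boolP (s \in _)) => [_|/negP ns].
    by rewrite mulr1 (le_trans (IQ s sT))// lerDr G0.
  rewrite mulr0 addr0; apply: IG => //; apply: IH => //.
  rewrite leNgt; apply/negP => sn; apply: ns; apply/mem_set; rewrite /= in_itv/= sn /=.
  exact: le_trans tn.
have hH : (\int[leb]_(s in `[0%R, t]) (h s)%:E <= (Y t - Y 0 + Q * sigma)%:E)%E.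
  rewrite /h; under eq_integral do rewrite EFinD.
  rewrite ge0_integralD//=; last 4 first.
  - by move=> s /=; rewrite in_itv/= => /andP[s0 st]; rewrite lee_fin G0// s0 (le_trans st).
  - apply/measurable_EFinP; apply: measurable_funTS; exact: continuous_measurable_fun.
  - by move=> s _; rewrite lee_fin mulr_ge0.
  - by apply/measurable_EFinP; apply: measurable_funTS; apply: measurable_funM => //; exact: measurable_indic.
  rewrite EFinD leeD//.
    by rewrite (is_derive_FTC2 tp (continuous_subspaceT cG) (fun s _ => dY s)).
  under eq_integral do rewrite EFinM.
  rewrite ge0_integralZl//=; last first.
    by apply/measurable_EFinP; apply: measurable_funTS; exact: measurable_indic.
  rewrite EFinM; apply: lee_wpmul2l; first by rewrite lee_fin.
  rewrite integral_indic//.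
  apply: (@le_trans _ _ (leb (`]n%:R * sigma, n.+1%:R * sigma]%classic : set R))).
    by apply: le_measure; rewrite ?inE//; exact: measurableI.
  rewrite lebesgue_measure_itv/= lte_fin; case: ifPn => _; last by rewrite lee_fin ltW.
  by rewrite -EFinB lee_fin -mulrBl -natrB// subSnn mul1r.
rewrite FE//; have := normr_Rintegral_dominated hI hH.
rewrite ler_norml => /andP[h1 h2]; lra.
Qed.

End growth.

(** * Solutions seen from the rotating frame *)

Section weak_solutions.
Context {R : realType}.
Local Notation plane := (measurableTypeR R * measurableTypeR R)%type.
Implicit Types (x y z : R * R) (w f : R * R -> R).

Definition clamp (u : R) : R := Num.max 0 (Num.min u 1).

Lemma clamp_bounds u : 0 <= clamp u <= 1.
Proof. by rewrite /clamp le_max lexx ge_max ler01 ge_min lexx orbT. Qed.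

Lemma clamp_id u : 0 <= u <= 1 -> clamp u = u.
Proof. by move=> /andP[u0 u1]; rewrite /clamp min_l// max_r. Qed.

(** A modification on null sets makes the bounds and the support hold everywhere;
it does not change the velocity. *)
Lemma rotating_representative (A0 : set (R * R)) omega (Omega T : R) :
  yudovich_solution A0 omega -> exists r (w : R -> R * R -> R), forall s, 0 <= s <= T ->
    [/\ measurable_fun [set: plane] (omega s), bounded_vorticity r (w s),
        forall x, 0 <= w s x &
        {ae area, forall x, omega s x = rotating Omega (w s) s x}].
Proof.
move=> [[mo bo _] [Phi _ ophi]].
have [M [r Hr]] := bo T; exists r.
exists (fun s x => if enorm x < r then clamp (omega s (rotation (Omega * s) x)) else 0).
move=> s sT; have /andP[s0 s1] := sT.
have ms : measurable_fun [set: plane] (omega s).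
  have mp : measurable_fun [set: plane] (fun x : plane => (s, x) : measurableTypeR R * plane).
    exact: pair1_measurable.
  have m0 : measurable ([set z : R * (R * R) | 0 <= z.1] : set (measurableTypeR R * plane)).
    rewrite (_ : [set z : R * (R * R) | 0 <= z.1] = (`[0%R, +oo[ : set R) `*` setT).
      by apply: measurableX => //; exact: measurable_itv.
    by apply/seteqP; split => z /=; rewrite in_itv/= andbT => //; case.
  move=> _ Y mY; have := mp measurableT _ (mo m0 _ mY); rewrite !setTI.
  by congr (measurable _); apply/seteqP; split => x //= [].
split => //.
- split.
  + apply: measurable_fun_ifT => //.
      by apply: measurable_fun_ltr => //; exact: measurable_enorm.
    apply: measurable_maxr => //; apply: measurable_minr => //.
    exact: (measurableT_comp ms (area_preserving_rotation _).1).
  + move=> x; case: ifP => _; last by rewrite normr0.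
    by have /andP[h0 h1] := clamp_bounds (omega s (rotation (Omega * s) x)); rewrite ger0_norm.
  + by move=> x rx; rewrite ltNge rx.
- move=> x; case: ifP => _ //.
  by case/andP: (clamp_bounds (omega s (rotation (Omega * s) x))).
- apply: ae_imp (ae_and (Hr s sT) (ophi s s0)) => x [[_ far] ind].
  rewrite /rotating enorm_rotation rotationK.
  have [xr|xr] := ltP (enorm x) r; last exact: far.
  rewrite clamp_id// ind indicE; case: (_ \in _); rewrite /= ?lexx ?ler01//.
Qed.

Lemma cutoff_test (r : R) : exists chi g1 g2, C1_compact chi g1 g2 /\
  forall x, enorm x < r -> [/\ chi x = 16, g1 x = 0 & g2 x = 0].
Proof.
do 3 eexists; split; first exact: (spline_radial_C1 (r ^+ 2 + 3) ltr01).
move=> x xr /=; set N := _ + _ - _.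
have N3 : 3 <= N by rewrite /N; have := enorm_ge0 x; nra.
by have [_ _ _ _ /(_ N3)[-> -> _]] := spline_pieces N; rewrite !mul0r.
Qed.

(** Here the test function is constant on all the supports, so that nothing is
transported. *)
Lemma mass_conservation w0 omega (w : R -> R * R -> R) (Omega r T : R) :
  weak_solution w0 omega -> bounded_vorticity r w0 ->
  (forall s, 0 <= s <= T -> [/\ measurable_fun [set: plane] (omega s), bounded_vorticity r (w s) &
     {ae area, forall x, omega s x = rotating Omega (w s) s x}]) ->
  forall t, 0 <= t <= T -> \int[area]_x w t x = \int[area]_x w0 x.
Proof.
move=> sol W0 H t /andP[t0 tT].
have [chi [g1 [g2 [C flat]]]] := cutoff_test r.
have HT s : 0 <= s <= t -> 0 <= s <= T by move=> /andP[-> st]; exact: le_trans tT.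
have := @weak_identity R Omega chi g1 g2 C w0 omega w t sol t0
  (fun s st => let: And3 h _ _ := H s (HT s st) in h)
  (fun s st => let: And3 _ h _ := H s (HT s st) in ex_intro _ r h)
  (fun s st => let: And3 _ _ h := H s (HT s st) in h).
have mass v : bounded_vorticity r v -> \int[area]_x (v x * chi x) = 16 * \int[area]_x v x.
  move=> V; have [_ _ vr] := V; rewrite -RintegralZl//; last exact: integrable_vorticity V.
  apply: eq_Rintegral => x _; have [/flat[-> _ _]|/vr ->] := ltP (enorm x) r.
    by rewrite mulrC.
  by rewrite mul0r mulr0.
have [_ Wt _] := H t ltac:(by rewrite t0).
rewrite (mass _ Wt) (mass _ W0) => E.
suff : \int[lebesgue_measure]_(s in `[0, t]) \int[area]_x (w s x * advection Omega g1 g2 (w s) x) = 0.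
  by move: E => /[swap] ->; lra.
transitivity (\int[lebesgue_measure]_(s in `[0, t]) (0 : R)); last by rewrite /Rintegral integral0.
apply: eq_Rintegral => s; rewrite inE/= in_itv/= => st.
have [_ [_ _ ws] _] := H s (HT s st).
transitivity (\int[area]_x (0 : R)); last by rewrite /Rintegral integral0.
apply: eq_Rintegral => x _; have [/flat[_ h1 h2]|/ws ->] := ltP (enorm x) r; last by rewrite mul0r.
by rewrite /advection h1 h2 !mulr0 subrr mulr0.
Qed.

Lemma L1_dist_rotating omega (w : R * R -> R) (K : set (R * R)) (Omega r t : R) :
  measurable_fun [set: plane] omega -> bounded_vorticity r w -> bounded_vorticity r (\1_K) ->
  {ae area, forall x, omega x = rotating Omega w t x} ->
  L1_dist omega (rotated (Omega * t) (\1_K)) = (L1norm (fun x => w x - \1_K x))%:E.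
Proof.
move=> mo W WK E; have [mw _ _] := W; have [mK _ _] := WK.
have I := integrable_norm (integrable_funB (integrable_vorticity W) (integrable_vorticity WK)).
rewrite /L1_dist Lnorm1 /L1norm -(integral_EFin I).
have mI : measurable_fun [set: plane] (fun x : plane => `|w x - \1_K x|%:E).
  by case/integrableP : I.
rewrite -(area_preserving_ge0 (area_preserving_rotation (- (Omega * t))) mI); last by move=> x.
apply: ae_eq_integral => //.
- apply/measurable_EFinP; apply: measurableT_comp => //; apply: measurable_funB => //.
  exact: (measurableT_comp mK (area_preserving_rotation _).1).
- exact: (measurableT_comp mI (area_preserving_rotation _).1).
- by apply: ae_imp E => x ox _ /=; rewrite ox.
Qed.

(** The function [Y = expR lam] solves [Y' = C * Y * (b - ln Y / 4)], which is linear
in [lam]. Solutions exist for all times, so the value at time [T] can be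
prescribed: this is what makes a small final distance possible. *)
Lemma osgood_curve (C b T lamT : R) : 0 < C -> 0 < b -> 0 <= T -> lamT <= 0 ->
  exists lam : R -> R,
   [/\ forall t : R, is_derive t 1 (fun s : R => expR (lam s)) (C * expR (lam t) * (b - lam t / 4)),
       continuous (fun t => C * expR (lam t) * (b - lam t / 4)) &
       forall t, t <= T -> lam t <= lamT].
Proof.
move=> C0 b0 T0 lT0.
pose c0 := lamT - 4 * b.
have c00 : c0 < 0 by rewrite /c0; lra.
pose e t := expR (- (C / 4) * (t - T)).
pose lam t := 4 * b + c0 * e t.
have De (t : R) : is_derive t 1 e (e t * - (C / 4)).
  have d : is_derive t 1 (fun s : R => - (C / 4) * (s - T)) (- (C / 4)).
    have := is_deriveZ (- (C / 4)) (is_derive_addr (- T) t).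
    by rewrite /GRing.scale/= mulr1.
  exact: (@is_derive1_comp R expR (fun s => - (C / 4) * (s - T)) t _ _ (is_derive_expR _) d).
have Dl (t : R) : is_derive t 1 lam (C * (b - lam t / 4)).
  have := is_deriveD (is_derive_cst (4 * b) t 1) (is_deriveM (is_derive_cst c0 t 1) (De t)).
  rewrite /GRing.scale/= mulr0 addr0 add0r => H; apply: (is_derive_eq (H : is_derive t 1 lam _)).
  by rewrite /lam; field.
have cl : continuous lam.
  by move=> t; exact: is_derive_continuous1 (Dl t).
exists lam; split.
- move=> t.
  have := @is_derive1_comp R expR lam t _ _ (is_derive_expR _) (Dl t).
  by move=> H; apply: (is_derive_eq H); ring.
- move=> t; apply: cvgM.
    apply: cvgM; first exact: cvg_cst.
    by apply: continuous_comp; [exact: cl|exact: continuous_expR].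
  by apply: cvgB; [exact: cvg_cst|apply: cvgM; [exact: cl|exact: cvg_cst]].
- move=> t tT; rewrite /lam; have : 1 <= e t.
    by rewrite /e -(expR0 R) ler_expR mulNr -mulrN opprB mulr_ge0 ?subr_ge0// divr_ge0// ltW.
  by rewrite /c0; move: (e t) c00; rewrite /c0 => u; nra.
Qed.

End weak_solutions.

(** * Stability on finite time intervals *)

Section stability.
Context {R : realType}.
Local Notation plane := (measurableTypeR R * measurableTypeR R)%type.
Implicit Types (x y z : R * R) (w f : R * R -> R).

(** With [Y = expR lam], the defect is at most [Y] and the distance [N] at most of
order [sqrt Y]. The cut-off distance [Y ^ (1 / 4)] makes both terms of the
quadratic estimate of order [Y * (1 + ln (1 / Y))]. *)
Lemma osgood_rate (C A N lam I : R) : 0 < C -> 0 < A -> lam <= 0 -> 0 <= N ->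
  N <= (A + 1) * expR (lam / 2) ->
  `|I| <= C * (N ^+ 2 * (1 + ln (1 + 10 / expR (lam / 4))) + 8 * expR (lam / 4) ^+ 2 * N) ->
  `|I| <= C * (A + 1) ^+ 2 * expR lam * (9 + ln 11 - lam / 4).
Proof.
move=> C0 A0 l0 N0 NB IB; apply: (le_trans IB).
have e0 : 0 < expR (lam / 4) by exact: expR_gt0.
have e1 : expR (lam / 4) <= 1 by rewrite expR_le1 pmulr_lle0 ?invr_gt0.
have E2 : expR (lam / 4) ^+ 2 = expR (lam / 2) by rewrite -expRM_natl; congr expR; field.
have E1 : expR lam = expR (lam / 2) ^+ 2 by rewrite -expRM_natl; congr expR; field.
have L : ln (1 + 10 / expR (lam / 4)) <= ln 11 - lam / 4.
  rewrite -{2}[lam / 4]expRK -lnV ?posrE// -lnM ?posrE ?invr_gt0//.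
  have h : 1 + 10 / expR (lam / 4) <= 11 / expR (lam / 4).
    have : 1 <= (expR (lam / 4))^-1 by rewrite invf_ge1.
    by move: (_^-1) => u; lra.
  have p (u : R) : 0 < u -> 0 < 1 + 10 / u by move=> u0; rewrite addr_gt0// divr_gt0.
  have X1 := p _ e0; have X2 : 0 < 11 / expR (lam / 4) by exact: divr_gt0.
  by rewrite ler_ln ?posrE.
rewrite E1 E2 (_ : C * (A + 1) ^+ 2 * _ * _ =
  C * ((A + 1) ^+ 2 * (expR (lam / 2) ^+ 2 * (9 + (ln 11 - lam / 4))))); last by ring.
rewrite ler_pM2l//.
have y0 : 0 < expR (lam / 2) by exact: expR_gt0.
have L0 : 0 <= ln (1 + 10 / expR (lam / 4)) by rewrite ln_ge0// lerDl divr_ge0// ltW.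
move: (expR (lam / 2)) (ln (1 + 10 / _)) (ln 11 - lam / 4) y0 L L0 NB => y u v y0 uv u0 NB.
have By0 : 0 <= (A + 1) * y by rewrite mulr_ge0// ?(ltW y0)//; lra.
have N2 : N ^+ 2 <= ((A + 1) * y) ^+ 2 by rewrite lerXn2r ?nnegrE.
have h1 : N ^+ 2 * (1 + u) <= ((A + 1) * y) ^+ 2 * (1 + v).
  by apply: ler_pM; rewrite ?sqr_ge0//; lra.
have h2 : 8 * y * N <= 8 * y * ((A + 1) * y) by rewrite ler_wpM2l// mulr_ge0// ltW.
have h3 : (A + 1) * y ^+ 2 <= (A + 1) ^+ 2 * y ^+ 2.
  by rewrite ler_wpM2r ?sqr_ge0// expr2 ler_peMr; lra.
rewrite exprMn in h1.
rewrite (_ : (A + 1) ^+ 2 * (y ^+ 2 * (9 + v)) = (A + 1) ^+ 2 * y ^+ 2 * (1 + v) + 8 * ((A + 1) ^+ 2 * y ^+ 2)); last by ring.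
apply: lerD => //; apply: (le_trans h2).
rewrite (_ : 8 * y * ((A + 1) * y) = 8 * ((A + 1) * y ^+ 2)); last by ring.
by rewrite ler_wpM2l.
Qed.

(** By [quadratic_estimate] and [patch_defect_bounds], the defect [F] satisfies
[F' <= C * F * (1 + ln (1 / F))] as long as it is small. It therefore stays
below the solution [Y] of the corresponding equation that is small at time [T],
provided that it starts below [Y 0]; the distance is of order [sqrt F]. *)
Theorem patch_stability (Omega a k kappa c eps T : R) (K : set (R * R)) :
  stable_patch Omega a k kappa c K -> 0 < eps -> 0 < T ->
  exists2 delta : R, 0 < delta & forall A0 : set (R * R), open A0 -> A0 `<=` eball 2 ->
    (L1_dist \1_A0 (\1_K) <= delta%:E)%E ->
    forall omega, yudovich_solution A0 omega -> forall t, 0 <= t <= T ->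
    (L1_dist (omega t) (rotated (Omega * t) (\1_K)) <= eps%:E)%E.
Proof.
move=> SP eps0 T0; have WK := patch_vorticity SP.
have [C C0 HQ] := quadratic_estimate SP.
have [A A0 HD] := patch_defect_bounds SP.
have B0 : 0 < A + 1 by lra.
have eB0 : 0 < eps / (A + 1) by rewrite divr_gt0.
(* at the final time, (A + 1) * sqrt Y is at most eps *)
pose lamT := Num.min 0 (2 * ln (eps / (A + 1))).
have lT0 : lamT <= 0 by rewrite ge_min lexx.
have lT1 : lamT <= 2 * ln (eps / (A + 1)) by rewrite ge_min lexx orbT.
have b0 : 0 < 9 + ln 11 :> R by rewrite ltr_wpDr// ln_ge0// ler1n.
have Cg0 : 0 < C * (A + 1) ^+ 2 by rewrite mulr_gt0// exprn_gt0.
have [lam [dY cG laml]] := osgood_curve Cg0 b0 (ltW T0) lT0.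
pose Y t := expR (lam t).
have Y00 : 0 < Y 0 by exact: expR_gt0.
exists (Y 0 / 16); first by rewrite divr_gt0.
move=> D oD D2 dist omega sol.
have [r [w H]] := rotating_representative Omega T sol.
have mD := open_measurable2 oD.
have WD2 : bounded_vorticity 2 (\1_D).
  by apply: bounded_vorticity_indic => // x x2 /D2; rewrite /eball /= ltNge x2.
pose R0 := `|r| + 2.
have R02 : 2 <= R0 by rewrite /R0 lerDr.
have Rr : r <= R0 by rewrite /R0 (le_trans (ler_norm r))// lerDl.
have WD := bounded_vorticity_widen R02 WD2.
have D0 x : 0 <= \1_D x :> R by rewrite indicE.
have HT s : 0 <= s <= T -> [/\ measurable_fun [set: plane] (omega s), bounded_vorticity R0 (w s) &
     {ae area, forall x, omega s x = rotating Omega (w s) s x}].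
  by move=> /H[? W _ ?]; split => //; exact: bounded_vorticity_widen Rr W.
have w0 s x : 0 <= s <= T -> 0 <= w s x by move=> /H[].
have [wsol _] := sol.
pose g1 x := spline' (level (relative_stream Omega (\1_K)) a kappa c x) * (rel1 Omega (\1_K) x / kappa).
pose g2 x := spline' (level (relative_stream Omega (\1_K)) a kappa c x) * (rel2 Omega (\1_K) x / kappa).
pose I s := \int[area]_x (w s x * advection Omega g1 g2 (w s) x).
pose defect v := patch_defect Omega a kappa c K v.
pose F t := defect (w t).
have FE t : 0 <= t <= T -> F t = defect (\1_D) - \int[lebesgue_measure]_(s in `[0, t]) I s.
  move=> tT; have /andP[t0 t1] := tT.
  have sT s : 0 <= s <= t -> 0 <= s <= T by move=> /andP[-> st]; exact: le_trans t1.
  have [_ Wt _] := HT t tT.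
  rewrite /F /defect (patch_defectE SP Wt (fun x => w0 t x tT)) (patch_defectE SP WD D0).
  rewrite (mass_conservation wsol WD HT tT).
  have := @weak_identity R Omega _ _ _ (patch_test SP) _ omega w t wsol t0
    (fun s st => let: And3 h _ _ := HT s (sT s st) in h)
    (fun s st => let: And3 _ h _ := HT s (sT s st) in ex_intro _ R0 h)
    (fun s st => let: And3 _ _ h := HT s (sT s st) in h).
  by rewrite /I /= => <-; ring.
pose N s := L1norm (fun x => w s x - \1_K x).
have N0 s : 0 <= N s by exact: L1norm_ge0.
(* a rough bound, which may depend on the solution: it only enters the length of
   the steps in the continuation argument *)
pose NQ := 8 * (`|R0| + 2) ^+ 2.
have NQ0 : 0 <= NQ by rewrite mulr_ge0// sqr_ge0.
have NB s : 0 <= s <= T -> N s <= NQ.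
  move=> sT; have [_ Ws _] := HT s sT.
  by apply: L1norm_le; [rewrite addr_ge0|exact: (deviation_vorticity SP Ws (fun x => w0 s x sT))].
have ln0 : 0 <= ln (1 + 10 / 1) :> R by rewrite ln_ge0// lerDl divr_ge0.
pose Q := C * (NQ ^+ 2 * (1 + ln (1 + 10 / 1)) + 8 * 1 ^+ 2 * NQ) + 1.
have Q0 : 0 < Q.
  rewrite ltr_wpDl// mulr_ge0 ?(ltW C0)// addr_ge0// mulr_ge0 ?sqr_ge0//.
  by rewrite addr_ge0.
have defect0 : defect (\1_D) <= Y 0 / 2.
  have [_ + _] := HD _ _ WD D0; move=> h; apply: (le_trans h).
  have rK : rotated (Omega * 0) (\1_K) = \1_K :> (R * R -> R).
    by apply/funext => x; rewrite /rotated mulr0 oppr0 rotation0.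
  rewrite -{1}rK (L1_dist_rotating (w := \1_D) (r := 2) _ WD2 WK) in dist; last 2 first.
  - by have [m _ _] := WD2.
  - by apply: aeW => x; rewrite /rotating mulr0 oppr0 rotation0.
  by move: dist; rewrite lee_fin; move: (L1norm _) => u; clear; lra.
pose sigma := Y 0 / (2 * Q).
have sigma0 : 0 < sigma by rewrite divr_gt0// mulr_gt0.
have start : defect (\1_D) + Q * sigma <= Y 0.
  have -> : Q * sigma = Y 0 / 2 by rewrite /sigma; field; rewrite gt_eqF.
  by clear -defect0; lra.
have NY s : 0 <= s <= T -> F s <= Y s -> N s <= (A + 1) * expR (lam s / 2).
  move=> sT FY; have [_ Ws _] := HT s sT.
  have [_ _ HN] := HD _ _ Ws (fun x => w0 s x sT).
  have y0 : 0 < expR (lam s / 2) by exact: expR_gt0.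
  have y1 : expR (lam s / 2) <= 1.
    rewrite expR_le1 pmulr_lle0 ?invr_gt0//; apply: le_trans lT0; apply: laml.
    by case/andP: sT.
  (* the width sqrt Y of the band balances its area and the defect outside *)
  have := HN (expR (lam s / 2)); rewrite y0 y1 => /(_ isT) h; apply: (le_trans h).
  rewrite [leRHS]mulrDl mul1r lerD2l ler_pdivrMr ?mulr_gt0//.
  have YE : Y s = expR (lam s / 2) * expR (lam s / 2) by rewrite -expRD /Y; congr expR; field.
  rewrite YE in FY; apply: (le_trans FY); rewrite ler_wpM2l ?(ltW y0)//.
  by rewrite ler_peMl// ?(ltW y0)//; clear -A0; lra.
have lams s : 0 <= s <= T -> lam s <= 0 by move=> /andP[_ sT]; exact: le_trans (laml s sT) lT0.
have compare : forall t, 0 <= t <= T -> F t <= Y t.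
  apply: (growth_comparison (ltW Q0) sigma0 start FE _ _ dY cG).
  - move=> s sT; have [_ Ws _] := HT s sT.
    have := HQ (w s) R0 1 Ws (fun x => w0 s x sT) ltr01.
    move=> h; apply: (le_trans h); rewrite /Q -[leLHS]addr0 lerD// ler_wpM2l ?(ltW C0)//.
    have nb := NB s sT; have n0 := N0 s; rewrite /N in nb n0.
    apply: lerD; last by rewrite ler_wpM2l// mulr_ge0// sqr_ge0.
    by apply: ler_wpM2r; [rewrite addr_ge0|rewrite lerXn2r ?nnegrE].
  - move=> s sT FY; have [_ Ws _] := HT s sT.
    apply: (osgood_rate (N := N s) C0 A0 (lams s sT) (N0 s) (NY s sT FY)).
    exact: HQ (w s) R0 _ Ws (fun x => w0 s x sT) (expR_gt0 _).
  - move=> s sT; rewrite mulr_ge0//; first by rewrite mulr_ge0 ?expR_ge0// ltW.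
    have := lams s sT; clear -b0; lra.
move=> t tT; have [mt Wt at'] := HT t tT.
rewrite (L1_dist_rotating mt Wt (bounded_vorticity_widen R02 WK) at') lee_fin -/(N t).
apply: (le_trans (NY t tT (compare t tT))).
rewrite -ler_pdivlMl// [leRHS]mulrC -[leRHS]lnK ?posrE// ler_expR.
have /andP[_ tT'] := tT; have := laml t tT'; clear -lT1; lra.
Qed.

End stability.

Theorem theorem1p1 (R : realType) (m : nat) (hm : (2 <= m)%N)
    (g : R -> R -> R) (Omega : R -> R) (hK : kelvin_family m g Omega) :
  exists beta1 r' : R, [/\ 0 < beta1, 1 < r' &
    forall beta eps T : R, 0 < beta <= beta1 -> 0 < eps -> 0 < T ->
    exists2 delta : R, 0 < delta &
    forall A0 : set (R * R),
      open A0 -> fold_symmetric m A0 ->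
      (L1_dist \1_A0 (kelvin_wave (g beta)) <= delta%:E)%E ->
      A0 `<=` eball r' ->
    forall omega : R -> R * R -> R, yudovich_solution A0 omega ->
      (ereal_sup [set L1_dist (omega t)
                        (rotated (Omega beta * t) (kelvin_wave (g beta)))
                 | t in `[0%R, T]] <= eps%:E)%E].
Proof.
have [beta1 beta10 patch] := kelvin_stable_patch hm hK.
exists beta1, 2; split => //; first by rewrite ltr1n.
move=> beta eps T betab eps0 T0.
have [a [k [kappa [c SP]]]] := patch beta betab.
have [delta delta0 stable] := patch_stability SP eps0 T0.
exists delta => // A0 oA _ dist A2 omega sol.
apply: ge_ereal_sup => _ [t tT <-].
by apply: (stable A0 oA A2 dist omega sol); move: tT; rewrite /= in_itv.
Qed.
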